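(* Let $Y$ be a Lévy process in $\mathbb{R}^d$ with generating triplet $(A,N,b)$ and with $h(0^+)=\infty$. The following four conditions are equivalent. (C1) The density $p(t,x)$ of $Y_t$ exists and there are $T_1\in(0,\infty]$, $c_1>0$ such that for all $0<t<T_1$, $$\sup_{x\in\mathbb{R}^d}p(t,x)\le c_1\,[h^{-1}(1/t)]^{-d}.$$ (C2) There are $T_2\in(0,\infty]$, $c_2>0$ such that for all $0<t<T_2$, $$\int_{\mathbb{R}^d}e^{-t\,\mathrm{Re}[\Psi(z)]}\,dz\le c_2\,[h^{-1}(1/t)]^{-d}.$$ (C3) There are $T_3\in(0,\infty]$, $c_3\in(0,1]$ and $\alpha_3\in(0,2]$ such that $c_3\Psi^*(|x|)\le \mathrm{Re}[\Psi(x)]$ for all $|x|>1/T_3$, and $\Psi^*(\lambda r)\ge c_3\lambda^{\alpha_3}\Psi^*(r)$ for all $\lambda\ge1$, $r>1/T_3$. (C4) There are $T_4\in(0,\infty]$, $c_4\in[1,\infty)$ such that for all $|x|>1/T_4$, $$\Psi^*(|x|)\le c_4\Big(\langle x,Ax\rangle+\int_{|\langle x,z\rangle|<1}|\langle x,z\rangle|^2N(dz)\Big).$$ Moreover, if one of these conditions holds with $T_i=\infty$ for some $i\in\{1,2,3,4\}$, then all of them hold with $T_i=\infty$, $i=1,\dots,4$.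
   Context: $Y=(Y_t)_{t\ge0}$ is a Lévy process in $\mathbb{R}^d$, $d\in\mathbb{N}$, with generating triplet $(A,N,b)$: $A$ is a symmetric non-negative definite $d\times d$ matrix, $b\in\mathbb{R}^d$, and $N$ is a Lévy measure (Borel measure with $N(\{0\})=0$, $\int(1\wedge|z|^2)N(dz)<\infty$). The characteristic exponent $\Psi$ is given by $\mathbb{E}e^{i\langle x,Y_t\rangle}=e^{-t\Psi(x)}$, $$\Psi(x)=\langle x,Ax\rangle-i\langle x,b\rangle-\int_{\mathbb{R}^d}\big(e^{i\langle x,z\rangle}-1-i\langle x,z\rangle\mathbf{1}_{|z|<1}\big)N(dz).$$ For $r>0$, $h(r)=r^{-2}\|A\|+\int_{\mathbb{R}^d}\big(1\wedge\frac{|x|^2}{r^2}\big)N(dx)$ and $\Psi^*(r)=\sup_{|z|\le r}\mathrm{Re}[\Psi(z)]$. Standing assumption: $h(0^+)=\infty$; then $h$ is a continuous strictly decreasing bijection of $(0,\infty)$ onto $(0,\infty)$ with inverse $h^{-1}$. Convention: $1/\infty=0$. $p(t,\cdot)$ is the density of the law of $Y_t$ with respect to Lebesgue measure (if $e^{-t\Psi}$ is integrable, it is the continuous one given by Fourier inversion). *)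

(* Defs.v *)
From HB Require Import structures.
From mathcomp Require Import all_boot all_order all_algebra.
From mathcomp Require Import complex.
From mathcomp Require Import all_classical all_reals all_analysis.
From mathcomp Require Import measurable_realfun.

Set Implicit Arguments.
Unset Strict Implicit.
Unset Printing Implicit Defensive.

Import Order.TTheory GRing.Theory Num.Theory.
Import numFieldNormedType.Exports.

Local Open Scope classical_set_scope.
Local Open Scope ring_scope.
Local Open Scope complex_scope.

(* Vectors of R^d are row vectors 'rV[R]_d. The norm `|x| that the library
   puts on matrices is the maximum norm, hence the separate Euclidean norm. *)
Definition dotv (R : realType) (d : nat) (x y : 'rV[R]_d) : R :=
  \sum_(i < d) x ord0 i * y ord0 i.

Definition enorm (R : realType) (d : nat) (x : 'rV[R]_d) : R :=
  Num.sqrt (dotv x x).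

(* On row vectors x |-> x *m A is the action of the transpose of A, so that
   qform A x = <x, A x>, and opnorm A is the operator norm of A with respect
   to the Euclidean norm. *)
Definition qform (R : realType) (d : nat) (A : 'M[R]_d) (x : 'rV[R]_d) : R :=
  dotv x (x *m A).

Definition opnorm (R : realType) (d : nat) (A : 'M[R]_d) : R :=
  sup [set enorm (x *m A) | x in [set x : 'rV[R]_d | enorm x <= 1]].

Definition rV_display : measure_display.
Proof. exact. Qed.

Section borel_rV.
Context {R : realType} {n : nat}.

Let borel := <<s [set U : set 'rV[R]_n | open U] >>.

Let borel0 : borel set0. Proof. exact: sigma_algebra0. Qed.

Let borelC (B : set 'rV[R]_n) : borel B -> borel (~` B).
Proof. exact: sigma_algebraC. Qed.

Let borel_bigcup (F : (set 'rV[R]_n)^nat) :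
  (forall i, borel (F i)) -> borel (\bigcup_i F i).
Proof. exact: sigma_algebra_bigcup. Qed.

HB.instance Definition _ :=
  @isMeasurable.Build rV_display 'rV[R]_n borel borel0 borelC borel_bigcup.

End borel_rV.

Lemma measurable_fun_rV (R : realType) (n : nat) (d : measure_display)
    (T : measurableType d) (f : T -> 'rV[R]_n) :
  (forall i, measurable_fun setT (fun w => f w ord0 i)) ->
  measurable_fun setT f.
Proof.
move=> mf; apply: (measurability [set U : set 'rV[R]_n | open U]) => //.
move=> _ [U oU <-]; rewrite setTI.
pose box (p : 'rV[rat]_n * nat) : set 'rV[R]_n :=
  [set v | forall i, ball (ratr (p.1 ord0 i) : R) p.2.+1%:R^-1 (v ord0 i)].
pose V p := if pselect (box p `<=` U) then box p else set0.
have -> : f @^-1` U = \bigcup_p (f @^-1` V p).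
  rewrite -preimage_bigcup; congr (_ @^-1` _); apply/seteqP; split => v; last first.
    by move=> [p _]; rewrite /V; case: pselect => // bU Vv; exact: (bU _ Vv).
  move=> Uv; have /nbhs_ballP[e /= e0 veU] : nbhs v U by exact: open_nbhs_nbhs.
  have [k] := ltr_add_invr (divr_gt0 e0 (ltr0Sn R 1)); rewrite add0r => ke.
  have ratv (i : 'I_n) : exists r : rat, ball (ratr r : R) k.+1%:R^-1 (v ord0 i).
    have := @dense_rat R (ball (v ord0 i) k.+1%:R^-1).
    case=> [||y [vy [r _ ry]]].
    - by exists (v ord0 i); apply: ballxx; rewrite invr_gt0.
    - exact: ball_open.
    - by exists r; rewrite ry; exact: ball_sym.
  have [q vq] := choice ratv.
  exists (\row_i q i, k) => //; rewrite /V.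
  have boxv : box (\row_i q i, k) v by move=> i /=; rewrite mxE; exact: vq.
  case: pselect => // -[] u boxu; apply: veU; split => // i j; rewrite ord1.
  apply: (@ball_split _ _ (ratr (q j) : R)).
    apply/ball_sym; exact: le_ball (ltW ke) _ (vq j).
  by have /= := boxu j; rewrite mxE; apply: le_ball (ltW ke) _.
apply: countable_bigcupT_measurable => // p; rewrite /V.
case: pselect => boxU; last by rewrite preimage_set0.
have -> : f @^-1` box p = \bigcap_(i in [set: 'I_n])
    (setT `&` (fun w => f w ord0 i) @^-1` ball (ratr (p.1 ord0 i) : R) p.2.+1%:R^-1).
  apply/seteqP; split => [w bw i _|w bw i]; first by split => //; exact: bw.
  by have [] := bw i Logic.I.
apply: fin_bigcap_measurable => // i _.
by apply: mf => //; exact: measurable_realfun.measurable_ball.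
Qed.

Lemma measurable_coord_rV (R : realType) (n : nat) (i : 'I_n) :
  measurable_fun setT (fun v : 'rV[R]_n => v ord0 i).
Proof.
apply: (measurability _ (RGenOpens.measurableE R)) => _ [_ [a [b ->] <-]].
rewrite setTI; apply: sub_sigma_algebra.
apply: open_comp; last exact: interval_open.
by move=> v _; exact: coord_continuous.
Qed.

Definition cons_rV (R : realType) (n : nat) (u : R * 'rV[R]_n) : 'rV[R]_n.+1 :=
  \row_(i < n.+1) (if unlift ord0 i is Some j then u.2 ord0 j else u.1).

Lemma measurable_cons_rV (R : realType) (n : nat) :
  measurable_fun setT (@cons_rV R n).
Proof.
apply: measurable_fun_rV => i; case: (unliftP ord0 i) => [j|] ->.
  under eq_fun do rewrite mxE liftK.
  exact: (measurableT_comp (@measurable_coord_rV R n j) measurable_snd).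
under eq_fun do rewrite mxE unlift_none.
exact: measurable_fst.
Qed.


Section lebesgue_cons.
Context {R : realType} {n : nat}.
Variable mu : {measure set 'rV[R]_n -> \bar R}.

Definition lebesgue_cons : set 'rV[R]_n.+1 -> \bar R :=
  pushforward (@lebesgue_measure R \x^ mu)%E (@cons_rV R n).

HB.instance Definition _ := Measure.copy lebesgue_cons
  (measure_function_pushforward__canonical__measure_function_Measure
    (@lebesgue_measure R \x^ mu)%E (@measurable_cons_rV R n)).

End lebesgue_cons.

(* Lebesgue measure on R^n, i.e. the n-fold product of Lebesgue measure on R
   transported to row vectors. *)
Fixpoint lebesgue_rV (R : realType) (n : nat) :
    {measure set 'rV[R]_n -> \bar R} :=
  match n with
  | 0%N => dirac (0 : 'rV[R]_0)
  | m.+1 => lebesgue_cons (lebesgue_rV R m)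
  end.

Lemma measurable_box (R : realType) (n : nat) (B : 'I_n -> set R) :
  (forall i, measurable (B i)) ->
  measurable [set v : 'rV[R]_n | forall i, B i (v ord0 i)].
Proof.
move=> mB; have -> : [set v : 'rV[R]_n | forall i, B i (v ord0 i)] =
    \bigcap_(i in [set: 'I_n]) (setT `&` (fun v : 'rV[R]_n => v ord0 i) @^-1` B i).
  apply/seteqP; split => [v Bv i _|v Bv i]; first by split => //; exact: Bv.
  by have [] := Bv i Logic.I.
by apply: fin_bigcap_measurable => // i _; exact: measurable_coord_rV.
Qed.

Lemma lebesgue_rV_box (R : realType) (n : nat) (B : 'I_n -> set R) :
  (forall i, measurable (B i)) ->
  lebesgue_rV R n [set v | forall i, B i (v ord0 i)] =
  (\prod_(i < n) lebesgue_measure (B i))%E.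
Proof.
elim: n B => [|n IHn] B mB /=.
  by rewrite big_ord0 diracE mem_set// => -[].
rewrite /lebesgue_cons /pushforward big_ord_recl -IHn; last first.
  by move=> i; exact: mB.
rewrite -product_measure2E//; [|exact: mB|]; last first.
  by apply: (@measurable_box R n (fun i => B (lift ord0 i))) => i; exact: mB.
congr (_ _); apply/seteqP; split => -[x v] /=.
  move=> Bv; split; first by have := Bv ord0; rewrite mxE unlift_none.
  by move=> i; have := Bv (lift ord0 i); rewrite mxE liftK.
by move=> [Bx Bv] i; rewrite mxE; case: unliftP => [j|] -> //=.
Qed.

(* Without these the names would refer to the projections Num.Re and Num.Im,
   whose values are complex numbers. *)
Local Notation Re := complex.Re.
Local Notation Im := complex.Im.

Definition cexp (R : realType) (z : R[i]) : R[i] :=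
  (expR (Re z))%:C * (cos (Im z) +i* sin (Im z)).

(* Integration of complex-valued functions, componentwise. *)
Definition cintegrable (disp : measure_display) (T : measurableType disp)
    (R : realType) (mu : {measure set T -> \bar R}) (f : T -> R[i]) : Prop :=
  mu.-integrable setT (fun x => (Re (f x))%:E) /\
  mu.-integrable setT (fun x => (Im (f x))%:E).

Definition cintegral (disp : measure_display) (T : measurableType disp)
    (R : realType) (mu : {measure set T -> \bar R}) (f : T -> R[i]) : R[i] :=
  (\int[mu]_x Re (f x)) +i* (\int[mu]_x Im (f x)).

Record generating_triplet (R : realType) (d : nat) (A : 'M[R]_d)
    (N : {measure set 'rV[R]_d -> \bar R}) (b : 'rV[R]_d) : Prop := {
  triplet_sym : A^T = A;
  triplet_nneg : forall x : 'rV[R]_d, 0 <= qform A x;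
  triplet_atom0 : N [set 0] = 0%E;
  triplet_levy : (\int[N]_z (Num.min 1 (enorm z ^+ 2))%:E < +oo)%E
}.

Definition Psi (R : realType) (d : nat) (A : 'M[R]_d)
    (N : {measure set 'rV[R]_d -> \bar R}) (b x : 'rV[R]_d) : R[i] :=
  (qform A x)%:C - 'i%C * (dotv x b)%:C
  - cintegral N (fun z => cexp ('i%C * (dotv x z)%:C) - 1
      - 'i%C * (dotv x z * \1_[set z | enorm z < 1] z)%:C).

Definition Psi_star (R : realType) (d : nat) (A : 'M[R]_d)
    (N : {measure set 'rV[R]_d -> \bar R}) (b : 'rV[R]_d) (r : R) : R :=
  sup [set Re (Psi A N b z) | z in [set z : 'rV[R]_d | enorm z <= r]].

Definition hfun (R : realType) (d : nat) (A : 'M[R]_d)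
    (N : {measure set 'rV[R]_d -> \bar R}) (r : R) : R :=
  r ^- 2 * opnorm A + \int[N]_x Num.min 1 (enorm x ^+ 2 / r ^+ 2).

(* The inverse of hfun on the positive half-line. *)
Definition hinv (R : realType) (d : nat) (A : 'M[R]_d)
    (N : {measure set 'rV[R]_d -> \bar R}) (s : R) : R :=
  xget 0 [set r | 0 < r /\ hfun A N r = s].

Section levy.
Context {disp : measure_display} {Omega : measurableType disp} {R : realType}.
Variables (P : probability Omega R) (d : nat).

Definition mutually_independent (n : nat) (X : 'I_n -> Omega -> 'rV[R]_d) : Prop :=
  forall B : 'I_n -> set 'rV[R]_d, (forall i, measurable (B i)) ->
    P [set w | forall i, B i (X i w)] =
    (\prod_(i < n) P [set w | B i (X i w)])%E.

(* A process is indexed by R; only the times t >= 0 are ever used. *)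
Variable Y : R -> {mfun Omega >-> 'rV[R]_d}.

(* The variables Y_(t 0), Y_(t 1) - Y_(t 0), Y_(t 2) - Y_(t 1), ... *)
Definition increment (t : nat -> R) (i : nat) (w : Omega) : 'rV[R]_d :=
  if i is j.+1 then Y (t j.+1) w - Y (t j) w else Y (t 0%N) w.

Record levy_process : Prop := {
  levy_start : {ae P, forall w, Y 0 w = 0};
  levy_independent_increments : forall (n : nat) (t : nat -> R),
    0 <= t 0%N -> (forall i, (i < n)%N -> t i < t i.+1) ->
    mutually_independent (fun i : 'I_n.+1 => increment t i);
  levy_stationary_increments : forall (s t : R) (B : set 'rV[R]_d),
    0 <= s -> 0 <= t -> measurable B ->
    P [set w | B (Y (s + t) w - Y s w)] = P [set w | B (Y t w - Y 0 w)];
  levy_stochastically_continuous : forall (t e : R), 0 <= t -> 0 < e ->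
    P [set w | e < enorm (Y s w - Y t w)]
      @[s --> within [set s | 0 <= s] (nbhs t)] --> 0%E;
  levy_cadlag : {ae P, forall w,
    (forall t : R, 0 <= t -> Y s w @[s --> t^'+] --> Y t w) /\
    (forall t : R, 0 < t -> cvg (Y s w @[s --> t^'-]))}
}.

Definition has_exponent (psi : 'rV[R]_d -> R[i]) : Prop :=
  forall (t : R) (x : 'rV[R]_d), 0 <= t ->
    cintegral P (fun w => cexp ('i%C * (dotv x (Y t w))%:C)) =
    cexp (- t%:C * psi x).

Definition is_density (t : R) (f : 'rV[R]_d -> R) : Prop :=
  [/\ (forall x, 0 <= f x), measurable_fun setT f &
    forall B, measurable B ->
      distribution P (Y t) B = (\int[lebesgue_rV R d]_(x in B) (f x)%:E)%E].

(* p t is a density of Y_t for every t > 0, namely the continuous one given by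
   Fourier inversion as soon as exp(- t psi) is integrable. *)
Definition transition_density (psi : 'rV[R]_d -> R[i])
    (p : R -> 'rV[R]_d -> R) : Prop :=
  forall t : R, 0 < t ->
    is_density t (p t) /\
    (cintegrable (lebesgue_rV R d) (fun z => cexp (- t%:C * psi z)) ->
     forall x, (p t x)%:C = ((2 * pi) ^- d)%:C *
       cintegral (lebesgue_rV R d)
         (fun z => cexp (- ('i%C * (dotv x z)%:C)) * cexp (- t%:C * psi z))).

End levy.

(* In the conditions below T ranges over ]0, +oo], and T^-1 is 0 for T = +oo. *)
Section conditions.
Context {disp : measure_display} {Omega : measurableType disp} {R : realType}.
Variables (P : probability Omega R) (d : nat).
Variable Y : R -> {mfun Omega >-> 'rV[R]_d}.
Variables (A : 'M[R]_d) (N : {measure set 'rV[R]_d -> \bar R}) (b : 'rV[R]_d).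

Definition C1 (T : \bar R) : Prop :=
  exists p, transition_density P Y (Psi A N b) p /\
  exists2 c : R, 0 < c &
    forall t : R, 0 < t -> (t%:E < T)%E ->
      (ereal_sup [set (p t x)%:E | x in setT] <=
        (c * hinv A N t^-1 ^- d)%:E)%E.

Definition C2 (T : \bar R) : Prop :=
  exists2 c : R, 0 < c &
    forall t : R, 0 < t -> (t%:E < T)%E ->
      (\int[lebesgue_rV R d]_z (expR (- t * Re (Psi A N b z)))%:E <=
        (c * hinv A N t^-1 ^- d)%:E)%E.

Definition C3 (T : \bar R) : Prop :=
  exists c alpha : R, [/\ 0 < c <= 1, 0 < alpha <= 2,
    (forall x : 'rV[R]_d, (T^-1 < (enorm x)%:E)%E ->
      c * Psi_star A N b (enorm x) <= Re (Psi A N b x)) &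
    (forall lambda r : R, 1 <= lambda -> (T^-1 < r%:E)%E ->
      c * lambda `^ alpha * Psi_star A N b r <= Psi_star A N b (lambda * r))].

Definition C4 (T : \bar R) : Prop :=
  exists2 c : R, 1 <= c &
    forall x : 'rV[R]_d, (T^-1 < (enorm x)%:E)%E ->
      Psi_star A N b (enorm x) <=
        c * (qform A x +
          \int[N]_(z in [set z | `|dotv x z| < 1]) (`|dotv x z| ^+ 2)).

End conditions.

(* Main.v *)
(* Write psi = Re Psi and h for the concentration function. Averaging
   1 - cos over segments on the coordinate axes shows that Psi*(r) and h(1/r)
   are comparable up to constants depending on d only.

   (C1) => (C2). If S bounds the density of Y_t, Parseval's identity with a
   Laplace kernel bounds the integral of |E exp(i<z,Y_t>)|^2 = exp(-2 t psi(z))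
   by S (2 pi)^d. Comparing this with the volume of a large cube, on which
   t psi is bounded, forces h to double over a fixed factor, and this turns
   the bound at t/2 into (C2) at t.
   (C2) => (C1). Fourier inversion, by letting the Laplace kernel tend to 1;
   the law is compared with its density on boxes.
   (C2) => (C3). The doubling of h gives the growth of Psi*. If psi(x) were
   much smaller than Psi*(|x|), psi would be small around many multiples of x,
   and the integral of exp(-t psi) would be too large.
   (C3) => (C2). exp(-t psi) is at most a constant times a product of Cauchy
   kernels at scale 1/h^{-1}(1/t).
   (C3) <=> (C4). The truncated form in (C4) controls, from both sides, the
   increments of r |-> <rx,A rx> + int min(1, <rx,z>^2) N(dz). So (C4) forces
   this function, hence h, to grow geometrically, and conversely (C3) makes it
   grow by an amount comparable to Psi*(|x|) over a fixed factor.

   The exponent matters only through psi and through the law of each Y_t. *)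
From HB Require Import structures.
Require Import Defs.
From mathcomp Require Import all_boot all_order all_algebra.
From mathcomp Require Import complex ring lra.
From mathcomp Require Import all_classical all_reals all_analysis.
From mathcomp Require Import measurable_realfun.

Import Order.TTheory GRing.Theory Num.Theory.
Import numFieldNormedType.Exports.

Local Open Scope classical_set_scope.
Local Open Scope ring_scope.

Set Implicit Arguments.
Unset Strict Implicit.
Unset Printing Implicit Defensive.

(** * Trigonometric bounds *)

Section trigonometric_bounds.
Context {R : realType}.
Implicit Types u v x y : R.

(** A small value of psi at x spreads to neighbourhoods of the multiples of x through two
    inequalities, psi(x + y) <= 2 psi(x) + 2 psi(y) and psi(k x) <= k^2 psi(x) for natural k. Both
    hold pointwise for 1 - cos. The kernel exp(-e (|z_1| + ... + |z_d|)) is used instead of a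
    Gaussian because it and its Fourier transform, a product of Cauchy kernels, have elementary
    antiderivatives: the transform is computed coordinate by coordinate, and a Cauchy kernel
    integrates over an interval to a difference of arctangents, whose limit is explicit. The decay
    |x|^-2 of a Cauchy kernel is also slow enough to dominate exp(-t psi) under (C3). Times below T
    correspond to frequencies above 1/h^{-1}(1/T). Hence T is kept between (C1) and (C2) and between
    (C3) and (C4), but changes between (C2) and (C3). In the variable 1/T both ranges are unbounded
    from a point u >= 0 on, and T = oo is u = 0 on either side; this is why the conditions are
    restated with a real parameter. *)

Lemma abs_sin_le x : `|sin x| <= `|x|.
Proof.
wlog x0 : x / 0 <= x.
  move=> H; case: (leP 0 x) => [|x0]; first exact: H.
  by have := H (- x); rewrite sinN !normrN; apply; rewrite oppr_ge0 ltW.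
have [c _ E] : exists2 c, c \in `[0, x]%R & sin x - sin 0 = cos c * (x - 0).
  apply: MVT_segment => //.
  by apply: continuous_subspaceT => z; exact: continuous_sin.
move: E; rewrite sin0 !subr0 => ->.
by rewrite normrM ler_piMl// cos_max.
Qed.

Lemma one_sub_cos u : 1 - cos u = 2 * sin (u / 2) ^+ 2.
Proof.
have -> : cos u = cos (u / 2 *+ 2) by rewrite -mulr_natr divfK ?pnatr_eq0.
by rewrite cos_mulr2n cos2sin2; ring.
Qed.

Lemma one_sub_cos_ge0 u : 0 <= 1 - cos u.
Proof. by rewrite subr_ge0 cos_le1. Qed.

Lemma one_sub_cos_le_sqr u : 1 - cos u <= u ^+ 2 / 2.
Proof.
rewrite one_sub_cos.
have : sin (u / 2) ^+ 2 <= (u / 2) ^+ 2.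
  by rewrite -real_normK ?num_real// -[leRHS]real_normK ?num_real// lerXn2r ?nnegrE// abs_sin_le.
by nra.
Qed.

Lemma one_sub_cos_le_min u : 1 - cos u <= 2 * Num.min 1 (u ^+ 2).
Proof.
have := one_sub_cos_le_sqr u; have := cos_geN1 u; have := sqr_ge0 u.
by case: (leP 1 (u ^+ 2)) => *; lra.
Qed.

(** By the mean value theorem, since cos >= 1/2 on [0, 1]. *)
Lemma abs_sin_ge x : `|x| <= 1 -> `|x| / 2 <= `|sin x|.
Proof.
wlog x0 : x / 0 <= x.
  move=> H; case: (leP 0 x) => [|x0]; first exact: H.
  by have := H (- x); rewrite sinN !normrN; apply; rewrite oppr_ge0 ltW.
rewrite (ger0_norm x0) => x1.
have [c] : exists2 c, c \in `[0, x]%R & sin x - sin 0 = cos c * (x - 0).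
  apply: MVT_segment => //.
  by apply: continuous_subspaceT => z; exact: continuous_sin.
rewrite in_itv/= sin0 !subr0 => /andP[c0 cx] ->.
have := one_sub_cos_le_sqr c; rewrite normrM (ger0_norm x0).
have c2 : c ^+ 2 <= 1 by rewrite expr_le1//; lra.
have := ler_norm (cos c) => ? ?.
have c12 : 1/2 <= `|cos c| by lra.
by have := ler_wpM2r x0 c12; lra.
Qed.

Lemma one_sub_cos_ge u : `|u| <= 2 -> u ^+ 2 / 8 <= 1 - cos u.
Proof.
move=> u2; rewrite one_sub_cos.
have h : `|u / 2| <= 1 by rewrite normrM (@ger0_norm _ 2^-1)//; lra.
have := abs_sin_ge h; rewrite normrM (@ger0_norm _ 2^-1)// => h1.
have : (`|u| / 2 / 2) ^+ 2 <= `|sin (u / 2)| ^+ 2.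
  by rewrite lerXn2r// nnegrE// !divr_ge0.
rewrite real_normK ?num_real// !exprMn real_normK ?num_real//; by lra.
Qed.

(** With p = sin(u/2) cos(v/2) and q = cos(u/2) sin(v/2) this is (p + q)^2 <= 2 p^2 + 2 q^2 followed
    by cos^2 <= 1. Integrated against N it gives [rePsiD]. *)
Lemma one_sub_cosD u v :
  1 - cos (u + v) <= 2 * (1 - cos u) + 2 * (1 - cos v).
Proof.
rewrite !one_sub_cos (mulrDl u v) sinD.
have := sin2cos2 (u / 2); have := sin2cos2 (v / 2).
set a := sin (u / 2); set b := sin (v / 2).
set a' := cos (u / 2); set b' := cos (v / 2) => e1 e2.
have : 0 <= (a * b' - a' * b) ^+ 2 by exact: sqr_ge0.
have E1 : a' ^+ 2 = 1 - a ^+ 2 by lra.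
have E2 : b' ^+ 2 = 1 - b ^+ 2 by lra.
have -> : (a * b' - a' * b) ^+ 2 = a ^+ 2 * b' ^+ 2 + a' ^+ 2 * b ^+ 2 - 2 * (a * b' * a' * b) by ring.
have -> : (a * b' + a' * b) ^+ 2 = a ^+ 2 * b' ^+ 2 + a' ^+ 2 * b ^+ 2 + 2 * (a * b' * a' * b) by ring.
rewrite E1 E2.
have : 0 <= a ^+ 2 * b ^+ 2 by rewrite mulr_ge0 ?sqr_ge0.
by lra.
Qed.

Lemma abs_sin_mulrn (k : nat) v : `|sin (v *+ k)| <= `|sin v| *+ k.
Proof.
elim: k => [|k IH]; first by rewrite mulr0n sin0 normr0.
rewrite mulrS sinD mulrS (le_trans (ler_normD _ _))//.
rewrite !normrM lerD//; first by rewrite ler_piMr// cos_max.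
by rewrite (le_trans _ IH)// ler_piMl// cos_max.
Qed.

(** From |sin(k v)| <= k |sin v|; integrated against N it bounds the exponent at integer multiples
    of a point. *)
Lemma one_sub_cos_mulrn (k : nat) u :
  1 - cos (k%:R * u) <= k%:R ^+ 2 * (1 - cos u).
Proof.
rewrite !one_sub_cos.
have -> : k%:R * u / 2 = u / 2 *+ k by rewrite -mulrA mulr_natl.
have : `|sin (u / 2 *+ k)| ^+ 2 <= (`|sin (u / 2)| *+ k) ^+ 2.
  by rewrite lerXn2r ?nnegrE ?mulrn_wge0// abs_sin_mulrn.
rewrite -(mulr_natl `|_|) exprMn !real_normK ?num_real//; by lra.
Qed.

(** u - sin u is the integral of 1 - cos over [0, u]. For u <= 2 it dominates u^3 / 24, because
    [one_sub_cos_ge] makes the difference nondecreasing; for u > 2 the bound sin u <= 1 is enough.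
    The constant 96 is not sharp. *)
Lemma sub_sin_ge u : 0 < u -> u * Num.min 1 (u ^+ 2) / 96 <= u - sin u.
Proof.
move=> u0; have [u2|u2] := leP u 2; last first.
  have := sin_le1 u; have : u * Num.min 1 (u ^+ 2) <= u * 1.
    by apply: ler_wpM2l; [exact: ltW|rewrite ge_min lexx].
  by lra.
have [c] : exists2 c, c \in `]0, u[%R &
    (fun y => y - sin y - y ^+ 3 / 24) u - (fun y => y - sin y - y ^+ 3 / 24) 0
    = (1 - cos c - c ^+ 2 / 8) * (u - 0).
  apply: (@MVT R (fun y => y - sin y - y ^+ 3 / 24)
     (fun c => 1 - cos c - c ^+ 2 / 8)) => //.
    move=> z _; apply: is_derive_eq.
    by rewrite /GRing.scale/= mulr1; field.
  apply: continuous_subspaceT => z.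
  apply: differentiable_continuous; apply/derivable1_diffP.
  by apply: ex_derive.
rewrite in_itv/= => /andP[c0 cu] /=.
rewrite sin0 expr0n/= mul0r !subr0 => E.
have : 0 <= (1 - cos c - c ^+ 2 / 8) * u.
  apply: mulr_ge0; last lra.
  by have := @one_sub_cos_ge c; rewrite ger0_norm ?subr_ge0; [move=> /(_ _); apply; lra|lra].
rewrite -E => h.
have : u * Num.min 1 (u ^+ 2) <= u * u ^+ 2.
  by apply: ler_wpM2l; [exact: ltW|rewrite ge_min lexx orbT].
have : 0 <= u ^+ 3 by rewrite exprn_ge0// ltW.
rewrite -exprS; by lra.
Qed.

End trigonometric_bounds.

(** Evaluation at the minimiser t = - b / c, once c = 0 and c < 0 are dealt with. The degenerate
    case c = 0 occurs because the forms to come are only semi-definite. *)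
Lemma discriminant_le0 (R : realFieldType) (a b c : R) :
  (forall t, 0 <= a + 2 * b * t + c * t ^+ 2) -> b ^+ 2 <= a * c.
Proof.
move=> H; have [c0|c0] := eqVneq c 0.
  rewrite c0 mulr0; have [->|b0] := eqVneq b 0; first by rewrite expr0n.
  have := H (- (a + 1) / (2 * b)).
  have -> : a + 2 * b * (- (a + 1) / (2 * b)) + c * (- (a + 1) / (2 * b)) ^+ 2 = -1.
    by rewrite c0 mul0r addr0; field.
  by rewrite lerNr oppr0 ler10.
have cp : 0 < c.
  rewrite lt_neqAle eq_sym c0/= leNgt; apply/negP => cn.
  (* For c < 0 a parameter this large makes the polynomial negative. *)
  pose m : R := Num.max 1 ((`|a| + 2 * `|b| + 1) / - c).
  have := H m; rewrite leNgt => /negP; apply.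
  have m1 : 1 <= m by rewrite le_max lexx.
  have : (`|a| + 2 * `|b| + 1) / - c <= m by rewrite le_max lexx orbT.
  rewrite ler_pdivrMr ?oppr_gt0// => hm.
  have := ler_norm a; have := ler_norm b; move: hm.
  have := normr_ge0 b; have := normr_ge0 a.
  move: (`|a|) (`|b|) => a' b' a0 b'0 h1 h2 h3; nra.
have := H (- b / c).
have -> : a + 2 * b * (- b / c) + c * (- b / c) ^+ 2 = (a * c - b ^+ 2) / c by field.
by rewrite pmulr_lge0 ?invr_gt0// subr_ge0.
Qed.

(** * Euclidean norm and quadratic forms *)

Section euclidean.
Context {R : realType} {d : nat}.
Implicit Types (x y z : 'rV[R]_d) (A : 'M[R]_d).

Lemma dotvC x y : dotv x y = dotv y x.
Proof. by apply: eq_bigr => i _; rewrite mulrC. Qed.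

Lemma dotvDl x y z : dotv (x + y) z = dotv x z + dotv y z.
Proof. by rewrite -big_split; apply: eq_bigr => i _; rewrite mxE mulrDl. Qed.

Lemma dotvZl (k : R) x z : dotv (k *: x) z = k * dotv x z.
Proof. by rewrite mulr_sumr; apply: eq_bigr => i _; rewrite mxE mulrA. Qed.

Lemma dotvDr x y z : dotv x (y + z) = dotv x y + dotv x z.
Proof. by rewrite dotvC dotvDl !(dotvC x). Qed.

Lemma dotvZr (k : R) x z : dotv x (k *: z) = k * dotv x z.
Proof. by rewrite dotvC dotvZl dotvC. Qed.

Lemma dotvBr x y z : dotv x (y - z) = dotv x y - dotv x z.
Proof. by rewrite -scaleN1r dotvDr dotvZr mulN1r. Qed.

Lemma dotv_ge0 x : 0 <= dotv x x.
Proof. by apply: sumr_ge0 => i _; rewrite -expr2 sqr_ge0. Qed.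

Lemma dotv_delta (s : R) (i : 'I_d) x : dotv (s *: delta_mx ord0 i) x = s * x ord0 i.
Proof.
rewrite dotvZl; congr (_ * _); rewrite /dotv (bigD1 i)//= mxE !eqxx mul1r.
by rewrite big1 ?addr0// => j ji; rewrite mxE (negPf ji) mul0r.
Qed.

Lemma enorm_ge0 x : 0 <= enorm x. Proof. exact: sqrtr_ge0. Qed.

Lemma sqr_enorm x : enorm x ^+ 2 = dotv x x.
Proof. by rewrite sqr_sqrtr// dotv_ge0. Qed.

Lemma enormZ (k : R) x : enorm (k *: x) = `|k| * enorm x.
Proof.
by rewrite /enorm dotvZl dotvZr mulrA -expr2 sqrtrM ?sqr_ge0// sqrtr_sqr.
Qed.

Lemma enorm0 : enorm (0 : 'rV[R]_d) = 0.
Proof. by rewrite -(scale0r 0) enormZ normr0 mul0r. Qed.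

Lemma enorm_eq0 x : enorm x = 0 -> x = 0.
Proof.
move=> x0; apply/rowP => i; rewrite mxE.
have : dotv x x = 0 by rewrite -sqr_enorm x0 expr0n.
move/eqP; rewrite psumr_eq0 => [|j _]; last by rewrite -expr2 sqr_ge0.
by move=> /allP/(_ i); rewrite mem_index_enum => /(_ isT)/=; rewrite mulf_eq0 orbb => /eqP.
Qed.

Lemma coord_le_enorm x i : `|x ord0 i| <= enorm x.
Proof.
rewrite -(@ler_pXn2r _ 2)// ?nnegrE ?enorm_ge0//.
rewrite sqr_enorm real_normK ?num_real// /dotv (bigD1 i)//= -expr2 lerDl.
by apply: sumr_ge0 => j _; rewrite -expr2 sqr_ge0.
Qed.

Lemma enorm_delta (s : R) (i : 'I_d) : enorm (s *: delta_mx ord0 i) = `|s|.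
Proof.
rewrite enormZ /enorm -[X in dotv X _]scale1r dotv_delta mul1r mxE !eqxx.
by rewrite sqrtr1 mulr1.
Qed.

(** Crude by a factor sqrt d, which is harmless as all constants may depend on d. The case d = 0 is
    separate because M may then be negative. *)
Lemma enorm_le_sup x (M : R) : (forall i, `|x ord0 i| <= M) -> enorm x <= d%:R * M.
Proof.
move=> xM; have [d0|d0] := posnP d.
  have -> : d%:R = 0 :> R by rewrite d0.
  rewrite mul0r /enorm /dotv big1 ?sqrtr0// => i.
  by have := ltn_ord i; rewrite [X in (_ < X)%N]d0.
pose i := Ordinal d0.
have M0 : 0 <= M by rewrite (le_trans (normr_ge0 _) (xM i)).
rewrite -(@ler_pXn2r _ 2)// ?nnegrE ?enorm_ge0 ?mulr_ge0 ?ler0n//.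
rewrite sqr_enorm exprMn; apply: (@le_trans _ _ (d%:R * M ^+ 2)); last first.
  by rewrite ler_wpM2r ?sqr_ge0// -natrX ler_nat leq_pmull.
rewrite mulr_natl -[X in _ *+ X]card_ord -sumr_const; apply: ler_sum => j _.
by rewrite -expr2 -real_normK ?num_real// lerXn2r// nnegrE.
Qed.

Section positive_form.
Variable A : 'M[R]_d.
Hypothesis symA : A^T = A.
Hypothesis nnegA : forall x, 0 <= qform A x.

Lemma dotv_mulmxC x y : dotv x (y *m A) = dotv y (x *m A).
Proof.
have E (u v : 'rV[R]_d) : dotv u v = (u *m v^T) ord0 ord0.
  by rewrite mxE; apply: eq_bigr => i _; rewrite mxE.
by rewrite (dotvC y) !E trmx_mul symA mulmxA.
Qed.

Lemma qformD x y :
  qform A (x + y) = qform A x + 2 * dotv x (y *m A) + qform A y.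
Proof.
rewrite /qform mulmxDl dotvDl !dotvDr (dotv_mulmxC y x); ring.
Qed.

Lemma qformZ (k : R) x : qform A (k *: x) = k ^+ 2 * qform A x.
Proof. by rewrite /qform -scalemxAl dotvZl dotvZr mulrA. Qed.

(** The parallelogram law after dropping the term Q(x - y) >= 0. *)
Lemma qformD_le x y : qform A (x + y) <= 2 * qform A x + 2 * qform A y.
Proof.
have := nnegA (x + (-1) *: y); rewrite !qformD -scalemxAl dotvZr qformZ; lra.
Qed.

Lemma dotv_mulmx_sqr x y : dotv x (y *m A) ^+ 2 <= qform A x * qform A y.
Proof.
apply: discriminant_le0 => t; have := nnegA (x + t *: y).
by rewrite qformD qformZ -scalemxAl dotvZr; move=> h; lra.
Qed.

End positive_form.

Lemma dotv_le_enorm x y : `|dotv x y| <= enorm x * enorm y.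
Proof.
rewrite -(@ler_pXn2r _ 2)// ?nnegrE ?mulr_ge0 ?enorm_ge0//.
rewrite real_normK ?num_real// exprMn !sqr_enorm.
have := @dotv_mulmx_sqr 1%:M (trmx1 _ _).
rewrite /qform; move=> /(_ _ x y); rewrite !mulmx1; apply => z.
by rewrite mulmx1 dotv_ge0.
Qed.

(** [sup] returns a default value on unbounded sets, so every use of [opnorm] rests on this bound by
    the entries of A. *)
Lemma opnorm_has_sup A :
  has_sup [set enorm (x *m A) | x in [set x : 'rV[R]_d | enorm x <= 1]].
Proof.
split; first by exists (enorm (0 *m A)), 0 => //=; rewrite enorm0 ler01.
pose M := \sum_i \sum_j `|A i j|.
exists (d%:R * M) => _ [x /= x1 <-]; apply: enorm_le_sup => j.
rewrite mxE (le_trans (ler_norm_sum _ _ _))// ler_sum// => i _.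
rewrite normrM (@le_trans _ _ (1 * `|A i j|))//.
  by rewrite ler_wpM2r// (le_trans (coord_le_enorm _ _)).
by rewrite mul1r (bigD1 j)//= lerDl sumr_ge0.
Qed.

Lemma opnorm_ge A x : enorm (x *m A) <= opnorm A * enorm x.
Proof.
have [/enorm_eq0 ->|x0] := eqVneq (enorm x) 0.
  by rewrite mul0mx enorm0 mulr0.
have xp : 0 < enorm x by rewrite lt_neqAle eq_sym x0 enorm_ge0.
rewrite -ler_pdivrMr//.
have -> : enorm (x *m A) / enorm x = enorm (((enorm x)^-1 *: x) *m A).
  by rewrite -scalemxAl enormZ ger0_norm ?invr_ge0 ?enorm_ge0// mulrC.
apply: ub_le_sup; first exact: (opnorm_has_sup A).2.
exists ((enorm x)^-1 *: x) => //=.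
by rewrite enormZ ger0_norm ?invr_ge0 ?enorm_ge0// mulVf.
Qed.

Lemma opnorm_ge0 A : 0 <= opnorm A.
Proof.
have -> : (0 : R) = enorm (0 *m A) by rewrite mul0mx enorm0.
apply: ub_le_sup; first exact: (opnorm_has_sup A).2.
by exists 0 => //=; rewrite enorm0.
Qed.

Lemma opnorm_le A (M : R) :
  (forall x, enorm x <= 1 -> enorm (x *m A) <= M) -> opnorm A <= M.
Proof.
move=> H; apply: ge_sup; first exact: (opnorm_has_sup A).1.
by move=> _ [x /= x1 <-]; exact: H.
Qed.

Lemma qform_le_opnorm A x : qform A x <= opnorm A * enorm x ^+ 2.
Proof.
rewrite (le_trans (ler_norm _))// (le_trans (dotv_le_enorm _ _))//.
rewrite expr2 mulrA [leRHS]mulrC ler_wpM2l ?enorm_ge0//; exact: opnorm_ge.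
Qed.

(* Cauchy-Schwarz for the form of [A]:
   |xA|^4 = <x, (xA)A>^2 <= Q(x) Q(xA) <= M M |xA|^2. *)
Lemma opnorm_le_qform A (M : R) : A^T = A -> (forall x, 0 <= qform A x) ->
  (forall x, enorm x <= 1 -> qform A x <= M) -> opnorm A <= M.
Proof.
move=> symA nnegA QM; apply: opnorm_le => x x1.
have M0 : 0 <= M.
  by rewrite (le_trans (nnegA 0))// QM// enorm0.
have QM2 y : qform A y <= M * enorm y ^+ 2.
  have [/enorm_eq0 ->|y0] := eqVneq (enorm y) 0.
    by rewrite /qform mul0mx -sqr_enorm enorm0 expr0n mulr0.
  have yp : 0 < enorm y by rewrite lt_neqAle eq_sym y0 enorm_ge0.
  rewrite -ler_pdivrMr ?exprn_gt0//.
  have -> : qform A y / enorm y ^+ 2 = qform A ((enorm y)^-1 *: y).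
    by rewrite qformZ exprVn mulrC.
  by apply: QM; rewrite enormZ ger0_norm ?invr_ge0 ?enorm_ge0// mulVf.
have := @dotv_mulmx_sqr A symA nnegA (x *m A) x.
rewrite -sqr_enorm.
have := QM2 (x *m A); have := QM _ x1; have := nnegA x.
have := enorm_ge0 (x *m A).
move: (enorm _) (qform A x) (qform A (_ *m _)) => e q q' e0 q0 qM q'M eq.
have [e0'|e0'] := eqVneq e 0; first by rewrite e0'.
have ep : 0 < e ^+ 2 by rewrite exprn_gt0// lt_neqAle eq_sym e0'.
have : (e ^+ 2) ^+ 2 <= M ^+ 2 * e ^+ 2.
  apply: (le_trans eq); apply: (@le_trans _ _ (M * e ^+ 2 * q)).
    by rewrite ler_wpM2r.
  by rewrite mulrC expr2 -mulrA mulrA mulrAC -mulrA ler_wpM2r// mulr_ge0// ltW.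
by rewrite expr2 (ler_pM2r ep) ler_pXn2r// nnegrE.
Qed.

End euclidean.

(** * Measurability and iterated integrals *)

Section measurability.
Context {R : realType} {d : nat} {disp : measure_display} {T : measurableType disp}.

Lemma measurable_dotv (f g : T -> 'rV[R]_d) :
  measurable_fun setT f -> measurable_fun setT g ->
  measurable_fun setT (fun w => dotv (f w) (g w)).
Proof.
move=> mf mg; apply: measurable_sum => i; apply: measurable_funM.
  exact: (measurableT_comp (measurable_coord_rV i) mf).
exact: (measurableT_comp (measurable_coord_rV i) mg).
Qed.

Lemma measurable_enorm_sqr (f : T -> 'rV[R]_d) :
  measurable_fun setT f -> measurable_fun setT (fun w => enorm (f w) ^+ 2).
Proof.
move=> mf; under eq_fun do rewrite sqr_enorm; exact: measurable_dotv.
Qed.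

Lemma measurable_cosR (f : T -> R) :
  measurable_fun setT f -> measurable_fun setT (cos \o f).
Proof.
apply: measurableT_comp; apply: continuous_measurable_fun.
exact: continuous_cos.
Qed.

Lemma measurable_sinR (f : T -> R) :
  measurable_fun setT f -> measurable_fun setT (sin \o f).
Proof.
apply: measurableT_comp; apply: continuous_measurable_fun.
exact: continuous_sin.
Qed.

End measurability.

Section sigma_finite_fubini.
Context {d1 d2 : measure_display} {T1 : measurableType d1}
  {T2 : measurableType d2} {R : realType}.
Variables (m1 : {measure set T1 -> \bar R}) (m2 : {measure set T2 -> \bar R}).
Hypotheses (sf1 : sigma_finite setT m1) (sf2 : sigma_finite setT m2).

(** Some of the measures below, such as N, come with a proof of sigma-finiteness but without the
    corresponding structure. Packing the proof with the measure makes the theorems of Tonelli and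
    Fubini applicable. *)
Let M1 : {sigma_finite_measure set T1 -> \bar R} :=
  HB.pack_for (SigmaFiniteMeasure.type T1 R) (Measure.sort m1)
    (@isSFinite.Build _ _ _ (Measure.sort m1) (sfinite_measure_sigma_finite sf1))
    (@isSigmaFinite.Build _ _ _ (Measure.sort m1) sf1).
Let M2 : {sigma_finite_measure set T2 -> \bar R} :=
  HB.pack_for (SigmaFiniteMeasure.type T2 R) (Measure.sort m2)
    (@isSFinite.Build _ _ _ (Measure.sort m2) (sfinite_measure_sigma_finite sf2))
    (@isSigmaFinite.Build _ _ _ (Measure.sort m2) sf2).

Local Open Scope ereal_scope.
Variable f : T1 * T2 -> \bar R.
Hypothesis mf : measurable_fun setT f.

Lemma sigma_finite_tonelli : (forall x, 0 <= f x) ->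
  \int[m1]_x \int[m2]_y f (x, y) = \int[m2]_y \int[m1]_x f (x, y).
Proof. by move=> f0; exact: (@fubini_tonelli _ _ _ _ _ M1 M2). Qed.

Lemma sigma_finite_measurable_tonelli : (forall x, 0 <= f x) ->
  measurable_fun setT (fun x => \int[m2]_y f (x, y)).
Proof.
by move=> f0; exact: (@measurable_fun_fubini_tonelli_F _ _ _ _ _ M2).
Qed.

Hypothesis fi : \int[m1]_x \int[m2]_y `|f (x, y)| < +oo.

Let fint : (M1 \x M2).-integrable setT f.
Proof. by apply/(@integrable12ltyP _ _ _ _ _ M1 M2). Qed.

Lemma sigma_finite_fubini :
  \int[m1]_x \int[m2]_y f (x, y) = \int[m2]_y \int[m1]_x f (x, y).
Proof. exact: (@Fubini _ _ _ _ _ M1 M2). Qed.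

End sigma_finite_fubini.

(** * Characteristic exponent and concentration function *)

Section levy_measure.
Context {R : realType} {d : nat}.
Variables (A : 'M[R]_d) (N : {measure set 'rV[R]_d -> \bar R}) (b : 'rV[R]_d).
Hypothesis trip : generating_triplet A N b.

Local Lemma mid : measurable_fun setT (@idfun 'rV[R]_d).
Proof. exact: measurable_id. Qed.

Lemma measurable_min_sqr (k : R) :
  measurable_fun setT (fun z : 'rV[R]_d => Num.min 1 (enorm z ^+ 2 * k)).
Proof.
apply: measurable_minr; first exact: measurable_cst.
apply: measurable_funM; last exact: measurable_cst.
exact: measurable_enorm_sqr.
Qed.

Lemma min_sqr_ge0 (k : R) (z : 'rV[R]_d) :
  0 <= k -> 0 <= Num.min 1 (enorm z ^+ 2 * k).
Proof. by move=> k0; rewrite le_min ler01 mulr_ge0 ?sqr_ge0. Qed.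

Lemma levy_integrable (f : 'rV[R]_d -> R) (C : R) :
  measurable_fun setT f ->
  (forall z, `|f z| <= C * Num.min 1 (enorm z ^+ 2)) ->
  N.-integrable setT (EFin \o f).
Proof.
move=> mf fC.
have mm : measurable_fun setT (fun z : 'rV[R]_d => Num.min 1 (enorm z ^+ 2)).
  by have := measurable_min_sqr 1; under eq_fun do rewrite mulr1.
have im : N.-integrable setT
    (fun z : 'rV[R]_d => (Num.min 1 (enorm z ^+ 2))%:E).
  apply/integrableP; split; first exact/measurable_EFinP.
  apply: le_lt_trans (triplet_levy trip).
  rewrite le_eqVlt; apply/orP; left; apply/eqP; apply: eq_integral => z _ /=.
  by rewrite ger0_norm// le_min ler01 sqr_ge0.
apply: (@le_integrable _ _ _ N setT measurableT _
  (fun z => C%:E * (Num.min 1 (enorm z ^+ 2))%:E)%E) => //.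
- exact/measurable_EFinP.
- move=> z _; rewrite -EFinM !abse_EFin lee_fin (le_trans (fC z))//.
  by rewrite (le_trans (ler_norm _)).
- exact: integrableZl.
Qed.

(** The sets where min(1, |z|^2) >= 1/(n+1) have finite mass by Markov's inequality; together with
    the null set {0} they cover the space. *)
Lemma levy_sigma_finite : sigma_finite setT N.
Proof.
have mm : measurable_fun setT (fun z : 'rV[R]_d => Num.min 1 (enorm z ^+ 2)).
  by have := measurable_min_sqr 1; under eq_fun do rewrite mulr1.
pose F (n : nat) := [set z : 'rV[R]_d | n.+1%:R^-1 <= Num.min 1 (enorm z ^+ 2)].
pose G (n : nat) := if n is m.+1 then F m else [set 0 : 'rV[R]_d].
have mF n : measurable (F n).
  have -> : F n = setT `&` (fun z : 'rV[R]_d => Num.min 1 (enorm z ^+ 2)) @^-1`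
      [set` `[n.+1%:R^-1, +oo[ ].
    by apply/seteqP; split => z; rewrite /= in_itv/= andbT => // -[].
  exact: mm.
have m0 : measurable [set 0 : 'rV[R]_d].
  have -> : [set 0 : 'rV[R]_d] = setT `&` (fun z => enorm z ^+ 2) @^-1` [set 0].
    apply/seteqP; split => [z ->|z [_ /= /eqP]].
      by split => //=; rewrite enorm0 expr0n.
    by rewrite sqrf_eq0 => /eqP /enorm_eq0.
  have := measurable_enorm_sqr mid; apply => //; exact: measurable_set1.
exists G.
  apply/seteqP; split => // z _.
  have [/enorm_eq0 ->|z0] := eqVneq (enorm z) 0; first by exists 0%N.
  have zp : 0 < Num.min 1 (enorm z ^+ 2).
    by rewrite lt_min ltr01 exprn_gt0// lt_neqAle eq_sym z0 enorm_ge0.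
  have [k] := ltr_add_invr zp; rewrite add0r => kz.
  by exists k.+1 => //=; rewrite /F/= ltW.
move=> [|n] /=; split => //; first by rewrite (triplet_atom0 trip).
have n0 : 0 < n.+1%:R^-1 :> R by rewrite invr_gt0.
have := @le_integral_abse _ _ _ N setT measurableT
  (fun z : 'rV[R]_d => (Num.min 1 (enorm z ^+ 2))%:E) n.+1%:R^-1
  ((measurable_EFinP _ _).2 mm) n0.
have -> : [set: 'rV[R]_d] `&` [set x |
    (n.+1%:R^-1%:E <= `|(Num.min 1 (enorm x ^+ 2))%:E|)%E] = F n.
  rewrite setTI; apply/seteqP; split => z /=;
  by rewrite lee_fin ger0_norm// le_min ler01 sqr_ge0.
move=> H; have : (n.+1%:R^-1%:E * N (F n) < +oo)%E.
  apply: (le_lt_trans H); apply: le_lt_trans (triplet_levy trip).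
  rewrite le_eqVlt; apply/orP; left; apply/eqP; apply: eq_integral => z _ /=.
  by rewrite ger0_norm// le_min ler01 sqr_ge0.
apply: contraPT; rewrite -leNgt leye_eq => /eqP ->.
by rewrite gt0_muley ?lte_fin// ltxx.
Qed.

End levy_measure.

Section exponent.
Context {R : realType} {d : nat}.

(** The real part of [Psi]: drift and compensator contribute to the imaginary part only, so [b]
    disappears. *)
Definition rePsi (A : 'M[R]_d) (N : {measure set 'rV[R]_d -> \bar R})
    (x : 'rV[R]_d) : R :=
  qform A x + \int[N]_z (1 - cos (dotv x z)).

Variables (A : 'M[R]_d) (N : {measure set 'rV[R]_d -> \bar R}) (b : 'rV[R]_d).

Lemma Re_Psi x : complex.Re (Psi A N b x) = rePsi A N x.
Proof.
rewrite /Psi /rePsi /cintegral /=.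
rewrite !(mul0r, mul1r, mulr0, subr0, oppr0, addr0, add0r, mulrN, opprK).
congr (_ + _); rewrite /Rintegral -fineN; congr fine.
(* For the nonnegative integrand 1 - cos the sign may be moved through the extended integral. *)
rewrite -[RHS]oppeK -integral_ge0N => [|z _]; last by rewrite lee_fin one_sub_cos_ge0.
congr (- _)%E; apply: eq_integral => z _.
rewrite mul0r !(mul0r, mul1r, add0r, addr0, subr0) expR0 mul1r -EFinN.
by rewrite opprB.
Qed.

Hypothesis trip : generating_triplet A N b.

Let symA := triplet_sym trip.
Let nnegA := triplet_nneg trip.

Lemma measurable_one_sub_cos (x : 'rV[R]_d) :
  measurable_fun setT (fun z : 'rV[R]_d => 1 - cos (dotv x z)).
Proof.
apply: measurable_funB; first exact: measurable_cst.
apply: measurable_cosR; apply: measurable_dotv; first exact: measurable_cst.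
exact: measurable_id.
Qed.

Lemma dotv_sqr_le (x z : 'rV[R]_d) : dotv x z ^+ 2 <= enorm z ^+ 2 * enorm x ^+ 2.
Proof.
rewrite -exprMn -real_normK ?num_real// lerXn2r ?nnegrE ?mulr_ge0 ?enorm_ge0//.
by rewrite mulrC dotv_le_enorm.
Qed.

Lemma min_scale_le (u k : R) : 0 <= u -> 0 <= k ->
  Num.min 1 (u * k) <= (1 + k) * Num.min 1 u.
Proof.
move=> u0 k0; have uk : 0 <= u * k by rewrite mulr_ge0.
by case: (leP 1 (u * k)) => h1; case: (leP 1 u) => h2; nra.
Qed.

Lemma integrable_min_sqr (k : R) : 0 <= k ->
  N.-integrable setT (EFin \o (fun z => Num.min 1 (enorm z ^+ 2 * k))).
Proof.
move=> k0; apply: (@levy_integrable R d A N b trip _ (1 + k)).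
  exact: measurable_min_sqr.
move=> z; rewrite ger0_norm; first by rewrite min_scale_le ?sqr_ge0.
exact: min_sqr_ge0.
Qed.

Lemma measurable_min_dotv (x : 'rV[R]_d) :
  measurable_fun setT (fun z : 'rV[R]_d => Num.min 1 (dotv x z ^+ 2)).
Proof.
apply: measurable_minr; first exact: measurable_cst.
apply: measurable_funX; apply: measurable_dotv; first exact: measurable_cst.
exact: measurable_id.
Qed.

Lemma min_dotv_le (x z : 'rV[R]_d) :
  Num.min 1 (dotv x z ^+ 2) <= Num.min 1 (enorm z ^+ 2 * enorm x ^+ 2).
Proof. by rewrite le_min2// dotv_sqr_le. Qed.

Lemma min_dotv_ge0 (x z : 'rV[R]_d) : 0 <= Num.min 1 (dotv x z ^+ 2).
Proof. by rewrite le_min ler01 sqr_ge0. Qed.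

Lemma integrable_min_dotv (x : 'rV[R]_d) :
  N.-integrable setT (EFin \o (fun z => Num.min 1 (dotv x z ^+ 2))).
Proof.
apply: (@levy_integrable R d A N b trip _ (1 + enorm x ^+ 2)).
  exact: measurable_min_dotv.
move=> z; rewrite ger0_norm ?min_dotv_ge0// (le_trans (min_dotv_le _ _))//.
by rewrite min_scale_le ?sqr_ge0.
Qed.

Lemma integrable_one_sub_cos (x : 'rV[R]_d) :
  N.-integrable setT (EFin \o (fun z => 1 - cos (dotv x z))).
Proof.
apply: (@levy_integrable R d A N b trip _ (2 * (1 + enorm x ^+ 2))).
  exact: measurable_one_sub_cos.
move=> z; rewrite ger0_norm ?one_sub_cos_ge0//.
rewrite (le_trans (one_sub_cos_le_min _))// -mulrA ler_pM2l//.
by rewrite (le_trans (min_dotv_le _ _))// min_scale_le ?sqr_ge0.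
Qed.

Lemma rePsi_ge0 x : 0 <= rePsi A N x.
Proof.
apply: addr_ge0; first exact: nnegA.
by apply: Rintegral_ge0 => z _; exact: one_sub_cos_ge0.
Qed.

Lemma rePsiD x y : rePsi A N (x + y) <= 2 * rePsi A N x + 2 * rePsi A N y.
Proof.
have := qformD_le symA nnegA x y.
have : \int[N]_z (1 - cos (dotv (x + y) z)) <=
    2 * (\int[N]_z (1 - cos (dotv x z))) + 2 * (\int[N]_z (1 - cos (dotv y z))).
  rewrite -!RintegralZl//; try exact: integrable_one_sub_cos.
  have iZ (v : 'rV[R]_d) :
    N.-integrable setT (EFin \o (fun z => 2 * (1 - cos (dotv v z)))).
    exact: (integrableZl measurableT 2 (integrable_one_sub_cos v)).
  rewrite -RintegralD//; apply: le_Rintegral => //.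
  - exact: integrable_one_sub_cos.
  - exact: (integrableD measurableT (iZ x) (iZ y)).
  - by move=> z _; rewrite dotvDl one_sub_cosD.
by rewrite /rePsi; lra.
Qed.

Lemma rePsi_mulrn (k : nat) x : rePsi A N (k%:R *: x) <= k%:R ^+ 2 * rePsi A N x.
Proof.
rewrite /rePsi mulrDr qformZ lerD2l.
rewrite -RintegralZl//; last exact: integrable_one_sub_cos.
apply: le_Rintegral => //.
- exact: integrable_one_sub_cos.
- exact: (integrableZl measurableT (k%:R ^+ 2) (integrable_one_sub_cos x)).
- by move=> z _; rewrite dotvZl one_sub_cos_mulrn.
Qed.

Lemma measurable_rePsi : measurable_fun setT (rePsi A N).
Proof.
apply: measurable_funD.
  apply: measurable_dotv; first exact: measurable_id.
  apply: measurable_fun_rV => i; under eq_fun do rewrite mxE.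
  apply: measurable_sum => j; apply: measurable_funM; last exact: measurable_cst.
  exact: measurable_coord_rV.
have mf : measurable_fun [set: 'rV[R]_d * 'rV[R]_d]
    (fun p => (1 - cos (dotv p.1 p.2))%:E).
  apply/measurable_EFinP; apply: measurable_funB; first exact: measurable_cst.
  by apply: measurable_cosR; apply: measurable_dotv.
have := @sigma_finite_measurable_tonelli _ _ _ _ R N (levy_sigma_finite trip) _ mf.
move=> H; apply: (measurableT_comp _ (H _)) => //.
Qed.

End exponent.

Section concentration.
Context {R : realType} {d : nat}.
Variables (A : 'M[R]_d) (N : {measure set 'rV[R]_d -> \bar R}) (b : 'rV[R]_d).
Hypothesis trip : generating_triplet A N b.

Let symA := triplet_sym trip.
Let nnegA := triplet_nneg trip.

(* [hfun] in the variable [k = r^-2], in which it is concave. *)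
Definition hsqr (k : R) : R :=
  k * opnorm A + \int[N]_z Num.min 1 (enorm z ^+ 2 * k).

Lemma hfunE (r : R) : hfun A N r = hsqr (r ^- 2).
Proof. by []. Qed.

Let imin k (k0 : 0 <= k) := @integrable_min_sqr R d A N b trip k k0.

Lemma hsqr_ge0 k : 0 <= k -> 0 <= hsqr k.
Proof.
move=> k0; rewrite addr_ge0 ?mulr_ge0 ?opnorm_ge0//.
by apply: Rintegral_ge0 => z _; exact: min_sqr_ge0.
Qed.

Lemma hsqr_le k k' : 0 <= k -> k <= k' -> hsqr k <= hsqr k'.
Proof.
move=> k0 kk; have k'0 := le_trans k0 kk.
rewrite lerD ?ler_wpM2r ?opnorm_ge0//.
apply: le_Rintegral => //; [exact: imin|exact: imin|].
by move=> z _; rewrite le_min2// ler_wpM2l ?sqr_ge0.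
Qed.

(** Concavity together with the value 0 at k = 0. It serves below both to spread a zero of [hsqr]
    and as a Lipschitz estimate. *)
Lemma hsqr_scale k l : 0 <= k -> 1 <= l -> hsqr (l * k) <= l * hsqr k.
Proof.
move=> k0 l1; have l0 : 0 <= l by rewrite (le_trans _ l1).
have lk0 : 0 <= l * k by rewrite mulr_ge0.
rewrite /hsqr (mulrDr l) -(mulrA l) lerD2l -RintegralZl//; last exact: imin.
apply: le_Rintegral => //; [exact: imin| |].
  exact: (integrableZl measurableT l (imin k0)).
move=> z _; have := sqr_ge0 (enorm z); move: (_ ^+ 2) => u u0.
have uk : 0 <= u * k by rewrite mulr_ge0.
rewrite mulrCA; case: (leP 1 (u * k)) => h1; case: (leP 1 (l * (u * k))) => h2; nra.
Qed.

(* Where [u k1 < 1] the right-hand difference is linear in [u],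
   and elsewhere the left-hand one vanishes. *)
Lemma hsqr_sub_le k2 k1 k : 0 <= k2 -> k2 < k1 -> k1 <= k ->
  hsqr k - hsqr k1 <= k / (k1 - k2) * (hsqr k1 - hsqr k2).
Proof.
move=> k20 k21 k1k; have d0 : 0 < k1 - k2 by rewrite subr_gt0.
have k10 : 0 <= k1 by rewrite ltW// (le_lt_trans k20).
have k0 : 0 <= k by rewrite (le_trans k10).
set C := k / (k1 - k2); have C0 : 0 <= C by rewrite divr_ge0// ltW.
have Ck : C * (k1 - k2) = k by rewrite divfK ?gt_eqF.
suff H : \int[N]_z (Num.min 1 (enorm z ^+ 2 * k) - Num.min 1 (enorm z ^+ 2 * k1))
   <= \int[N]_z (C * (Num.min 1 (enorm z ^+ 2 * k1) - Num.min 1 (enorm z ^+ 2 * k2))).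
  move: H; rewrite RintegralZl//; last exact: (integrableB measurableT (imin k10) (imin k20)).
  rewrite !RintegralB//; try exact: imin.
  rewrite /hsqr; have := opnorm_ge0 A.
  move: (opnorm A) => a a0; have : (k - k1) * a <= C * (k1 - k2) * a.
    by rewrite Ck ler_wpM2r// gerBl.
  by lra.
apply: le_Rintegral => //.
- exact: (integrableB measurableT (imin k0) (imin k10)).
- exact: (integrableZl measurableT C (integrableB measurableT (imin k10) (imin k20))).
move=> z _; have := sqr_ge0 (enorm z); move: (_ ^+ 2) => u u0.
have ukk : u * k2 <= u * k1 by rewrite ler_wpM2l// ltW.
have ukk1 : u * k1 <= u * k by rewrite ler_wpM2l.
have h0 : 0 <= C * (1 - Num.min 1 (u * k2)).
  by rewrite mulr_ge0// subr_ge0 ge_min lexx.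
have [h1|h1] := leP 1 (u * k1).
  by have [h2|h2] := leP 1 (u * k); lra.
have -> : Num.min 1 (u * k2) = u * k2 by apply/min_idPr; lra.
have -> : C * (u * k1 - u * k2) = u * k by rewrite -mulrBr mulrCA Ck.
have : 0 <= u * k1 by rewrite mulr_ge0.
have : Num.min 1 (u * k) <= u * k by rewrite ge_min lexx orbT.
by lra.
Qed.

(** In terms of h this is h(r) -> 0 as r -> oo, by dominated convergence along k = 1/(n+1). *)
Lemma hsqr_small (e : R) : 0 < e -> exists2 k, 0 < k & hsqr k < e.
Proof.
move=> e0.
pose kn (n : nat) : R := n.+1%:R^-1.
have kn0 n : 0 < kn n by rewrite invr_gt0.
have knc : kn n @[n --> \oo] --> 0.
  by have := @cvg_harmonic R; rewrite /harmonic.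
have [] := @dominated_convergence _ _ R N setT measurableT
  (fun n z => (Num.min 1 (enorm z ^+ 2 * kn n))%:E) (cst 0%E)
  (EFin \o (fun z => Num.min 1 (enorm z ^+ 2 * 1))).
- by move=> n; apply/measurable_EFinP; exact: measurable_min_sqr.
- exact: measurable_cst.
- apply: aeW => z _; apply: cvg_EFin; first by near=> n.
  have : enorm z ^+ 2 * kn n @[n --> \oo] --> enorm z ^+ 2 * 0.
    exact: cvgMr.
  rewrite mulr0 => uc; apply: (@squeeze_cvgr _ _ _ _ (cst 0) (fun n => enorm z ^+ 2 * kn n)).
  + near=> n; rewrite /= min_sqr_ge0 ?(ltW (kn0 _))//=.
    by rewrite ge_min lexx orbT.
  + exact: cvg_cst.
  + exact: uc.
- exact: imin.
- apply: aeW => z n _; rewrite /= ger0_norm ?min_sqr_ge0 ?(ltW (kn0 _))//.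
  rewrite lee_fin le_min2// ler_wpM2l ?sqr_ge0//.
  by rewrite invf_le1// ler1n.
move=> _ _; rewrite integral_cst// mul0e => /fine_cvgP[_ /= ic].
have hc : hsqr (kn n) @[n --> \oo] --> 0 * opnorm A + 0.
  apply: cvgD; last exact: ic.
  by apply: cvgMl.
move: hc; rewrite mul0r addr0 => hc.
have /cvgrPdist_lt/(_ e e0) := hc.
case=> n _ /(_ n (leqnn _)) /=; rewrite sub0r normrN => H.
by exists (kn n) => //; exact: le_lt_trans (ler_norm _) H.
Unshelve. all: by end_near. Qed.

Hypothesis h0oo : hfun A N r @[r --> 0^'+] --> +oo.

Lemma hsqr_large (M : R) : exists2 k, 0 < k & M < hsqr k.
Proof.
have /cvgryPgt/(_ M) H := h0oo.
have : \forall r \near 0^'+, 0 < r /\ M < hfun A N r.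
  near=> r; split; first by near: r; exact: nbhs_right_gt.
  by near: r.
move=> /filter_ex[r [r0 Mr]]; exists (r ^- 2) => //.
by rewrite invr_gt0 exprn_gt0.
Unshelve. all: by end_near. Qed.

(** A zero at k would spread to the whole half-line by [hsqr_scale], against h(0+) = oo. *)
Lemma hsqr_gt0 k : 0 < k -> 0 < hsqr k.
Proof.
move=> k0; rewrite lt_neqAle hsqr_ge0 ?(ltW k0)// andbT eq_sym.
apply/negP => /eqP hk.
have [k' k'0 hk'] := hsqr_large 0.
have : hsqr (Num.max 1 (k' / k) * k) <= Num.max 1 (k' / k) * hsqr k.
  by apply: hsqr_scale; rewrite ?(ltW k0)// le_max lexx.
rewrite hk mulr0 leNgt => /negP; apply; apply: (lt_le_trans hk').
apply: hsqr_le; first exact: ltW.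
by rewrite -ler_pdivrMr// le_max lexx orbT.
Qed.

(** Strictness comes from [hsqr_sub_le]: if the increment over [k, k'] vanished, so would all later
    ones, and h would stay bounded near 0. *)
Lemma hsqr_lt k k' : 0 <= k -> k < k' -> hsqr k < hsqr k'.
Proof.
move=> k0 kk; rewrite lt_neqAle hsqr_le ?(ltW kk)// andbT; apply/negP => /eqP E.
have [m m0 hm] := hsqr_large (hsqr k').
have k'0 : 0 <= k' by rewrite (le_trans k0)// ltW.
have := @hsqr_sub_le k k' (Num.max k' m) k0 kk.
rewrite E subrr mulr0 le_max lexx => /(_ isT); rewrite subr_le0 => H.
have : hsqr m <= hsqr (Num.max k' m).
  by apply: hsqr_le; [exact: ltW|rewrite le_max lexx orbT].
by rewrite leNgt (le_lt_trans H hm).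
Qed.

(** Intermediate value theorem between a point where the function is below s and one where it
    exceeds s. *)
Lemma hsqr_surj (s : R) : 0 < s -> exists2 k, 0 < k & hsqr k = s.
Proof.
move=> s0; have [a a0 ha] := hsqr_small s0.
have [m m0 hm] := hsqr_large s.
have am : a <= m.
  rewrite leNgt; apply/negP => ma.
  by have := hsqr_lt (ltW m0) ma; rewrite ltNge (le_trans (ltW ha) (ltW hm)).
(* Freezing the function below a makes it continuous on the whole line. *)
pose G x := hsqr (Num.max a x).
have Gc : continuous G.
  move=> x; apply/cvgrPdist_le => e e0.
  pose B := Num.max a x + 1; have aB : a <= B.
    by rewrite /B (@le_trans _ _ (Num.max a x))// ?le_max ?lexx// lerDl.
  have hB : 0 < hsqr B by apply: hsqr_gt0; exact: lt_le_trans aB.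
  (* On [a, B] the function is Lipschitz with constant hsqr(B) / a, by [hsqr_scale] with the factor
     z / y. *)
  have key y z : a <= y -> y <= z -> z <= B ->
      `|hsqr y - hsqr z| <= (z - y) * (hsqr B / a).
    move=> ay yz zB; have y0 : 0 < y by exact: lt_le_trans ay.
    rewrite distrC ger0_norm; last by rewrite subr_ge0 hsqr_le// ltW.
    have h1 : hsqr ((z / y) * y) <= (z / y) * hsqr y.
      by apply: hsqr_scale; [exact: ltW|rewrite ler_pdivlMr// mul1r].
    rewrite divfK ?gt_eqF// in h1.
    have h2 : (z - y) / y * hsqr y <= (z - y) / a * hsqr B.
      rewrite ler_pM//.
      - by rewrite divr_ge0 ?subr_ge0 ?(ltW y0).
      - by rewrite hsqr_ge0// ltW.
      - by rewrite ler_wpM2l ?subr_ge0// lef_pV2 ?posrE.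
      - by rewrite hsqr_le ?(ltW y0)// (le_trans yz).
    have -> : (z - y) * (hsqr B / a) = (z - y) / a * hsqr B by ring.
    apply: le_trans h2; rewrite mulrBl divff ?gt_eqF//; lra.
  near=> y.
  have yx : `|x - y| <= Num.min 1 (e / (hsqr B / a)).
    near: y; apply: cvgr_dist_le; first exact: cvg_id.
    by rewrite lt_min ltr01 divr_gt0// divr_gt0.
  have mm : `|Num.max a x - Num.max a y| <= `|x - y|.
    have n1 := ler_norm (x - y); have n2 := ler_norm (y - x).
    rewrite distrC in n2; rewrite ler_norml.
    by have [?|?] := leP a x; have [?|?] := leP a y; apply/andP; split; lra.
  have {}yx := le_trans mm yx.
  have yx1 : `|Num.max a x - Num.max a y| <= 1 by rewrite (le_trans yx)// ge_min lexx.
  have yx2 : `|Num.max a x - Num.max a y| * (hsqr B / a) <= e.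
    by rewrite -ler_pdivlMr ?divr_gt0// (le_trans yx)// ge_min lexx orbT.
  have ax : a <= Num.max a x by rewrite le_max lexx.
  have ay : a <= Num.max a y by rewrite le_max lexx.
  apply: le_trans yx2; rewrite /G.
  have [xy|xy] := leP (Num.max a x) (Num.max a y).
    rewrite (distrC (Num.max a x)) (@ger0_norm _ (Num.max a y - _)) ?subr_ge0//.
    apply: key => //; move: yx1; rewrite distrC ger0_norm ?subr_ge0// /B; lra.
  rewrite distrC (@ger0_norm _ (Num.max a x - _)) ?subr_ge0 ?(ltW xy)//.
  by apply: key => //; [exact: ltW|rewrite /B lerDl].
have := @IVT R G a m s am (continuous_subspaceT Gc).
rewrite /G maxxx (max_idPr am) (min_idPl _) ?(ltW (lt_trans ha hm))//.
rewrite (max_idPr _) ?(ltW (lt_trans ha hm))// (ltW ha) (ltW hm).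
move=> /(_ isT)[c]; rewrite in_itv/= => /andP[ac _]; rewrite (max_idPr ac) => hc.
by exists c => //; exact: lt_le_trans ac.
Unshelve. all: by end_near. Qed.

End concentration.

Section concentration_inverse.
Context {R : realType} {d : nat}.
Variables (A : 'M[R]_d) (N : {measure set 'rV[R]_d -> \bar R}) (b : 'rV[R]_d).
Hypothesis trip : generating_triplet A N b.
Hypothesis h0oo : hfun A N r @[r --> 0^'+] --> +oo.

Lemma hfun_gt0 r : 0 < r -> 0 < hfun A N r.
Proof.
by move=> r0; rewrite hfunE (hsqr_gt0 trip h0oo)// invr_gt0 exprn_gt0.
Qed.

Lemma hfun_lt r r' : 0 < r -> r < r' -> hfun A N r' < hfun A N r.
Proof.
move=> r0 rr; have r'0 := lt_trans r0 rr; rewrite !hfunE (hsqr_lt trip h0oo)//.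
  by rewrite invr_ge0 exprn_ge0// ltW.
by rewrite ltf_pV2 ?posrE ?exprn_gt0// ltrXn2r// ltW.
Qed.

Lemma hfun_le r r' : 0 < r -> r <= r' -> hfun A N r' <= hfun A N r.
Proof.
by move=> r0; rewrite le_eqVlt => /predU1P[->//|rr]; rewrite ltW// hfun_lt.
Qed.

Lemma hinvP s : 0 < s -> 0 < hinv A N s /\ hfun A N (hinv A N s) = s.
Proof.
move=> s0; suff [r [r0 hr]] : exists r, 0 < r /\ hfun A N r = s.
  exact: (@xgetPex _ 0 [set r | 0 < r /\ hfun A N r = s] (ex_intro _ r (conj r0 hr))).
have [k k0 hk] := hsqr_surj trip h0oo s0.
exists (Num.sqrt k^-1); split; first by rewrite sqrtr_gt0 invr_gt0.
by rewrite hfunE sqr_sqrtr ?invrK// invr_ge0 ltW.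
Qed.

Lemma hfunK r : 0 < r -> hinv A N (hfun A N r) = r.
Proof.
move=> r0; have [i0 hi] := hinvP (hfun_gt0 r0).
apply/eqP; rewrite eq_le !leNgt; apply/andP; split; apply/negP => lt.
  by have := hfun_lt r0 lt; rewrite hi ltxx.
by have := hfun_lt i0 lt; rewrite hi ltxx.
Qed.

End concentration_inverse.

(** * Comparison of the maximal exponent with the concentration function *)

Section maximal_exponent.
Context {R : realType} {d : nat}.
Variables (A : 'M[R]_d) (N : {measure set 'rV[R]_d -> \bar R}) (b : 'rV[R]_d).
Hypothesis trip : generating_triplet A N b.

Let symA := triplet_sym trip.
Let nnegA := triplet_nneg trip.

(* <x,Ax> + int min(1, <x,z>^2) N(dz), the analogue of h(1/|x|) in the
   direction of [x] only. *)
Definition hdir (x : 'rV[R]_d) : R :=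
  qform A x + \int[N]_z Num.min 1 (dotv x z ^+ 2).

(** The right-hand side of (C4) up to its constant. Formally r d/dr hdir(r x) = 2 udir(r x), which
    is why it governs the growth of [hdir] along rays. *)
Definition udir (x : 'rV[R]_d) : R :=
  qform A x + \int[N]_(z in [set z | `|dotv x z| < 1]) (`|dotv x z| ^+ 2).

Let imd := @integrable_min_dotv R d A N b trip.
Let ioc := @integrable_one_sub_cos R d A N b trip.

Lemma hdir_le_hfun x r : 0 < r -> enorm x <= r -> hdir x <= hfun A N r^-1.
Proof.
move=> r0 xr; rewrite hfunE exprVn invrK lerD//.
  rewrite (le_trans (qform_le_opnorm _ _))// mulrC ler_wpM2r ?opnorm_ge0//.
  by rewrite lerXn2r ?nnegrE ?enorm_ge0// ltW.
apply: le_Rintegral => //.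
  by apply: (@integrable_min_sqr _ _ _ _ _ trip); rewrite exprn_ge0// ltW.
move=> z _; rewrite (le_trans (min_dotv_le _ _))// le_min2//.
by rewrite ler_wpM2l ?sqr_ge0// lerXn2r ?nnegrE ?enorm_ge0// ltW.
Qed.

Lemma rePsi_le_hdir x : rePsi A N x <= 2 * hdir x.
Proof.
rewrite /rePsi /hdir mulrDr -RintegralZl//.
apply: lerD; first by have := nnegA x; lra.
apply: le_Rintegral => //.
  exact: (integrableZl measurableT 2 (imd x)).
by move=> z _; exact: one_sub_cos_le_min.
Qed.

(** The truncated square extended by 0, ready for pointwise comparison with min(1, <x,z>^2) and with
    1 - cos <x,z>. *)
Let usup x := (fun z : 'rV[R]_d => `|dotv x z| ^+ 2) \_ [set z | `|dotv x z| < 1].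

Let usupE x z : usup x z = if `|dotv x z| < 1 then dotv x z ^+ 2 else 0.
Proof.
rewrite /usup patchE real_normK ?num_real//; case: ifPn; first by rewrite inE => ->.
by rewrite notin_setE => /negP/negPf ->.
Qed.

Let musup x : measurable_fun setT (usup x).
Proof.
have -> : usup x = fun z => dotv x z ^+ 2 * \1_[set u | u < 1] (dotv x z ^+ 2).
  apply/funext => z; rewrite usupE indicE.
  have E : (dotv x z ^+ 2 < 1) = (`|dotv x z| < 1).
    by rewrite -(real_normK (num_real _)) expr_lt1.
  case: ifPn; rewrite -E => h.
    by rewrite mem_set// mulr1.
  by rewrite memNset ?mulr0//=; exact/negP.
have mx : measurable_fun setT (fun z : 'rV[R]_d => dotv x z ^+ 2).
  apply: measurable_funX; apply: measurable_dotv; first exact: measurable_cst.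
  exact: measurable_id.
apply: measurable_funM => //; apply: (measurableT_comp _ mx).
have -> : [set u : R | u < 1] = [set` `]-oo, 1[ ] by apply/seteqP; split => u; rewrite /= in_itv.
exact: measurable_indic.
Qed.

Let usup_ge0 x z : 0 <= usup x z.
Proof. by rewrite usupE; case: ifPn => // _; exact: sqr_ge0. Qed.

Let usup_le x z : usup x z <= Num.min 1 (dotv x z ^+ 2).
Proof.
rewrite usupE; case: ifPn => [h|_]; last by rewrite min_dotv_ge0.
by rewrite le_min lexx andbT -(real_normK (num_real _)) ltW// expr_lt1.
Qed.

Let iusup x : N.-integrable setT (EFin \o usup x).
Proof.
apply: (@le_integrable _ _ _ N setT measurableT _
   (EFin \o (fun z => Num.min 1 (dotv x z ^+ 2)))).
- exact/measurable_EFinP.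
- move=> z _; by rewrite /= lee_fin [leLHS]ger0_norm // [leRHS]ger0_norm ?min_dotv_ge0//.
- exact: imd.
Qed.

Let udirE x : udir x = qform A x + \int[N]_z usup x z.
Proof. by rewrite /udir Rintegral_mkcond. Qed.

Lemma udir_le_hdir x : udir x <= hdir x.
Proof.
by rewrite udirE lerD2l; apply: le_Rintegral.
Qed.

Lemma udir_le_rePsi x : udir x <= 8 * rePsi A N x.
Proof.
rewrite udirE /rePsi mulrDr -RintegralZl//.
apply: lerD; first by have := nnegA x; lra.
apply: le_Rintegral => //.
  exact: (integrableZl measurableT 8 (ioc x)).
move=> z _; rewrite usupE; case: ifPn => [h|_].
  by have := @one_sub_cos_ge R (dotv x z); rewrite (le_trans (ltW h)) ?ler1n//; move=> /(_ isT); lra.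
by rewrite mulr_ge0// one_sub_cos_ge0.
Qed.

(* For 0 <= v <= 1, min(1, 4 v) - v / 4 >= 3 v / 4. *)
Lemma hdir_double x : hdir (2^-1 *: x) + 3/4 * udir x <= hdir (2 *: x).
Proof.
rewrite udirE /hdir !qformZ.
suff : \int[N]_z Num.min 1 (dotv (2^-1 *: x) z ^+ 2) + 3/4 * \int[N]_z usup x z
   <= \int[N]_z Num.min 1 (dotv (2 *: x) z ^+ 2).
  by have := nnegA x; lra.
rewrite -RintegralZl// -RintegralD//; last
  exact: (integrableZl measurableT (3/4) (iusup x)).
apply: le_Rintegral => //.
  exact: (integrableD measurableT (imd _) (integrableZl measurableT (3/4) (iusup x))).
move=> z _; rewrite !dotvZl !exprMn usupE -(real_normK (num_real (dotv x z))).
have := normr_ge0 (dotv x z); move: (`|_|) => v v0.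
case: ifPn => [v1|]; last rewrite -leNgt => v1.
  have v2 : v ^+ 2 <= 1 by rewrite expr_le1// ltW.
  have -> : Num.min 1 (2^-1 ^+ 2 * v ^+ 2) = 2^-1 ^+ 2 * v ^+ 2 by apply/min_idPr; lra.
  have := sqr_ge0 v; rewrite le_min; move=> *; apply/andP; split; lra.
by rewrite mulr0 addr0 le_min2// ler_wpM2r ?sqr_ge0//; lra.
Qed.

(** Where |<x,z>| >= 1 both minima equal 1 and cancel; elsewhere the one at l x is at most l^2
    <x,z>^2. *)
Lemma hdir_scale_sub x l : 1 <= l -> hdir (l *: x) - hdir x <= l ^+ 2 * udir x.
Proof.
move=> l1; rewrite udirE /hdir qformZ.
suff : \int[N]_z Num.min 1 (dotv (l *: x) z ^+ 2) - \int[N]_z Num.min 1 (dotv x z ^+ 2)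
   <= l ^+ 2 * \int[N]_z usup x z.
  by have := nnegA x; lra.
rewrite -RintegralZl// -RintegralB//.
apply: le_Rintegral => //.
- exact: (integrableB measurableT (imd _) (imd _)).
- exact: (integrableZl measurableT (l ^+ 2) (iusup x)).
move=> z _; rewrite !dotvZl !exprMn usupE -(real_normK (num_real (dotv x z))).
have := normr_ge0 (dotv x z); move: (`|_|) => v v0.
case: ifPn => [v1|]; last rewrite -leNgt => v1.
  have : Num.min 1 (l ^+ 2 * v ^+ 2) <= l ^+ 2 * v ^+ 2 by rewrite ge_min lexx orbT.
  have : 0 <= Num.min 1 (v ^+ 2) by rewrite le_min ler01 sqr_ge0.
  by lra.
have -> : Num.min 1 (v ^+ 2) = 1 by apply/min_idPl; rewrite expr_ge1.
by rewrite mulr0 subr_le0 ge_min lexx.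
Qed.

Lemma hdir_ge0 x : 0 <= hdir x.
Proof.
apply: addr_ge0; first exact: nnegA.
by apply: Rintegral_ge0 => z _; exact: min_dotv_ge0.
Qed.

Let Psi_set r := [set complex.Re (Psi A N b z) | z in [set z : 'rV[R]_d | enorm z <= r]].

Lemma Psi_set_ub r : 0 < r -> ubound (Psi_set r) (2 * hfun A N r^-1).
Proof.
move=> r0 _ [z zr <-]; rewrite Re_Psi (le_trans (rePsi_le_hdir _))//.
by rewrite ler_pM2l// hdir_le_hfun.
Qed.

Lemma Psi_star_le r : 0 < r -> Psi_star A N b r <= 2 * hfun A N r^-1.
Proof.
move=> r0; apply: ge_sup; last exact: Psi_set_ub.
by exists (complex.Re (Psi A N b 0)), 0 => //=; rewrite enorm0 ltW.
Qed.

Lemma rePsi_le_Psi_star r z : 0 < r -> enorm z <= r -> rePsi A N z <= Psi_star A N b r.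
Proof.
move=> r0 zr; apply: ub_le_sup; first by exists (2 * hfun A N r^-1); exact: Psi_set_ub.
by exists z => //; rewrite Re_Psi.
Qed.

End maximal_exponent.

Lemma integral_mul_indic d (T : measurableType d) (R : realType)
    (mu : {measure set T -> \bar R}) (D : set T) (f : T -> R) :
  (\int[mu]_(x in D) (f x)%:E = \int[mu]_x (f x * \1_D x)%:E)%E.
Proof.
rewrite integral_mkcond; apply: eq_integral => x _.
by rewrite patchE indicE; case: ifPn => _; rewrite ?mulr1 ?mulr0.
Qed.

(** For x != 0 the integral is r - sin(r x) / x, and [sub_sin_ge] at r |x|, divided by |x|, bounds
    it from below. *)
Lemma integral_one_sub_cos (R : realType) (r x : R) : 0 < r ->
  ((r * Num.min 1 ((r * x) ^+ 2) / 96)%:E <=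
    \int[lebesgue_measure]_(s in `[0%R, r]) (1 - cos (s * x))%:E)%E.
Proof.
move=> r0; have [->|x0] := eqVneq x 0.
  rewrite mulr0 expr0n/= (min_idPr _)// mulr0 mul0r.
  by apply: integral_ge0 => s _; rewrite lee_fin one_sub_cos_ge0.
pose F (s : R) : R := s - sin (s * x) / x.
have dF (s : R) : is_derive s (1 : R) F (1 - cos (s * x)).
  by apply: is_derive_eq; rewrite /GRing.scale/=; field.
rewrite (@continuous_FTC2 R (fun s => 1 - cos (s * x)) F 0 r)//.
- rewrite /F mul0r sin0 mul0r subr0 -EFinB subr0 lee_fin.
  have ax : 0 < `|x| by rewrite normr_gt0.
  have := @sub_sin_ge R (r * `|x|) (mulr_gt0 r0 ax).
  rewrite exprMn real_normK ?num_real// -exprMn.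
  have -> : sin (r * x) / x = sin (r * `|x|) / `|x|.
    have [xp|xn] := leP 0 x; first by rewrite ger0_norm.
    by rewrite ltr0_norm// mulrN sinN invrN mulrNN.
  have -> : r - sin (r * `|x|) / `|x| = (r * `|x| - sin (r * `|x|)) / `|x|.
    by field; rewrite gt_eqF.
  rewrite ler_pdivlMr//; move=> h; apply: le_trans h.
  by rewrite le_eqVlt; apply/orP; left; apply/eqP; field.
- apply: continuous_subspaceT => s; apply: differentiable_continuous.
  by apply/derivable1_diffP; apply: ex_derive.
- have cF (s : R) : {for s, continuous F}.
    by apply: differentiable_continuous; apply/derivable1_diffP; exact: ex_derive.
  split.
  + by move=> s _; exact: ex_derive.
  + exact: cvg_at_right_filter (cF 0).
  + exact: cvg_at_left_filter (cF r).
- by move=> s _; rewrite derive1E derive_val.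
Qed.

Section maximal_exponent_lower.
Context {R : realType} {d : nat}.
Variables (A : 'M[R]_d) (N : {measure set 'rV[R]_d -> \bar R}) (b : 'rV[R]_d).
Hypothesis trip : generating_triplet A N b.

(* Averages 1 - cos(s z_i) over s in [0, r]; the average of the exponent is
   at most Psi*(r). *)
Lemma coord_min_le r (i : 'I_d) : 0 < r ->
  \int[N]_z Num.min 1 (dotv (r *: delta_mx ord0 i) z ^+ 2) <= 96 * Psi_star A N b r.
Proof.
move=> r0; set m := fun z => Num.min 1 _.
have im : N.-integrable setT (EFin \o m) := integrable_min_dotv trip _.
have m0 z : 0 <= m z := min_dotv_ge0 _ _.
have mm : measurable_fun setT (fun z => (m z)%:E).
  by apply/measurable_EFinP; exact: measurable_min_dotv.
have m0E z : setT z -> (0 <= (m z)%:E)%E by rewrite lee_fin.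
rewrite -lee_fin /Rintegral fineK ?integrable_fin_num//.
pose f (p : 'rV[R]_d * R) : \bar R :=
  ((1 - cos (p.2 * p.1 ord0 i)) * \1_`[0, r] p.2)%:E.
have f0 p : (0 <= f p)%E.
  by rewrite lee_fin mulr_ge0 ?one_sub_cos_ge0// indicE.
have mf : measurable_fun setT f.
  apply/measurable_EFinP; apply: measurable_funM.
    apply: measurable_funB; first exact: measurable_cst.
    apply: measurable_cosR; apply: measurable_funM; first exact: measurable_snd.
    exact: (measurableT_comp (measurable_coord_rV i) measurable_fst).
  by apply: (measurableT_comp (measurable_indic _) measurable_snd).
have r96 : (0 <= (r / 96)%:E)%E by rewrite lee_fin divr_ge0// ltW.
have h1 : ((r / 96)%:E * \int[N]_z (m z)%:E <=
    \int[N]_z \int[lebesgue_measure]_s f (z, s))%E.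
  rewrite -ge0_integralZl//.
  apply: ge0_le_integral => //.
  - by move=> z _; rewrite mule_ge0// lee_fin.
  - exact: measurable_funeM.
  - exact: (sigma_finite_measurable_tonelli (sigma_finiteT lebesgue_measure) mf f0).
  move=> z _; rewrite -EFinM -integral_mul_indic.
  have := integral_one_sub_cos (z ord0 i) r0; apply: le_trans.
  by rewrite lee_fin /m dotv_delta mulrAC.
(* After the integrals are exchanged, the inner one over N is at most psi(s e_i) <= Psi*(r) for
   every s in [0, r]. *)
have h2 : (\int[N]_z \int[lebesgue_measure]_s f (z, s) <= (r * Psi_star A N b r)%:E)%E.
  rewrite (sigma_finite_tonelli (levy_sigma_finite trip) (sigma_finiteT lebesgue_measure) mf f0).
  apply: (@le_trans _ _ (\int[lebesgue_measure]_(s in `[0%R, r]) (Psi_star A N b r)%:E)%E).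
    rewrite integral_mul_indic; apply: ge0_le_integral => //.
    - by move=> s _; apply: integral_ge0 => z _.
    - pose g (p : R * 'rV[R]_d) := f (p.2, p.1).
      apply: (sigma_finite_measurable_tonelli (f := g) (levy_sigma_finite trip)).
        apply: (measurableT_comp mf); apply: measurable_fun_pair => /=.
          exact: measurable_snd.
        exact: measurable_fst.
      by move=> p; exact: f0.
    - by apply/measurable_EFinP; apply: measurable_funM => //; exact: measurable_indic.
    move=> s _; rewrite /f/= indicE; have [|_] := boolP (s \in _); last first.
      by rewrite mulr0; under eq_integral do rewrite mulr0; rewrite integral0.
    rewrite inE/= in_itv/= mulr1 => /andP[s0 sr].
    under eq_integral do rewrite mulr1.
    apply: (@le_trans _ _ (rePsi A N (s *: delta_mx ord0 i))%:E).
      rewrite /rePsi EFinD /Rintegral fineK; last first.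
        by apply: integrable_fin_num => //; exact: (integrable_one_sub_cos trip).
      rewrite -[leLHS]add0e; apply: leeD; first by rewrite lee_fin (triplet_nneg trip).
      rewrite le_eqVlt; apply/orP; left; apply/eqP; apply: eq_integral => z _.
      by rewrite dotv_delta.
    rewrite lee_fin (rePsi_le_Psi_star trip)//.
    by rewrite enorm_delta ger0_norm.
  rewrite (@integral_cst _ _ R lebesgue_measure `[0, r]%classic)//=.
  by rewrite lebesgue_measure_itv lte_fin r0 -EFinD subr0 -EFinM mulrC.
have := le_trans h1 h2.
have : (\int[N]_z (m z)%:E)%E \is a fin_num by exact: integrable_fin_num.
move=> /fineK <-; rewrite -EFinM !lee_fin => h3.
have rp : 0 < r / 96 by rewrite divr_gt0.
by rewrite -(ler_pM2l rp) (le_trans h3)// le_eqVlt; apply/orP; left; apply/eqP; field.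
Qed.

Lemma min_sum_le (I : finType) (a : I -> R) : (forall i, 0 <= a i) ->
  Num.min 1 (\sum_i a i) <= \sum_i Num.min 1 (a i).
Proof.
move=> a0; have [[i ai]|H] := pselect (exists i, 1 <= a i).
  rewrite (@le_trans _ _ 1)// ?ge_min ?lexx//.
  rewrite (bigD1 i)//= (min_idPl ai) lerDl sumr_ge0// => j _.
  by rewrite le_min ler01 a0.
rewrite ge_min; apply/orP; right; apply: ler_sum => i _.
rewrite le_min lexx andbT leNgt; apply/negP => ai; apply: H.
by exists i; exact: ltW.
Qed.

(** The 1 accounts for A, since r^2 <x, A x> <= psi(r x) <= Psi*(r) on the unit ball. The 96 d
    accounts for N: |z|^2 is the sum of d squared coordinates, and [coord_min_le] costs 96 for
    each. *)
Lemma hfun_le_Psi_star r : 0 < r ->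
  hfun A N r^-1 <= (1 + d%:R * 96) * Psi_star A N b r.
Proof.
move=> r0; rewrite hfunE exprVn invrK mulrDl mul1r lerD//.
  rewrite mulrC -ler_pdivlMr ?exprn_gt0//.
  apply: opnorm_le_qform; [exact: (triplet_sym trip)|exact: (triplet_nneg trip)|].
  move=> x x1; rewrite ler_pdivlMr ?exprn_gt0// mulrC -qformZ.
  apply: (@le_trans _ _ (rePsi A N (r *: x))); last first.
    apply: (rePsi_le_Psi_star trip) => //.
    by rewrite enormZ ger0_norm ?(ltW r0)//; apply: ler_piMr => //; exact: ltW.
  rewrite lerDl; apply: Rintegral_ge0 => z _; exact: one_sub_cos_ge0.
pose m (i : 'I_d) z := Num.min 1 (dotv (r *: delta_mx ord0 i) z ^+ 2).
have im i : N.-integrable setT (EFin \o m i) := integrable_min_dotv trip _.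
have m0 i z : 0 <= m i z := min_dotv_ge0 _ _.
have is1 : N.-integrable setT (fun z => \sum_(i < d) (m i z)%:E)%E.
  exact: (@integrable_sum _ _ _ N setT measurableT _ _ xpredT (fun i => EFin \o m i)).
have isum : N.-integrable setT (EFin \o (fun z => \sum_(i < d) m i z)).
  by apply: eq_integrable is1 => // z _; rewrite /= sumEFin.
apply: (@le_trans _ _ (\int[N]_z \sum_(i < d) m i z)).
  apply: le_Rintegral => //.
    by apply: (integrable_min_sqr trip); rewrite exprn_ge0// ltW.
  move=> z _; apply: le_trans (min_sum_le _); last by move=> i; exact: sqr_ge0.
  rewrite le_min2// sqr_enorm mulr_suml; apply: ler_sum => i _.
  by rewrite dotv_delta exprMn expr2 mulrC.
rewrite /Rintegral.
under eq_integral do rewrite -sumEFin.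
rewrite (@integral_sum _ _ _ N setT measurableT _ (fun i => EFin \o m i))//.
rewrite (eq_bigr (fun i => (\int[N]_z m i z)%:E)); last first.
  by move=> i _; have /fineK <- := integrable_fin_num measurableT (im i).
rewrite sumEFin/=.
rewrite -mulrA mulr_natl -[X in _ *+ X]card_ord -sumr_const; apply: ler_sum => i _.
exact: coord_min_le.
Qed.

End maximal_exponent_lower.

Lemma exists_expr_gt (R : realType) (q x : R) : 2 <= q -> exists n, x < q ^+ n.
Proof.
move=> q2; exists (Num.bound `|x|).
rewrite (le_lt_trans (ler_norm x))// (lt_le_trans (archi_boundP (normr_ge0 x)))//.
rewrite (@le_trans _ _ (2 ^+ Num.bound `|x|))//.
  by rewrite -natrX ler_nat ltnW// ltn_expl.
by rewrite lerXn2r// nnegrE// (le_trans _ q2).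
Qed.

Lemma floor_expr (R : realType) (q l : R) : 2 <= q -> 1 <= l ->
  exists k, q ^+ k <= l < q ^+ k.+1.
Proof.
move=> q2 l1; have ex := exists_expr_gt l q2.
case: (ex_minnP ex) => -[|k] lk mk; first by rewrite expr0 ltNge l1 in lk.
exists k; rewrite lk andbT leNgt; apply/negP => /mk.
by rewrite ltnn.
Qed.

(* Iterating [g (q u) >= 2 g u] gives growth of exponent [ln 2 / ln q]. *)
Lemma doubling_power_growth (R : realType) (g : R -> R) (u0 q : R) :
  0 <= u0 -> 2 <= q ->
  (forall u, u0 < u -> 0 <= g u) ->
  (forall u v, u0 < u -> u <= v -> g u <= g v) ->
  (forall u, u0 < u -> 2 * g u <= g (q * u)) ->
  exists2 a, 0 < a <= 2 &
    forall l u, 1 <= l -> u0 < u -> l `^ a * g u <= 2 * g (l * u).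
Proof.
move=> u00 q2 g0 gle g2.
have q0 : 0 < q by rewrite (lt_le_trans _ q2).
have lnq : ln 2 <= ln q by rewrite ler_ln ?posrE.
have ln20 : 0 < ln (2 : R) by rewrite ln_gt0// ltr1n.
have lnq0 : 0 < ln q by rewrite (lt_le_trans ln20).
(* This exponent a solves q^a = 2; it is at most 1 because q >= 2. *)
exists (ln 2 / ln q).
  rewrite divr_gt0//= ler_pdivrMr// (le_trans lnq)//; lra.
move=> l u l1 u0u; have [k /andP[kl lk]] := floor_expr q2 l1.
have up : 0 < u by rewrite (le_lt_trans u00).
have iter n : 2 ^+ n * g u <= g (q ^+ n * u).
  elim: n => [|n IH]; first by rewrite !expr0 !mul1r.
  rewrite !exprS -!mulrA; apply: le_trans (g2 _ _).
    by rewrite ler_pM2l.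
  rewrite (lt_le_trans u0u)// ler_peMl ?(ltW up)// exprn_ege1//.
  by rewrite (le_trans _ q2)// ler1n.
(* l < q^(k+1) gives l^a <= 2^(k+1). The factor 2 in the conclusion pays for rounding l down to the
   power q^k. *)
have l_le : l `^ (ln 2 / ln q) <= 2 ^+ k.+1.
  rewrite (@le_trans _ _ ((q ^+ k.+1) `^ (ln 2 / ln q)))//.
    apply: ge0_ler_powR; rewrite ?nnegrE ?divr_ge0 ?ltW ?exprn_gt0//.
      by rewrite (lt_le_trans _ l1).
  rewrite -powR_mulrn ?(ltW q0)// -powRrM mulrC powRrM.
  have -> : q `^ (ln 2 / ln q) = 2.
    by rewrite /powR gt_eqF// divfK ?gt_eqF// lnK ?posrE.
  by rewrite powR_mulrn.
apply: (@le_trans _ _ (2 ^+ k.+1 * g u)); first by rewrite ler_wpM2r ?g0.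
rewrite exprS -mulrA ler_pM2l// (le_trans (iter k))// gle//.
  rewrite (lt_le_trans u0u)// ler_peMl ?(ltW up)// exprn_ege1//.
  by rewrite (le_trans _ q2)// ler1n.
by rewrite ler_wpM2r// ltW.
Qed.

(** * Equivalence of (C3) and (C4) *)

Section scaling_conditions.
Context {R : realType} {d : nat}.
Variables (A : 'M[R]_d) (N : {measure set 'rV[R]_d -> \bar R}) (b : 'rV[R]_d).

(* Here [u] stands for 1/T, so that [u = 0] is the case T = oo, and [t < T]
   reads [u < 1/t]. *)
Definition C2_at (u : R) := exists2 c : R, 0 < c &
  forall t : R, 0 < t -> u < t^-1 ->
    (\int[lebesgue_rV R d]_z (expR (- t * rePsi A N z))%:E <=
      (c * hinv A N t^-1 ^- d)%:E)%E.

Definition C3_at (u : R) := exists c alpha : R, [/\ 0 < c <= 1, 0 < alpha <= 2,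
  (forall x : 'rV[R]_d, u < enorm x -> c * Psi_star A N b (enorm x) <= rePsi A N x) &
  (forall l r : R, 1 <= l -> u < r ->
    c * l `^ alpha * Psi_star A N b r <= Psi_star A N b (l * r))].

Definition C4_at (u : R) := exists2 c : R, 1 <= c &
  forall x : 'rV[R]_d, u < enorm x -> Psi_star A N b (enorm x) <= c * udir A N x.

Hypothesis trip : generating_triplet A N b.
Hypothesis h0oo : hfun A N r @[r --> 0^'+] --> +oo.

Let K : R := 1 + d%:R * 96.
Let K1 : 1 <= K. Proof. by rewrite lerDl mulr_ge0. Qed.
Let K0 : 0 < K. Proof. exact: lt_le_trans K1. Qed.
Let hK r : 0 < r -> hfun A N r^-1 <= K * Psi_star A N b r.
Proof. exact: hfun_le_Psi_star. Qed.
Let Sh r : 0 < r -> Psi_star A N b r <= 2 * hfun A N r^-1.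
Proof. exact: Psi_star_le. Qed.
Let h0 r : 0 < r -> 0 < hfun A N r^-1.
Proof. by move=> r0; apply: (hfun_gt0 trip h0oo); rewrite invr_gt0. Qed.
Let S0 r : 0 < r -> 0 < Psi_star A N b r.
Proof. by move=> r0; rewrite -(pmulr_rgt0 _ K0) (lt_le_trans (h0 r0))// hK. Qed.

(* It is enough to get the growth condition of [C3] for [h] by a single factor 2. *)
Lemma C3_of_doubling u0 q c : 0 <= u0 -> 1 <= q -> 0 < c ->
  (forall u, u0 < u -> 2 * hfun A N u^-1 <= hfun A N (q * u)^-1) ->
  (forall x, u0 < enorm x -> c * Psi_star A N b (enorm x) <= rePsi A N x) ->
  C3_at u0.
Proof.
move=> u00 q1 c0 h2 Sc.
have hle u v : 0 < u -> u <= v -> hfun A N u^-1 <= hfun A N v^-1.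
  move=> up uv; have vp := lt_le_trans up uv.
  by apply: (hfun_le trip h0oo); [rewrite invr_gt0|rewrite lef_pV2 ?posrE].
have pos u : u0 < u -> 0 < u by exact: le_lt_trans.
(* [doubling_power_growth] wants a factor of at least 2; enlarging q is harmless since u |-> h(1/u)
   is increasing. *)
have [|u u0u|u v u0u uv|u u0u|a a02 ga] :=
  @doubling_power_growth R (fun u => hfun A N u^-1) u0 (Num.max q 2) u00.
- by rewrite le_max lexx orbT.
- by rewrite ltW// h0// pos.
- by apply: hle => //; exact: pos.
- rewrite (le_trans (h2 u u0u))// hle//.
    by apply: mulr_gt0; [exact: lt_le_trans q1|exact: pos].
  by rewrite ler_wpM2r ?(ltW (pos _ u0u))// le_max lexx.
(* The 4 K comes from l^a Psi*(r) <= 2 l^a h(1/r) <= 4 h(1/(l r)) <= 4 K Psi*(l r). *)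
pose c' := Num.min (Num.min 1 c) (4 * K)^-1.
exists c', a; split => //.
- by rewrite !lt_min ltr01 c0/= invr_gt0 mulr_gt0//= !ge_min lexx.
- move=> x ux; apply: le_trans (Sc _ ux).
  rewrite ler_wpM2r ?(ltW (S0 _))//; first exact: pos.
  by rewrite !ge_min lexx orbT.
move=> l r l1 ur; have r0 := pos _ ur.
have lr0 : 0 < l * r by rewrite mulr_gt0// (lt_le_trans _ l1).
have := ga l r l1 ur; have := hK lr0; have := Sh r0.
have : c' <= (4 * K)^-1 by rewrite ge_min lexx orbT.
have la := powR_ge0 l a.
move=> h1 h3 h4 h5.
have h6 : l `^ a * Psi_star A N b r <= 2 * (2 * (K * Psi_star A N b (l * r))).
  apply: (@le_trans _ _ (l `^ a * (2 * hfun A N r^-1))); first by rewrite ler_wpM2l.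
  by rewrite mulrCA ler_pM2l// (le_trans h5)// ler_pM2l.
rewrite -mulrA (@le_trans _ _ ((4 * K)^-1 * (l `^ a * Psi_star A N b r)))//.
  by rewrite ler_wpM2r// mulr_ge0// ltW// S0.
rewrite mulrC ler_pdivrMr ?mulr_gt0//; move: h6; lra.
Qed.

Lemma C3_at_of_C4_at u0 : (0 < d)%N -> 0 <= u0 -> C4_at u0 -> C3_at u0.
Proof.
move=> d0 u00 [c c1 H].
have c0 : 0 < c by exact: lt_le_trans c1.
have pos u : u0 < u -> 0 < u by exact: le_lt_trans.
(* One direction is enough: the hypothesis bounds the isotropic Psi* by [udir] in each direction,
   and [hdir] in a single direction is below h. *)
pose e : 'rV[R]_d := delta_mx ord0 (Ordinal d0).
have ne u : 0 < u -> enorm (u *: e) = u by move=> ?; rewrite enorm_delta gtr0_norm.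
pose f u := hdir A N (u *: e).
have fh u : 0 < u -> f u <= hfun A N u^-1.
  by move=> up; apply: (hdir_le_hfun trip) => //; rewrite ne.
have hU u : u0 < u -> hfun A N u^-1 <= (c * K) * udir A N (u *: e).
  move=> uu; have up := pos _ uu.
  have := H (u *: e); rewrite ne// => /(_ uu) h1.
  by rewrite (le_trans (hK up))// mulrC [leRHS]mulrAC ler_wpM2r ?(ltW K0).
have cK1 : 1 <= c * K by have := mulr_ege1 c1 K1.
have cK0 : 0 < c * K by exact: lt_le_trans cK1.
(* From [hdir_double] at 2 u e: the increment from f(u) to f(4 u) is at least 3/4 udir(2 u e) >= 3/4
   h(1/(2u)) / (c K) >= D f(u). *)
pose D := 3 / (4 * (c * K)).
have D0 : 0 < D by rewrite divr_gt0// mulr_gt0.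
have step u : u0 < u -> (1 + D) * f u <= f (4 * u).
  move=> uu; have up := pos _ uu.
  have := hdir_double trip ((2 * u) *: e); rewrite !scalerA.
  have -> : 2^-1 * (2 * u) = u by field.
  have -> : 2 * (2 * u) = 4 * u by ring.
  rewrite -/(f u) -/(f (4 * u)).
  have uu2 : u <= 2 * u by rewrite ler_peMl ?(ltW up)// ler1n.
  have h1 := hU (2 * u) (lt_le_trans uu uu2).
  have h2 : f u <= hfun A N (2 * u)^-1.
    by apply: (hdir_le_hfun trip); [rewrite mulr_gt0|rewrite ne].
  move=> h3; apply: le_trans h3; rewrite mulrDl mul1r lerD2l.
  have -> : D * f u = 3 / 4 * (f u / (c * K)) by rewrite /D; field; rewrite gt_eqF// gt_eqF.
  rewrite ler_pM2l ?divr_gt0//.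
  by rewrite ler_pdivrMr// mulrC (le_trans h2).
have iter n u : u0 < u -> (1 + D) ^+ n * f u <= f (4 ^+ n * u).
  move=> uu; elim: n => [|n IH]; first by rewrite !expr0 !mul1r.
  rewrite !exprS -!mulrA; apply: le_trans (step _ _).
    by rewrite ler_pM2l// addr_gt0.
  rewrite (lt_le_trans uu)// ler_peMl ?(ltW (pos _ uu))// exprn_ege1//.
  by rewrite ler1n.
(* By Bernoulli's inequality. The threshold 2 c K pays for h(1/u) <= c K f(u) and leaves the factor
   2 of the doubling. *)
have [n nD] : exists n, 2 * (c * K) <= (1 + D) ^+ n.
  pose m := Num.bound (2 * (c * K) / D).
  exists m.
  have : 2 * (c * K) / D < m%:R.
    by apply: archi_boundP; apply: divr_ge0; [apply: mulr_ge0 => //|]; exact: ltW.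
  rewrite ltr_pdivrMr// => /ltW h1; apply: (le_trans h1).
  have B k : 1 + k%:R * D <= (1 + D) ^+ k.
    elim: k => [|k IH]; first by rewrite mul0r addr0 expr0.
    rewrite exprS; apply: (@le_trans _ _ ((1 + D) * (1 + k%:R * D))); last first.
      by rewrite ler_pM2l// addr_gt0.
    rewrite -natr1; have : 0 <= k%:R * D * D by rewrite -mulrA mulr_ge0// mulr_ge0// ltW.
    by lra.
  by have := B m; lra.
apply: (@C3_of_doubling u0 (4 ^+ n) (8 * c)^-1) => //.
- by rewrite exprn_ege1// ler1n.
- by rewrite invr_gt0 mulr_gt0.
- move=> u uu; have up := pos _ uu.
  have up4 : 0 < 4 ^+ n * u by rewrite mulr_gt0// exprn_gt0.
  apply: le_trans (fh _ up4); apply: le_trans (iter n u uu).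
  have fU : udir A N (u *: e) <= f u by exact: (udir_le_hdir trip).
  have f0 : 0 <= f u by exact: (hdir_ge0 trip).
  have h1 : hfun A N u^-1 <= (c * K) * f u.
    by rewrite (le_trans (hU _ uu))// ler_pM2l.
  apply: (@le_trans _ _ (2 * (c * K) * f u)); last by rewrite ler_wpM2r.
  by rewrite -mulrA ler_pM2l.
(* The constant 1/(8 c): Psi*(|x|) <= c udir(x) <= 8 c psi(x). *)
move=> x xu; rewrite mulrC ler_pdivrMr ?mulr_gt0//.
rewrite (le_trans (H x xu))//; have := udir_le_rePsi trip x.
by move=> h; have := ler_wpM2l (ltW c0) h; lra.
Qed.

(** For l with l^a = B, the hypothesis gives 2 hdir(l x) >= psi(l x) >= c^2 B Psi*(|x|) = 4 K
    Psi*(|x|), while hdir(x) <= h(1/|x|) <= K Psi*(|x|). The difference of [hdir] at l x and x is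
    thus at least Psi*(|x|), and by [hdir_scale_sub] it is at most l^2 udir(x). *)
Lemma C4_at_of_C3_at u0 : 0 <= u0 -> C3_at u0 -> C4_at u0.
Proof.
move=> u00 [c [a [/andP[c0 c1] /andP[a0 a2] H1 H2]]].
have pos u : u0 < u -> 0 < u by exact: le_lt_trans.
pose B := 4 * K / c ^+ 2.
have B1 : 1 <= B.
  rewrite ler_pdivlMr ?exprn_gt0// mul1r (@le_trans _ _ 1)//.
    by rewrite expr_le1// ltW.
  by have := K1; lra.
pose l := B `^ a^-1.
have l1 : 1 <= l.
  by rewrite -(powRr0 B) ler_powR// invr_ge0 ltW.
have la : l `^ a = B by rewrite -powRrM mulVf ?gt_eqF// powRr1// (le_trans _ B1).
exists (l ^+ 2); first by rewrite expr_ge1// (le_trans _ l1).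
move=> x xu; have xp := pos _ xu.
have lx : enorm (l *: x) = l * enorm x by rewrite enormZ ger0_norm// (le_trans _ l1).
have lxu : u0 < l * enorm x by rewrite (lt_le_trans xu)// ler_peMl// ltW.
have h1 := rePsi_le_hdir trip (l *: x).
have h2 := H1 (l *: x); rewrite lx in h2; have {}h2 := h2 lxu.
have h3 := H2 l (enorm x) l1 xu; rewrite la in h3.
have h4 := hdir_scale_sub trip x l1.
have h5 : hdir A N x <= hfun A N (enorm x)^-1 by exact: (hdir_le_hfun trip).
have h6 := hK xp.
have h7 : c * (c * B * Psi_star A N b (enorm x)) <= 2 * hdir A N (l *: x).
  by apply: le_trans h1; apply: le_trans h2; rewrite ler_pM2l.
have e : c * (c * B * Psi_star A N b (enorm x)) = 4 * (K * Psi_star A N b (enorm x)).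
  by rewrite /B; field; rewrite gt_eqF.
rewrite e in h7.
have : Psi_star A N b (enorm x) <= K * Psi_star A N b (enorm x).
  by rewrite ler_peMl// ltW// S0.
by lra.
Qed.

End scaling_conditions.

(** * Lebesgue measure, Cauchy and Laplace kernels on R^d *)

Section lebesgue_rV_theory.
Context {R : realType}.
Local Notation mu := (@lebesgue_measure R).

Definition cube (d : nat) (c : 'rV[R]_d) (e : R) : set 'rV[R]_d :=
  [set v | forall i, `|v ord0 i - c ord0 i| <= e].

Let cubeE d (c : 'rV[R]_d) e :
  cube c e = [set v | forall i, `[c ord0 i - e, c ord0 i + e]%classic (v ord0 i)].
Proof.
by apply/seteqP; split => v H i; have := H i; rewrite /= in_itv/= ler_distl.
Qed.

Lemma measurable_cube d (c : 'rV[R]_d) e : measurable (cube c e).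
Proof.
rewrite cubeE.
exact: (@measurable_box R d (fun i => `[c ord0 i - e, c ord0 i + e]%classic)).
Qed.

Lemma lebesgue_rV_cube d (c : 'rV[R]_d) e : 0 <= e ->
  lebesgue_rV R d (cube c e) = ((2 * e) ^+ d)%:E.
Proof.
move=> e0; rewrite cubeE.
rewrite (@lebesgue_rV_box R d (fun i => `[c ord0 i - e, c ord0 i + e]%classic))//.
rewrite (eq_bigr (fun=> (2 * e)%:E)); last first.
  move=> i _; rewrite lebesgue_measure_itv/= lte_fin; case: ifPn => [_|].
    by rewrite -EFinB; congr EFin; ring.
  by rewrite -leNgt => h; congr EFin; lra.
rewrite prodEFin; congr EFin.
by rewrite prodr_const card_ord.
Qed.

Lemma lebesgue_rV_sigma_finite (d : nat) : sigma_finite setT (lebesgue_rV R d).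
Proof.
exists (fun n => cube (0 : 'rV[R]_d) n%:R).
  apply/seteqP; split => // v _.
  exists (Num.bound (\sum_i `|v ord0 i|)) => //= i; rewrite mxE subr0.
  apply: (@le_trans _ _ (\sum_i `|v ord0 i|)).
    by rewrite (bigD1 i)//= lerDl sumr_ge0.
  by rewrite ltW// archi_boundP// sumr_ge0.
move=> n; split; first exact: measurable_cube.
by rewrite lebesgue_rV_cube// ltry.
Qed.

(** Lebesgue measure on R^(d+1) is the image of the product [\x^]. That product agrees with [\x] on
    rectangles, hence everywhere, and Tonelli's theorem then puts the integral over the new
    coordinate inside. *)
Lemma ge0_integral_rV_cons d (f : 'rV[R]_d.+1 -> \bar R) :
  measurable_fun setT f -> (forall v, 0 <= f v)%E ->
  (\int[lebesgue_rV R d.+1]_v f v =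
   \int[lebesgue_rV R d]_v \int[mu]_x f (cons_rV (x, v)))%E.
Proof.
move=> mf f0.
pose phi (p : g_sigma_algebraType R.-ocitv.-measurable * 'rV[R]_d) := cons_rV p.
have mphi : measurable_fun setT phi by exact: measurable_cons_rV.
have mg : measurable_fun setT (f \o phi) by exact: measurableT_comp.
transitivity (\int[(mu \x^ lebesgue_rV R d)%E]_p (f \o phi) p)%E.
  exact: (@ge0_integral_pushforward _ _ _ _ R phi mphi (mu \x^ lebesgue_rV R d)%E setT f).
pose sf2 := @lebesgue_rV_sigma_finite d.
pose M2 : {sigma_finite_measure set 'rV[R]_d -> \bar R} :=
  HB.pack_for (SigmaFiniteMeasure.type _ R) (Measure.sort (lebesgue_rV R d))
    (@isSFinite.Build _ _ _ (Measure.sort (lebesgue_rV R d)) (sfinite_measure_sigma_finite sf2))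
    (@isSigmaFinite.Build _ _ _ (Measure.sort (lebesgue_rV R d)) sf2).
have := @fubini_tonelli2 _ _ _ _ R mu M2 _ mg (fun p => f0 _).
rewrite /fubini_G => <-.
apply: eq_measure_integral => B mB _; apply/esym.
by apply: (@product_measure_unique _ _ _ _ R mu M2) => //= *; rewrite product_measure2E.
Qed.

Lemma ge0_integral_rV_prod d (f : 'I_d -> R -> R) :
  (forall i, measurable_fun setT (f i)) -> (forall i x, 0 <= f i x) ->
  (\int[lebesgue_rV R d]_v (\prod_i f i (v ord0 i))%:E =
   \prod_i \int[mu]_x (f i x)%:E)%E.
Proof.
elim: d f => [|d IH] f mf f0.
  rewrite big_ord0; under eq_integral do rewrite big_ord0.
  by rewrite integral_cst//= diracE in_setT mul1e.
have mprod n (g : 'I_n -> R -> R) : (forall i, measurable_fun setT (g i)) ->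
    measurable_fun setT (fun v : 'rV[R]_n => \prod_i g i (v ord0 i)).
  move=> mg; apply: measurable_prod => i _.
  exact: (measurableT_comp (mg i) (measurable_coord_rV i)).
rewrite ge0_integral_rV_cons; last 2 first.
- by apply/measurable_EFinP; exact: mprod.
- by move=> v; rewrite lee_fin; apply: prodr_ge0 => i _.
rewrite big_ord_recl -IH//.
transitivity (\int[lebesgue_rV R d]_v ((\int[mu]_x (f ord0 x)%:E) *
    (\prod_i f (lift ord0 i) (v ord0 i))%:E))%E.
  apply: eq_integral => v _.
  rewrite -ge0_integralZr//.
  - apply: eq_integral => x _; rewrite big_ord_recl EFinM; congr (_%:E * _%:E)%E.
      by rewrite mxE unlift_none.
    by apply: eq_bigr => i _; rewrite mxE liftK.
  - exact: ((measurable_EFinP _ _).2 (mf ord0)).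
  - by move=> x _; rewrite lee_fin.
  - by rewrite lee_fin; apply: prodr_ge0 => i _.
rewrite ge0_integralZl//.
- by apply/measurable_EFinP; exact: (mprod d (fun i => f (lift ord0 i))).
- by move=> v _; rewrite lee_fin; apply: prodr_ge0 => i _.
- by apply: integral_ge0 => x _; rewrite lee_fin.
Qed.

End lebesgue_rV_theory.

Section cauchy_kernel.
Context {R : realType}.
Local Notation mu := (@lebesgue_measure R).

(** The Fourier transform of [laplace e], left unnormalised: its height is 2 / e and its total mass
    2 pi. *)
Definition cauchy (e x : R) : R := 2 * e / (e ^+ 2 + x ^+ 2).

Lemma cauchy_ge0 e x : 0 <= e -> 0 <= cauchy e x.
Proof. by move=> e0; rewrite divr_ge0 ?mulr_ge0 ?addr_ge0 ?sqr_ge0. Qed.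

Lemma cauchy_le e x : 0 < e -> cauchy e x <= 2 / e.
Proof.
move=> e0; rewrite /cauchy ler_pdivrMr; last by rewrite ltr_pwDl ?exprn_gt0 ?sqr_ge0.
have -> : 2 / e * (e ^+ 2 + x ^+ 2) = 2 * e + 2 / e * x ^+ 2 by field; rewrite gt_eqF.
by rewrite lerDl mulr_ge0 ?sqr_ge0// divr_ge0// ltW.
Qed.

Lemma continuous_cauchy (e c : R) : 0 < e -> continuous (fun x : R => cauchy e (x - c)).
Proof.
move=> e0 x; apply: cvgM; first exact: cvg_cst.
apply: cvgV; first by rewrite gt_eqF// ltr_pwDl ?exprn_gt0 ?sqr_ge0.
apply: cvgD; first exact: cvg_cst.
apply: (cvg_comp (fun x => x - c) (fun x => x ^+ 2)); last exact: exprn_continuous.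
by apply: cvgB; [exact: cvg_id|exact: cvg_cst].
Qed.

Lemma measurable_cauchy (e c : R) : 0 < e -> measurable_fun setT (fun x : R => cauchy e (x - c)).
Proof. by move=> e0; apply: continuous_measurable_fun; exact: continuous_cauchy. Qed.

Lemma cvg_atan_linear (a k : R) : 0 < a ->
  atan (a * n%:R + k) @[n --> \oo] --> pi / 2.
Proof.
move=> a0; apply: (cvg_comp (fun n : nat => a * n%:R + k) atan); last exact: cvgy_atan.
apply/cvgryPge => M; near=> n.
rewrite -lerBlDr -ler_pdivrMl//.
by near: n; exact: nbhs_infty_ger.
Unshelve. all: by end_near. Qed.

Lemma integral_cauchy_itv (e c a b : R) : 0 < e -> a < b ->
  (\int[mu]_(x in `[a, b]) (cauchy e (x - c))%:E =
    (2 * (atan ((b - c) / e) - atan ((a - c) / e)))%:E)%E.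
Proof.
move=> e0 ab; pose F (x : R) : R := 2 * atan ((x - c) / e).
have dF (x : R) : is_derive x (1 : R) F (cauchy e (x - c)).
  apply: is_derive_eq; rewrite /GRing.scale/= /cauchy; field.
  by apply/andP; split; rewrite gt_eqF// ltr_pwDl ?exprn_gt0 ?sqr_ge0.
have cF (s : R) : {for s, continuous F}.
  by apply: differentiable_continuous; apply/derivable1_diffP; exact: ex_derive.
transitivity ((F b)%:E - (F a)%:E)%E; last by rewrite -EFinB mulrBr.
apply: (@continuous_FTC2 R (fun x : R => cauchy e (x - c)) F a b) => //.
- by apply: continuous_subspaceT; exact: continuous_cauchy.
- split.
  + by move=> s _; exact: ex_derive.
  + exact: cvg_at_right_filter (cF a).
  + exact: cvg_at_left_filter (cF b).
- by move=> s _; rewrite derive1E derive_val.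
Qed.

(** Monotone exhaustion by [-n, n], where the antiderivative 2 atan((x - c) / e) is explicit. *)
Lemma integral_cauchy (e c : R) : 0 < e ->
  (\int[mu]_x (cauchy e (x - c))%:E = (2 * pi)%:E)%E.
Proof.
move=> e0.
have mc : measurable_fun setT (fun x : R => (cauchy e (x - c))%:E).
  by apply/measurable_EFinP; exact: measurable_cauchy.
pose F (n : nat) : set R := `[- n%:R, n%:R]%classic.
have UT : \bigcup_n F n = [set: R].
  apply/seteqP; split => // x _; exists (Num.bound `|x|) => //=.
  by rewrite /F/= in_itv/= -ler_norml ltW// archi_boundP.
have nd : nondecreasing_seq F.
  move=> m n mn; apply/subsetPset => x; rewrite /F/= !in_itv/= => /andP[x1 x2].
  have : m%:R <= n%:R :> R by rewrite ler_nat.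
  by move=> ?; apply/andP; split; lra.
have := @ge0_nondecreasing_set_cvg_integral _ (measurableTypeR R) R F
  (fun x : R => (cauchy e (x - c))%:E) mu nd.
rewrite UT => H; apply: (cvg_unique _ (H _ _ _)) => // [n|n|n x _|].
- exact: measurable_itv.
- exact: measurable_funTS.
- by rewrite lee_fin cauchy_ge0// ltW.
pose u (n : nat) : R := 2 * (atan (e^-1 * n%:R + (- c / e)) + atan (e^-1 * n%:R + c / e)).
have lim : u n @[n --> \oo] --> 2 * (pi / 2 + pi / 2 : R).
  apply: cvgM; first exact: cvg_cst.
  by apply: cvgD; apply: cvg_atan_linear; rewrite invr_gt0.
have <- : 2 * (pi / 2 + pi / 2) = 2 * pi :> R by field.
have limE : (u n)%:E @[n --> \oo] --> (2 * (pi / 2 + pi / 2))%:E.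
  by apply: cvg_EFin; [near=> n|exact: lim].
apply: cvg_trans limE.
apply: near_eq_cvg; near=> n => /=.
have n0 : 0 < n%:R :> R by rewrite ltr0n; near: n; exact: nbhs_infty_gt.
rewrite /F (@integral_cauchy_itv e c (- n%:R) n%:R e0); last lra.
congr EFin; congr (2 * _).
have -> : (- n%:R - c) / e = - (e^-1 * n%:R + c / e) by ring.
by rewrite atanN opprK; congr (atan _ + _); ring.
Unshelve. all: by end_near. Qed.

End cauchy_kernel.

Section laplace_kernel.
Context {R : realType}.
Local Notation mu := (@lebesgue_measure R).

Definition laplace (e x : R) : R := expR (- e * `|x|).

Lemma continuous_laplace (e : R) : continuous (laplace e).
Proof.
move=> x; apply: (cvg_comp (fun x => - e * `|x|) expR); last exact: continuous_expR.
by apply: cvgM; [exact: cvg_cst|apply: cvg_norm; exact: cvg_id].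
Qed.

Lemma laplace_ge0 (e x : R) : 0 <= laplace e x. Proof. exact: expR_ge0. Qed.

Lemma laplace_le1 (e x : R) : 0 <= e -> laplace e x <= 1.
Proof. by move=> e0; rewrite -expR0 ler_expR mulNr oppr_le0 mulr_ge0. Qed.

(** Removes the boundary term at +oo in the improper integrals below. *)
Lemma cvg_expRN_bounded (e M : R) (g : R -> R) : 0 < e -> (forall x, `|g x| <= M) ->
  expR (- e * x) * g x @[x --> +oo%R] --> (0 : R).
Proof.
move=> e0 gM; apply/norm_cvg0P.
have lim : expR (- (e * x)) * M @[x --> +oo%R] --> (0 * M : R).
  apply: cvgM; last exact: cvg_cst.
  apply: (cvg_comp (fun x => e * x) (fun y => expR (- y))); last exact: cvgr_expR.
  by apply: gt0_cvgMry => //; exact: cvg_id.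
rewrite mul0r in lim.
apply: (squeeze_cvgr _ (cvg_cst 0) lim).
near=> x; rewrite normr_ge0/= normrM (ger0_norm (expR_ge0 _)) mulNr.
by rewrite ler_wpM2l ?expR_ge0.
Unshelve. all: by end_near. Qed.

Lemma continuous_scale_trig (x : R) (f : R -> R) : continuous f -> continuous (fun z => f (x * z)).
Proof.
move=> cf z; apply: (cvg_comp (fun z => x * z) f); last exact: cf.
by apply: cvgM; [exact: cvg_cst|exact: cvg_id].
Qed.

(** The combination 1 - cos keeps the integrand nonnegative, which the fundamental theorem on a
    half-line asks for; evenness reduces the integral to [0, +oo[. *)
Lemma integral_laplace_one_sub_cos (e x : R) : 0 < e ->
  (\int[mu]_z (laplace e z * (1 - cos (x * z)))%:E =
   (2 * (e^-1 - e / (e ^+ 2 + x ^+ 2)))%:E)%E.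
Proof.
move=> e0; have D0 : e ^+ 2 + x ^+ 2 != 0.
  by rewrite gt_eqF// ltr_pwDl ?exprn_gt0 ?sqr_ge0.
pose f (z : R) : R := laplace e z * (1 - cos (x * z)).
have f0 z : 0 <= f z by rewrite mulr_ge0 ?laplace_ge0 ?one_sub_cos_ge0.
have cf : continuous f.
  move=> z; apply: cvgM; first exact: continuous_laplace.
  apply: cvgB; first exact: cvg_cst.
  by apply: continuous_scale_trig; exact: continuous_cos.
have evf : f =1 f \o -%R by move=> z /=; rewrite /f /laplace normrN mulrN cosN.
rewrite (ge0_symfun_integralT f0 cf evf) EFinM; congr (_ * _)%E.
(* exp(-e z) G(z) is the antiderivative of exp(-e z) (1 - cos(x z)) that vanishes at +oo. *)
pose G (z : R) : R := - e^-1 - (x * sin (x * z) - e * cos (x * z)) / (e ^+ 2 + x ^+ 2).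
pose F (z : R) : R := expR (- e * z) * G z.
have dF (z : R) : is_derive z (1 : R) F (expR (- e * z) * (1 - cos (x * z))).
  by apply: is_derive_eq; rewrite /GRing.scale/= /G; field; rewrite D0 gt_eqF.
have FT : F z @[z --> +oo%R] --> (0 : R).
  apply: (@cvg_expRN_bounded e (e^-1 + (`|x| + e) / (e ^+ 2 + x ^+ 2))) => // z.
  rewrite (le_trans (ler_normD _ _))// !normrN lerD//.
    by rewrite ger0_norm// invr_ge0 ltW.
  rewrite normrM [X in _ * X]ger0_norm ?invr_ge0 ?addr_ge0 ?sqr_ge0//.
  rewrite ler_wpM2r ?invr_ge0 ?addr_ge0 ?sqr_ge0//.
  rewrite (le_trans (ler_normB _ _))// lerD// normrM.
    by rewrite ler_piMr// ler_norml sin_geN1 sin_le1.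
  by rewrite (ger0_norm (ltW e0)) ler_piMr ?(ltW e0)// cos_max.
have -> : [set z : R | 0 <= z] = `[0, +oo[%classic by rewrite set_itvcy.
transitivity (\int[mu]_(z in `[0%R, +oo[) (expR (- e * z) * (1 - cos (x * z)))%:E)%E.
  apply: eq_integral => z; rewrite inE/= in_itv/= andbT => z0.
  by rewrite /f /laplace ger0_norm.
transitivity ((0 : R)%:E - (F 0)%:E)%E; last first.
  rewrite -EFinB; congr EFin; rewrite /F /G !mulr0 sin0 cos0 expR0.
  by field; rewrite D0 gt_eqF.
apply: (@ge0_continuous_FTC2y R (fun z => expR (- e * z) * (1 - cos (x * z)))) => //.
- apply: continuous_subspaceT => z; apply: cvgM.
    by apply: continuous_scale_trig; exact: continuous_expR.
  apply: cvgB; first exact: cvg_cst.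
  by apply: continuous_scale_trig; exact: continuous_cos.
- apply: cvg_at_right_filter; apply: differentiable_continuous.
  by apply/derivable1_diffP; exact: ex_derive.
- by move=> z _; rewrite derive1E derive_val.
Qed.

Lemma integral_laplace (e : R) : 0 < e ->
  (\int[mu]_z (laplace e z)%:E = (2 / e)%:E)%E.
Proof.
move=> e0.
have evf : laplace e =1 laplace e \o -%R by move=> z /=; rewrite /laplace normrN.
rewrite (ge0_symfun_integralT (laplace_ge0 e) (@continuous_laplace e) evf).
pose F (z : R) : R := expR (- e * z) * (- e^-1).
have dF (z : R) : is_derive z (1 : R) F (expR (- e * z)).
  by apply: is_derive_eq; rewrite /GRing.scale/=; field; rewrite gt_eqF.
have -> : [set z : R | 0 <= z] = `[0, +oo[%classic by rewrite set_itvcy.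
rewrite EFinM; congr (_ * _)%E.
transitivity (\int[mu]_(z in `[0%R, +oo[) (expR (- e * z))%:E)%E.
  apply: eq_integral => z; rewrite inE/= in_itv/= andbT => z0.
  by rewrite /laplace ger0_norm.
transitivity ((0 : R)%:E - (F 0)%:E)%E; last first.
  by rewrite -EFinB; congr EFin; rewrite /F mulr0 expR0; ring.
apply: (@ge0_continuous_FTC2y R (fun z => expR (- e * z))) => //.
- apply: continuous_subspaceT => z.
  by apply: continuous_scale_trig; exact: continuous_expR.
- by apply: (@cvg_expRN_bounded e `|- e^-1| (fun=> - e^-1)).
- apply: cvg_at_right_filter; apply: differentiable_continuous.
  by apply/derivable1_diffP; exact: ex_derive.
- by move=> z _; rewrite derive1E derive_val.
Qed.

Lemma measurable_laplace (e : R) : measurable_fun setT (laplace e).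
Proof. by apply: continuous_measurable_fun; exact: continuous_laplace. Qed.

Lemma integrable_laplace (e : R) : 0 < e -> mu.-integrable setT (EFin \o laplace e).
Proof.
move=> e0; apply/integrableP; split.
  exact: ((measurable_EFinP _ _).2 (measurable_laplace e)).
under eq_integral do rewrite /= ger0_norm ?laplace_ge0//.
by rewrite integral_laplace// ltry.
Qed.

Lemma integrable_laplaceM (e : R) (g : R -> R) : 0 < e -> continuous g ->
  (forall z, `|g z| <= 2) -> mu.-integrable setT (EFin \o (fun z => laplace e z * g z)).
Proof.
move=> e0 cg g2.
apply: (@le_integrable _ _ _ mu setT measurableT _ (fun z => 2%:E * (laplace e z)%:E)%E).
- apply: ((measurable_EFinP _ _).2 _); apply: continuous_measurable_fun => z.
  by apply: cvgM; [exact: continuous_laplace|exact: cg].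
- move=> z _; rewrite /= lee_fin normrM [X in X * _]ger0_norm ?laplace_ge0//.
  rewrite [leRHS]ger0_norm ?mulr_ge0 ?laplace_ge0// mulrC.
  by rewrite ler_wpM2r ?laplace_ge0.
- exact: (integrableZl measurableT 2 (integrable_laplace e0)).
Qed.

Lemma Rintegral_laplace_cos (e x : R) : 0 < e ->
  \int[mu]_z (laplace e z * cos (x * z)) = cauchy e x.
Proof.
move=> e0.
have c1 : continuous (fun z => 1 - cos (x * z)).
  move=> z; apply: cvgB; first exact: cvg_cst.
  by apply: continuous_scale_trig; exact: continuous_cos.
have i1 := @integrable_laplaceM e _ e0 c1 _.
have {}i1 : mu.-integrable setT (EFin \o (fun z => laplace e z * (1 - cos (x * z)))).
  by apply: i1 => z; rewrite ger0_norm ?one_sub_cos_ge0// lerBlDr; have := cos_geN1 (x * z); lra.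
transitivity (\int[mu]_z (laplace e z - laplace e z * (1 - cos (x * z)))).
  by apply: eq_Rintegral => z _; ring.
rewrite (@RintegralB _ _ R mu setT (laplace e) _ measurableT (integrable_laplace e0) i1).
rewrite /Rintegral integral_laplace// integral_laplace_one_sub_cos//= /cauchy.
by field; rewrite !gt_eqF// ltr_pwDl ?exprn_gt0 ?sqr_ge0.
Qed.

(** The integrand is odd and Lebesgue measure is invariant under reflection. *)
Lemma Rintegral_laplace_sin (e x : R) : 0 < e ->
  \int[mu]_z (laplace e z * sin (x * z)) = 0.
Proof.
move=> e0; set f := fun z => _.
have cs : continuous (fun z => sin (x * z)).
  by apply: continuous_scale_trig; exact: continuous_sin.
have fi : mu.-integrable setT (EFin \o f).
  apply: integrable_laplaceM => // z.
  by rewrite (@le_trans _ _ 1) ?ler1n// ler_norml sin_geN1 sin_le1.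
suff : \int[mu]_z f z = - \int[mu]_z f z by lra.
have odd z : f (- z) = - f z by rewrite /f /laplace normrN mulrN sinN mulrN.
rewrite -[RHS]mulN1r -RintegralZl//.
have fNi : mu.-integrable setT ((EFin \o f) \o (-%R : measurableTypeR R -> measurableTypeR R)).
  apply: (@eq_integrable _ _ _ mu setT measurableT (fun z => (-1)%:E * (f z)%:E)%E).
    by move=> z _; rewrite /= odd -EFinM mulN1r.
  exact: integrableZl.
have mN : measurable_fun setT (-%R : measurableTypeR R -> measurableTypeR R).
  exact: oppr_measurable.
rewrite /Rintegral; congr fine.
transitivity (\int[pushforward mu (-%R : measurableTypeR R -> measurableTypeR R)]_z (f z)%:E)%E.
  by apply: eq_measure_integral => B mB _; exact/esym/lebesgue_measureN.
rewrite (@integral_pushforward _ _ _ _ R _ mN mu setT (EFin \o f))//.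
  by apply: eq_integral => z _; rewrite /= odd mulN1r.
exact: (measurable_int _ fi).
Qed.

End laplace_kernel.

Section product_kernels.
Context {R : realType}.
Local Notation mu := (@lebesgue_measure R).

(** The exponential of the l^1 norm rather than the Euclidean one, so that the kernel and its
    transform [cauchy_rV] factor over the coordinates. *)
Definition laplace_rV (d : nat) (e : R) (z : 'rV[R]_d) : R :=
  \prod_(i < d) laplace e (z ord0 i).

Definition cauchy_rV (d : nat) (e : R) (x : 'rV[R]_d) : R :=
  \prod_(i < d) cauchy e (x ord0 i).

(** The phase [a] carries the contribution of the other coordinates when one coordinate is
    integrated out. *)
Lemma integral_laplace_one_add_cos (e x a : R) : 0 < e ->
  (\int[mu]_z (laplace e z * (1 + cos (a + x * z)))%:E =
   (2 / e + cos a * cauchy e x)%:E)%E.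
Proof.
move=> e0.
have cc : continuous (fun z => cos (x * z)).
  by apply: continuous_scale_trig; exact: continuous_cos.
have cs : continuous (fun z => sin (x * z)).
  by apply: continuous_scale_trig; exact: continuous_sin.
have ic : mu.-integrable setT (EFin \o (fun z => laplace e z * cos (x * z))).
  by apply: integrable_laplaceM => // z; rewrite (@le_trans _ _ 1) ?ler1n ?cos_max.
have is1 : mu.-integrable setT (EFin \o (fun z => laplace e z * sin (x * z))).
  apply: integrable_laplaceM => // z.
  by rewrite (@le_trans _ _ 1) ?ler1n// ler_norml sin_geN1 sin_le1.
have il := integrable_laplace e0.
have icZ := integrableZl measurableT (cos a) ic.
have isZ := integrableZl measurableT (sin a) is1.
transitivity (\int[mu]_z ((laplace e z)%:E + ((cos a)%:E * (laplace e z * cos (x * z))%:E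
    - (sin a)%:E * (laplace e z * sin (x * z))%:E)))%E.
  apply: eq_integral => z _; rewrite -!EFinM -EFinB -EFinD; congr EFin.
  by rewrite cosD; ring.
rewrite (@integralD _ _ R mu setT measurableT _ _ il (integrableB measurableT icZ isZ)).
rewrite (@integralB _ _ R mu setT measurableT _ _ icZ isZ).
rewrite !integralZl// integral_laplace//.
have := Rintegral_laplace_cos x e0; have := Rintegral_laplace_sin x e0.
rewrite /Rintegral => hs hc.
rewrite -(fineK (integrable_fin_num measurableT ic)).
rewrite -(fineK (integrable_fin_num measurableT is1)).
by rewrite /= hs hc mulr0 oppr0 adde0 -EFinM -EFinD.
Qed.

Lemma measurable_laplace_rV d e : measurable_fun setT (@laplace_rV d e).
Proof.
apply: measurable_prod => i _.
exact: (measurableT_comp (measurable_laplace e) (measurable_coord_rV i)).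
Qed.

Lemma laplace_rV_ge0 d e (z : 'rV[R]_d) : 0 <= laplace_rV e z.
Proof. by apply: prodr_ge0 => i _; exact: laplace_ge0. Qed.

Lemma laplace_rV_le1 d e (z : 'rV[R]_d) : 0 <= e -> laplace_rV e z <= 1.
Proof.
move=> e0; suff /andP[] : 0 <= laplace_rV e z <= 1 by [].
apply: (big_ind (fun x : R => 0 <= x <= 1)) => [|x y /andP[? ?] /andP[? ?]|i _].
- by rewrite ler01 lexx.
- by rewrite mulr_ge0//= mulr_ile1.
- by rewrite laplace_ge0 laplace_le1.
Qed.

Lemma integral_laplace_rV d e : 0 < e ->
  (\int[lebesgue_rV R d]_z (laplace_rV e z)%:E = ((2 / e) ^+ d)%:E)%E.
Proof.
move=> e0.
rewrite (@ge0_integral_rV_prod R d (fun=> laplace e)); last 2 first.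
- by move=> _; exact: measurable_laplace.
- by move=> _ x; exact: laplace_ge0.
rewrite (eq_bigr (fun=> (2 / e)%:E)); last by move=> i _; rewrite integral_laplace.
by rewrite prodEFin prodr_const card_ord.
Qed.

Let mlc d (e a : R) (x : 'rV[R]_d) :
  measurable_fun setT (fun z => laplace_rV e z * (1 + cos (a + dotv x z))).
Proof.
apply: measurable_funM; first exact: measurable_laplace_rV.
apply: measurable_funD; first exact: measurable_cst.
apply: measurable_cosR; apply: measurable_funD; first exact: measurable_cst.
by apply: measurable_dotv; [exact: measurable_cst|exact: measurable_id].
Qed.

(* Written for 1 + cos, so that only Tonelli's theorem is needed. *)
Lemma integral_laplace_rV_one_add_cos d (e a : R) (x : 'rV[R]_d) : 0 < e ->
  (\int[lebesgue_rV R d]_z (laplace_rV e z * (1 + cos (a + dotv x z)))%:E =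
   ((2 / e) ^+ d + cos a * cauchy_rV e x)%:E)%E.
Proof.
move=> e0; elim: d a x => [|d IH] a x.
  rewrite (eq_integral (cst (1 + cos a)%:E)); last first.
    by move=> z _; rewrite /laplace_rV /dotv !big_ord0 mul1r addr0.
  by rewrite integral_cst//= diracE in_setT mule1 expr0 /cauchy_rV big_ord0 mulr1.
rewrite ge0_integral_rV_cons; last 2 first.
- by apply/measurable_EFinP; exact: mlc.
- by move=> v; rewrite lee_fin mulr_ge0 ?laplace_rV_ge0.
pose x' : 'rV[R]_d := \row_i x ord0 (lift ord0 i).
set c := cauchy e (x ord0 ord0).
have c2e : 0 <= 2 / e - c by rewrite subr_ge0 cauchy_le.
have c0 : 0 <= c by rewrite cauchy_ge0// ltW.
(* 2/e + c cos = (2/e - c) + c (1 + cos) has nonnegative coefficients by [cauchy_le], and the second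
   term has the form covered by the induction hypothesis. *)
transitivity (\int[lebesgue_rV R d]_v ((2 / e - c)%:E * (laplace_rV e v)%:E +
   c%:E * (laplace_rV e v * (1 + cos (a + dotv x' v)))%:E))%E.
  apply: eq_integral => v _.
  transitivity (\int[mu]_z ((laplace e z * (1 + cos ((a + dotv x' v) + x ord0 ord0 * z)))%:E
      * (laplace_rV e v)%:E))%E.
    apply: eq_integral => z _; rewrite -EFinM; congr EFin.
    rewrite /laplace_rV /dotv !big_ord_recl.
    under [X in _ * X * _]eq_bigr do rewrite mxE liftK.
    under [X in cos (a + (_ + X))]eq_bigr do rewrite mxE liftK.
    under [X in _ = _ * (_ + cos (_ + X + _)) * _]eq_bigr do rewrite mxE.
    rewrite !mxE !unlift_none [in LHS]addrA [in RHS]addrAC; ring.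
  rewrite ge0_integralZr//; last 3 first.
  - apply: ((measurable_EFinP _ _).2 _); apply: continuous_measurable_fun => z.
    apply: cvgM; first exact: continuous_laplace.
    apply: cvgD; first exact: cvg_cst.
    apply: (cvg_comp (fun z => a + dotv x' v + x ord0 ord0 * z) cos); last exact: continuous_cos.
    apply: cvgD; first exact: cvg_cst.
    by apply: cvgM; [exact: cvg_cst|exact: cvg_id].
  - by move=> z _; rewrite lee_fin mulr_ge0 ?laplace_ge0.
  - by rewrite lee_fin laplace_rV_ge0.
  rewrite integral_laplace_one_add_cos// -!EFinM -EFinD; congr EFin.
  by rewrite -/c; ring.
rewrite ge0_integralD//; last 4 first.
- by move=> z _; rewrite -EFinM lee_fin mulr_ge0 ?laplace_rV_ge0.
- by apply: measurable_funeM; apply/measurable_EFinP; exact: measurable_laplace_rV.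
- by move=> v _; rewrite -EFinM lee_fin; apply: mulr_ge0 => //; rewrite mulr_ge0 ?laplace_rV_ge0.
- by apply: measurable_funeM; apply/measurable_EFinP; exact: mlc.
rewrite !ge0_integralZl_EFin//; last 4 first.
- by move=> v _; rewrite lee_fin mulr_ge0 ?laplace_rV_ge0.
- by apply/measurable_EFinP; exact: mlc.
- by move=> v _; rewrite lee_fin laplace_rV_ge0.
- by apply/measurable_EFinP; exact: measurable_laplace_rV.
rewrite IH integral_laplace_rV// -!EFinM -EFinD; congr EFin.
rewrite /cauchy_rV big_ord_recl -/c exprS.
rewrite (_ : \prod_(i < d) cauchy e (x' ord0 i) = \prod_(i < d) cauchy e (x ord0 (lift ord0 i))).
  by ring.
by apply: eq_bigr => i _; rewrite mxE.
Qed.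

Lemma integrable_laplace_rV d e : 0 < e ->
  (lebesgue_rV R d).-integrable setT (EFin \o @laplace_rV d e).
Proof.
move=> e0; apply/integrableP; split.
  by apply/measurable_EFinP; exact: measurable_laplace_rV.
under eq_integral do rewrite /= ger0_norm ?laplace_rV_ge0//.
by rewrite integral_laplace_rV// ltry.
Qed.

Lemma Rintegral_laplace_rV_cos d (e a : R) (x : 'rV[R]_d) : 0 < e ->
  \int[lebesgue_rV R d]_z (laplace_rV e z * cos (a + dotv x z)) = cos a * cauchy_rV e x.
Proof.
move=> e0.
have i1 : (lebesgue_rV R d).-integrable setT
    (EFin \o (fun z => laplace_rV e z * (1 + cos (a + dotv x z)))).
  apply/integrableP; split; first by apply/measurable_EFinP; exact: mlc.
  under eq_integral do rewrite /= ger0_norm ?mulr_ge0 ?laplace_rV_ge0//.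
  by rewrite integral_laplace_rV_one_add_cos// ltry.
transitivity (\int[lebesgue_rV R d]_z
    (laplace_rV e z * (1 + cos (a + dotv x z)) - laplace_rV e z)).
  by apply: eq_Rintegral => z _; ring.
rewrite RintegralB//; last exact: integrable_laplace_rV.
rewrite /Rintegral integral_laplace_rV_one_add_cos// integral_laplace_rV//=.
by ring.
Qed.

Lemma cauchy_rV_ge0 d e (x : 'rV[R]_d) : 0 < e -> 0 <= cauchy_rV e x.
Proof. by move=> e0; apply: prodr_ge0 => i _; rewrite cauchy_ge0// ltW. Qed.

Lemma integral_cauchy_rV d e (c : 'rV[R]_d) : 0 < e ->
  (\int[lebesgue_rV R d]_x (cauchy_rV e (x - c))%:E = ((2 * pi) ^+ d)%:E)%E.
Proof.
move=> e0.
transitivity (\int[lebesgue_rV R d]_x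
    (\prod_(i < d) cauchy e (x ord0 i - c ord0 i))%:E)%E.
  apply: eq_integral => x _; congr EFin; apply: eq_bigr => i _.
  by rewrite !mxE.
rewrite (@ge0_integral_rV_prod R d (fun i x => cauchy e (x - c ord0 i))); last 2 first.
- by move=> i; exact: measurable_cauchy.
- by move=> i x; rewrite cauchy_ge0// ltW.
rewrite (eq_bigr (fun=> (2 * pi)%:E)); last by move=> i _; rewrite integral_cauchy.
by rewrite prodEFin prodr_const card_ord.
Qed.

End product_kernels.

(** * Measures with a bounded density, and measures determined by boxes *)

Section density_measure.
Context {disp : measure_display} {T : measurableType disp} {R : realType}.
Variables (mu : {measure set T -> \bar R}) (f : T -> R).
Hypotheses (mf : measurable_fun setT f) (f0 : forall x, 0 <= f x).

(** The measure f mu. The hypotheses on f are arguments of the set function so that its measure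
    structure can be inferred from the term. *)
Definition density_measure of measurable_fun setT f & (forall x, 0 <= f x) :=
  fun B : set T => (\int[mu]_(x in B) (f x)%:E)%E.

Local Notation nu := (density_measure mf f0).

Let nu0 : nu set0 = 0%E. Proof. exact: integral_set0. Qed.

Let nu_ge0 B : (0 <= nu B)%E.
Proof. by apply: integral_ge0 => x _; rewrite lee_fin. Qed.

Let nu_sigma_additive : semi_sigma_additive nu.
Proof.
move=> /= F mF tF mUF; rewrite /density_measure; apply: cvg_toP.
  apply: ereal_nondecreasing_is_cvgn => m n mn.
  by apply: lee_sum_nneg_natr => // k _ _; exact: nu_ge0.
rewrite ge0_integral_bigcup//=.
  by apply: measurable_funTS; exact/measurable_EFinP.
by move=> x _; rewrite lee_fin.
Qed.

HB.instance Definition _ := isMeasure.Build _ _ _ nu nu0 nu_ge0 nu_sigma_additive.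

End density_measure.

(* c mu = nu + (c - f) mu, so integrals against nu = f mu are at most c times those against mu. *)
Lemma ge0_integral_density_le d (T : measurableType d) (R : realType)
    (mu nu : {measure set T -> \bar R}) (f : T -> R) (c : R) (g : T -> \bar R) :
  measurable_fun setT f -> (forall x, 0 <= f x <= c) ->
  (forall B, measurable B -> nu B = \int[mu]_(x in B) (f x)%:E)%E ->
  measurable_fun setT g -> (forall x, 0 <= g x)%E ->
  (\int[nu]_x g x <= c%:E * \int[mu]_x g x)%E.
Proof.
move=> mf fc nuE mg g0.
have mh : measurable_fun setT (fun x => c - f x).
  by apply: measurable_funB => //; exact: measurable_cst.
have h0 x : 0 <= c - f x by have /andP[_] := fc x; rewrite subr_ge0.
have f0 x : 0 <= f x by have /andP[] := fc x.
pose rho := density_measure mu mh h0.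
(* The sign of c is read off at a point, so an empty space is treated apart. *)
have [[x _]|noT] := pselect (exists x : T, True); last first.
  have -> : [set: T] = set0 by apply/seteqP; split => // x _; apply: noT; exists x.
  by rewrite !integral_set0 mule0.
have c0 : 0 <= c by rewrite (le_trans (f0 x))//; have /andP[] := fc x.
have <- := @ge0_integral_mscale _ _ R mu setT measurableT (NngNum c0) g mg (fun x _ => g0 x).
have -> : (\int[mscale (NngNum c0) mu]_x g x = \int[measure_add nu rho]_x g x)%E.
  apply: eq_measure_integral => B mB _.
  transitivity (nu B + rho B)%E; last exact/esym/measure_addE.
  rewrite nuE// [rho B]/(density_measure _ _ _ _) -ge0_integralD//.
  - rewrite (eq_integral (cst c%:E)); first by rewrite integral_cst.
    by move=> y _; rewrite -EFinD/=; congr EFin; ring.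
  - by move=> y _; rewrite lee_fin.
  - by apply: measurable_funTS; exact/measurable_EFinP.
  - by move=> y _; rewrite lee_fin.
  - by apply: measurable_funTS; exact/measurable_EFinP.
rewrite ge0_integral_measure_add//.
by rewrite leeDl// integral_ge0.
Qed.

Section boxes.
Context {R : realType} {d : nat}.

Definition obox (a b : 'rV[R]_d) : set 'rV[R]_d :=
  [set v | forall i, a ord0 i < v ord0 i < b ord0 i].

Definition cbox (a b : 'rV[R]_d) : set 'rV[R]_d :=
  [set v | forall i, a ord0 i <= v ord0 i <= b ord0 i].

Definition oboxes : set (set 'rV[R]_d) := [set obox p.1 p.2 | p in setT].

Lemma measurable_obox a b : measurable (obox a b).
Proof.
have -> : obox a b = [set v | forall i, `]a ord0 i, b ord0 i[%classic (v ord0 i)].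
  by apply/seteqP; split => v H i; have := H i; rewrite /= in_itv.
exact: (@measurable_box R d (fun i => `]a ord0 i, b ord0 i[%classic)).
Qed.

Lemma cboxE a b : cbox a b = [set v | forall i, `[a ord0 i, b ord0 i]%classic (v ord0 i)].
Proof. by apply/seteqP; split => v H i; have := H i; rewrite /= in_itv. Qed.

Lemma measurable_cbox a b : measurable (cbox a b).
Proof.
rewrite cboxE; exact: (@measurable_box R d (fun i => `[a ord0 i, b ord0 i]%classic)).
Qed.

Lemma bigcup_obox (v : 'rV[R]_d) :
  exists n : nat, obox (const_mx (- n%:R)) (const_mx n%:R) v.
Proof.
exists (Num.bound (\sum_i `|v ord0 i|)) => i; rewrite !mxE -ltr_norml.
apply: (@le_lt_trans _ _ (\sum_i `|v ord0 i|)).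
  by rewrite (bigD1 i)//= lerDl sumr_ge0.
by rewrite archi_boundP// sumr_ge0.
Qed.

Lemma setI_oboxes : setI_closed oboxes.
Proof.
move=> _ _ [[a b] _ <-] [[a' b'] _ <-].
exists (\row_i Num.max (a ord0 i) (a' ord0 i), \row_i Num.min (b ord0 i) (b' ord0 i)) => //=.
apply/seteqP; split => v /=.
  by move=> H; split => i; have := H i; rewrite !mxE gt_max lt_min => /andP[/andP[? ?] /andP[? ?]]; apply/andP.
move=> [H H'] i; have /andP[h1 h2] := H i; have /andP[h3 h4] := H' i.
by rewrite !mxE gt_max lt_min h1 h2 h3 h4.
Qed.

(** The identity map is measurable from the sigma-algebra generated by boxes to the Borel sets,
    because its coordinates are. *)
Lemma measurable_oboxes : measurable = <<s oboxes >>.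
Proof.
apply/seteqP; split; last first.
  apply: smallest_sub; first exact: sigma_algebra_measurable.
  by move=> _ [[a b] _ <-]; exact: measurable_obox.
have mid : measurable_fun setT (fun v : g_sigma_algebraType oboxes => v : 'rV[R]_d).
  apply: measurable_fun_rV => i.
  apply: (measurability _ (RGenOpens.measurableE R)) => _ [_ [a [b ->] <-]].
  rewrite setTI.
  (* A strip in the i-th coordinate is exhausted by boxes whose other sides are ]-n, n[. *)
  have -> : (fun v : 'rV[R]_d => v ord0 i) @^-1` `]a, b[ =
      \bigcup_n obox (\row_j if j == i then a else - n%:R) (\row_j if j == i then b else n%:R).
    apply/seteqP; split => v /=.
      rewrite in_itv/= => vab; have [n vn] := bigcup_obox v; exists n => // j.
      rewrite !mxE; case: eqP => [->//|_]; have := vn j; by rewrite !mxE.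
    by move=> [n _ H]; have := H i; rewrite !mxE eqxx in_itv.
  apply: bigcup_measurable => n _; apply: sub_sigma_algebra.
  by eexists (_, _).
by move=> B mB; have := mid measurableT B mB; rewrite setTI.
Qed.

Lemma measure_eq_oboxes (m1 m2 : {measure set 'rV[R]_d -> \bar R}) :
  (m1 setT < +oo)%E -> (forall a b, m1 (obox a b) = m2 (obox a b)) ->
  forall B, measurable B -> m1 B = m2 B.
Proof.
move=> fin E B mB.
apply: (measure_unique oboxes (fun n => obox (const_mx (- n%:R)) (const_mx n%:R))) => //.
- exact: measurable_oboxes.
- exact: setI_oboxes.
- by move=> n; exists (const_mx (- n%:R), const_mx n%:R).
- by apply/seteqP; split => // v _; have [n vn] := bigcup_obox v; exists n.
- by move=> _ [[a b] _ <-]; exact: E.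
- move=> n; apply: le_lt_trans fin; apply: le_measure; rewrite ?inE//.
  exact: measurable_obox.
Qed.

End boxes.

(** * Characteristic functions and Fourier inversion *)

Section characteristic_function.
Context {disp : measure_display} {Omega : measurableType disp} {R : realType}.
Variables (P : probability Omega R) (d : nat).
Variable X : Omega -> 'rV[R]_d.
Hypothesis mX : measurable_fun setT X.
Local Notation leb := (lebesgue_rV R d).

Lemma bounded_integrable (f : Omega -> R) (M : R) :
  measurable_fun setT f -> (forall w, `|f w| <= M) -> P.-integrable setT (EFin \o f).
Proof.
move=> mf fM; apply: measurable_bounded_integrable => //.
  by rewrite (le_lt_trans (probability_le1 _ _)) ?ltry.
exists M; split; first exact: num_real.
by move=> N MN w _; exact: le_trans (fM w) (ltW MN).
Qed.

Let int_cst (c : R) : (\int[P]_w c%:E = c%:E)%E.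
Proof.
by rewrite (@integral_cst _ _ _ P setT measurableT c%:E) [X in (_ * X)%E]probability_setT mule1.
Qed.

Let Rint_cst (c : R) : \int[P]_w c = c.
Proof. by rewrite /Rintegral int_cst. Qed.

(* Re (exp(i (a - <x,z>)) E exp(i <X,z>)). *)
Definition shifted_cf (a : R) (x z : 'rV[R]_d) : R :=
  \int[P]_w cos (a + dotv (X w - x) z).

Let mshift (a : R) x z : measurable_fun setT (fun w => cos (a + dotv (X w - x) z)).
Proof.
apply: measurable_cosR; apply: measurable_funD; first exact: measurable_cst.
apply: measurable_dotv; last exact: measurable_cst.
apply: measurable_fun_rV => i; under eq_fun do rewrite !mxE.
apply: measurable_funB; last exact: measurable_cst.
exact: (measurableT_comp (measurable_coord_rV i) mX).
Qed.

Let ishift (a : R) x z : P.-integrable setT (EFin \o (fun w => cos (a + dotv (X w - x) z))).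
Proof. by apply: (@bounded_integrable _ 1) => // w; exact: cos_max. Qed.

Let mX2 (x : 'rV[R]_d) : measurable_fun setT (fun w => X w - x).
Proof.
apply: measurable_fun_rV => i; under eq_fun do rewrite !mxE.
apply: measurable_funB; last exact: measurable_cst.
exact: (measurableT_comp (measurable_coord_rV i) mX).
Qed.

(** Tonelli's theorem applies after adding 1, as 1 + cos >= 0. *)
Lemma measurable_shifted_cf (a : R) x : measurable_fun setT (shifted_cf a x).
Proof.
pose g (p : 'rV[R]_d * Omega) : \bar R := (1 + cos (a + dotv (X p.2 - x) p.1))%:E.
have mg : measurable_fun setT g.
  apply/measurable_EFinP; apply: measurable_funD; first exact: measurable_cst.
  apply: measurable_cosR; apply: measurable_funD; first exact: measurable_cst.
  apply: measurable_dotv; last exact: measurable_fst.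
  exact: (measurableT_comp (mX2 x) measurable_snd).
have g0 p : (0 <= g p)%E by rewrite lee_fin; have := cos_geN1 (a + dotv (X p.2 - x) p.1); lra.
have mt := @sigma_finite_measurable_tonelli _ _ _ _ R P (sigma_finiteT P) g mg g0.
have -> : shifted_cf a x = fun z => fine (\int[P]_w g (z, w)) - 1.
  apply/funext => z; rewrite /g /= /shifted_cf.
  transitivity (\int[P]_w ((1 + cos (a + dotv (X w - x) z)) - 1)).
    by apply: eq_Rintegral => w _; ring.
  have i1 : P.-integrable setT (EFin \o cst (1 : R)).
    by apply: (@bounded_integrable _ 1) => // w; rewrite /= normr1.
  rewrite RintegralB//; last exact: (integrableD measurableT i1 (ishift a x z)).
  by rewrite Rint_cst.
apply: measurable_funB; last exact: measurable_cst.
by apply: (measurableT_comp _ mt).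
Qed.

Lemma shifted_cf_le1 a x z : `|shifted_cf a x z| <= 1.
Proof.
rewrite (le_trans (le_normr_Rintegral _ _))//.
have -> : 1 = \int[P]_w (1 : R) :> R.
  by rewrite Rint_cst.
apply: le_Rintegral => //.
- by apply: (@bounded_integrable _ 1); [apply: measurableT_comp|move=> w; rewrite normr_id cos_max].
- by apply: (@bounded_integrable _ 1) => // w; rewrite /= normr1.
- by move=> w _; exact: cos_max.
Qed.

(** At x = 0, the phases 0 and - pi / 2 give the real and the imaginary part of the characteristic
    function; a rotation by a - <x,z> produces every other shift from these two. *)
Lemma shifted_cf_rotate a x z :
  shifted_cf a x z = cos (a - dotv x z) * shifted_cf 0 0 z
    + cos (a + pi / 2 - dotv x z) * shifted_cf (- (pi / 2)) 0 z.
Proof.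
rewrite /shifted_cf -!RintegralZl// -RintegralD//; last 2 first.
- exact: (integrableZl measurableT _ (ishift _ _ _)).
- exact: (integrableZl measurableT _ (ishift _ _ _)).
apply: eq_Rintegral => w _; rewrite !subr0 add0r.
have -> : dotv (X w - x) z = dotv (X w) z - dotv x z.
  by rewrite dotvC dotvBr !(dotvC z).
have -> : a + pi / 2 - dotv x z = (a - dotv x z) + pi / 2 by ring.
rewrite cosDpihalf (addrC (- (pi / 2))) cosBpihalf.
have -> : a + (dotv (X w) z - dotv x z) = (a - dotv x z) + dotv (X w) z by ring.
by rewrite cosD; ring.
Qed.

Lemma measurable_cauchy_rV e : 0 < e -> measurable_fun setT (@cauchy_rV R d e).
Proof.
move=> e0; apply: measurable_prod => i _.
have := measurable_cauchy (0 : R) e0; under eq_fun do rewrite subr0.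
by move=> mc; exact: (measurableT_comp mc (measurable_coord_rV i)).
Qed.

Lemma cauchy_rV_le e (x : 'rV[R]_d) : 0 < e -> cauchy_rV e x <= (2 / e) ^+ d.
Proof.
move=> e0; have -> : (2 / e) ^+ d = \prod_(i < d) (2 / e).
  by rewrite prodr_const card_ord.
apply: ler_prod => i _; rewrite cauchy_ge0 ?(ltW e0)//=; exact: cauchy_le.
Qed.

Lemma integrable_cauchy_rV e x : 0 < e ->
  P.-integrable setT (EFin \o (fun w => cauchy_rV e (X w - x))).
Proof.
move=> e0; apply: (@bounded_integrable _ ((2 / e) ^+ d)).
  exact: (measurableT_comp (measurable_cauchy_rV e0) (mX2 x)).
by move=> w; rewrite ger0_norm ?cauchy_rV_ge0// cauchy_rV_le.
Qed.

(* Parseval's identity for the Laplace kernel and its Fourier transform. *)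
Lemma integral_laplace_shifted_cf a x e : 0 < e ->
  \int[leb]_z (laplace_rV e z * shifted_cf a x z) =
  cos a * \int[P]_w cauchy_rV e (X w - x).
Proof.
move=> e0; have sl := @lebesgue_rV_sigma_finite R d.
pose f (p : 'rV[R]_d * Omega) : \bar R :=
  (laplace_rV e p.1 * cos (a + dotv (X p.2 - x) p.1))%:E.
have mf : measurable_fun setT f.
  apply/measurable_EFinP; apply: measurable_funM.
    exact: (measurableT_comp (measurable_laplace_rV e) measurable_fst).
  apply: measurable_cosR; apply: measurable_funD; first exact: measurable_cst.
  apply: measurable_dotv; last exact: measurable_fst.
  exact: (measurableT_comp (mX2 x) measurable_snd).
have fi : (\int[leb]_z \int[P]_w `|f (z, w)| < +oo)%E.
  have : (\int[leb]_z (laplace_rV e z)%:E < +oo)%E by rewrite integral_laplace_rV// ltry.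
  apply: le_lt_trans; apply: ge0_le_integral => //.
  - by move=> z _; exact: integral_ge0.
  - apply: (sigma_finite_measurable_tonelli (f := abse \o f) (sigma_finiteT P)) => //.
      exact: measurableT_comp.
    by move=> p; exact: abse_ge0.
  - by apply/measurable_EFinP; exact: measurable_laplace_rV.
  move=> z _; apply: (@le_trans _ _ (\int[P]_w cst (laplace_rV e z)%:E w)%E).
    apply: ge0_le_integral => //.
      have : measurable_fun setT (abse \o f) by exact: measurableT_comp.
      by move=> m; exact: (measurableT_comp m (pair1_measurable z)).
    move=> w _; rewrite /f/= lee_fin normrM ger0_norm ?laplace_rV_ge0//.
    by rewrite ler_piMr ?laplace_rV_ge0// cos_max.
  by rewrite int_cst.
have := sigma_finite_fubini sl (sigma_finiteT P) mf fi.
have -> : (\int[leb]_z \int[P]_w f (z, w) =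
    \int[leb]_z (laplace_rV e z * shifted_cf a x z)%:E)%E.
  apply: eq_integral => z _; rewrite /shifted_cf -RintegralZl//.
  rewrite /Rintegral fineK//; apply: integrable_fin_num => //.
  exact: (integrableZl measurableT (laplace_rV e z) (ishift a x z)).
have -> : (\int[P]_w \int[leb]_z f (z, w) =
    \int[P]_w (cos a * cauchy_rV e (X w - x))%:E)%E.
  apply: eq_integral => w _; rewrite -Rintegral_laplace_rV_cos//.
  rewrite /Rintegral fineK//; apply: integrable_fin_num => //.
  apply: (@le_integrable _ _ _ leb setT measurableT _ (EFin \o laplace_rV e)).
  - apply/measurable_EFinP; apply: measurable_funM; first exact: measurable_laplace_rV.
    apply: measurable_cosR; apply: measurable_funD; first exact: measurable_cst.
    by apply: measurable_dotv; [exact: measurable_cst|exact: measurable_id].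
  - move=> z _; rewrite /= lee_fin normrM ler_piMr// cos_max//.
  - exact: integrable_laplace_rV.
move=> E; rewrite -RintegralZl//; last exact: integrable_cauchy_rV.
by rewrite /Rintegral E.
Qed.

End characteristic_function.

Section laplace_limit.
Context {R : realType} {d : nat}.

Lemma laplace_rVE (e : R) (z : 'rV[R]_d) :
  laplace_rV e z = expR (- e * \sum_(i < d) `|z ord0 i|).
Proof. by rewrite mulr_sumr expR_sum. Qed.

Lemma laplace_rV_le (e e' : R) (z : 'rV[R]_d) : e' <= e -> laplace_rV e z <= laplace_rV e' z.
Proof.
move=> ee; rewrite !laplace_rVE ler_expR ler_wpM2r ?lerN2//.
by apply: sumr_ge0 => i _.
Qed.

Lemma cvg_laplace_rV (z : 'rV[R]_d) :
  laplace_rV (n.+1%:R^-1 : R) z @[n --> \oo] --> (1 : R).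
Proof.
under eq_fun do rewrite laplace_rVE.
have h0 : (n.+1%:R^-1 : R) @[n --> \oo] --> (0 : R).
  by have := @cvg_harmonic R; rewrite /harmonic.
have lim : (fun n : nat => - n.+1%:R^-1 * \sum_(i < d) `|z ord0 i|) @ \oo -->
    - (0 : R) * \sum_(i < d) `|z ord0 i|.
  by apply: cvgM; [exact: cvgN|exact: cvg_cst].
rewrite oppr0 mul0r in lim.
have := @cvg_comp _ _ _ _ (@expR R) _ _ _ lim (@continuous_expR R 0).
by rewrite expR0.
Qed.

End laplace_limit.

Section square_integrable_cf.
Context {disp : measure_display} {Omega : measurableType disp} {R : realType}.
Variables (P : probability Omega R) (d : nat).
Variable X : {mfun Omega >-> 'rV[R]_d}.
Local Notation leb := (lebesgue_rV R d).

Let mX : measurable_fun setT X. Proof. exact: measurable_funP. Qed.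

(** The squared modulus of the characteristic function at z, as real part squared plus imaginary
    part squared. *)
Definition cf_sqr (z : 'rV[R]_d) : R :=
  shifted_cf P X 0 0 z ^+ 2 + shifted_cf P X (- (pi / 2)) 0 z ^+ 2.

Lemma cf_sqr_ge0 z : 0 <= cf_sqr z.
Proof. by rewrite addr_ge0 ?sqr_ge0. Qed.

Lemma measurable_cf_sqr : measurable_fun setT cf_sqr.
Proof.
by apply: measurable_funD; apply: measurable_funX; exact: measurable_shifted_cf.
Qed.

Variables (f : 'rV[R]_d -> R) (S : R).
Hypothesis mf : measurable_fun setT f.
Hypothesis fS : forall x, 0 <= f x <= S.
Hypothesis lawf : forall B, measurable B ->
  (distribution P X B = \int[leb]_(x in B) (f x)%:E)%E.

(** The law is at most S times Lebesgue measure, and the kernel has mass (2 pi)^d wherever it is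
    centred. *)
Let expectation_cauchy_le (e : R) c : 0 < e ->
  \int[P]_w cauchy_rV e (X w - c) <= S * (2 * pi) ^+ d.
Proof.
move=> e0; have ic := integrable_cauchy_rV P mX c e0.
have mc : measurable_fun setT (fun x : 'rV[R]_d => (cauchy_rV e (x - c))%:E).
  apply/measurable_EFinP; apply: (measurableT_comp (measurable_cauchy_rV e0)).
  apply: measurable_fun_rV => i; under eq_fun do rewrite !mxE.
  by apply: measurable_funB; [exact: measurable_coord_rV|exact: measurable_cst].
have c0 x : (0 <= (cauchy_rV e (x - c))%:E)%E by rewrite lee_fin cauchy_rV_ge0.
rewrite -lee_fin /Rintegral fineK; last exact: integrable_fin_num.
have <- : (\int[distribution P X]_x (cauchy_rV e (x - c))%:E =
    \int[P]_w (cauchy_rV e (X w - c))%:E)%E.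
  by rewrite ge0_integral_distribution.
rewrite EFinM -(integral_cauchy_rV c e0).
exact: (@ge0_integral_density_le _ _ R leb (distribution P X) f S _ mf fS lawf mc c0).
Qed.

(** |E exp(i<z,X>)|^2 = E E' cos <X' - X, z> for an independent copy X' of X, realised by a second
    integral over the same space. Fubini's theorem and Parseval's identity turn the left side into E
    E' of the Cauchy kernel at X' - X, and the inner expectation is bounded uniformly in the centre
    X. *)
Let laplace_cf_sqr_le (e : R) : 0 < e ->
  (\int[leb]_z (laplace_rV e z * cf_sqr z)%:E <= (S * (2 * pi) ^+ d)%:E)%E.
Proof.
move=> e0; have sl := @lebesgue_rV_sigma_finite R d.
have cE x z : shifted_cf P X 0 x z = cos (dotv x z) * shifted_cf P X 0 0 z
   + sin (dotv x z) * shifted_cf P X (- (pi / 2)) 0 z.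
  rewrite shifted_cf_rotate// sub0r cosN add0r -opprB cosN cosBpihalf//.
pose g (p : 'rV[R]_d * Omega) : \bar R :=
  (laplace_rV e p.1 * shifted_cf P X 0 (X p.2) p.1)%:E.
have mXz : measurable_fun [set: 'rV[R]_d * Omega] (fun p => dotv (X p.2) p.1).
  apply: measurable_dotv; last exact: measurable_fst.
  exact: (measurableT_comp mX measurable_snd).
have mg : measurable_fun setT g.
  apply/measurable_EFinP; apply: measurable_funM.
    exact: (measurableT_comp (measurable_laplace_rV e) measurable_fst).
  under eq_fun do rewrite cE.
  apply: measurable_funD; apply: measurable_funM.
  - exact: measurable_cosR.
  - exact: (measurableT_comp (measurable_shifted_cf P mX _ _) measurable_fst).
  - exact: measurable_sinR.
  - exact: (measurableT_comp (measurable_shifted_cf P mX _ _) measurable_fst).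
have gi : (\int[leb]_z \int[P]_w `|g (z, w)| < +oo)%E.
  have : (\int[leb]_z (laplace_rV e z)%:E < +oo)%E by rewrite integral_laplace_rV// ltry.
  have mag : measurable_fun setT (abse \o g) by exact: measurableT_comp.
  apply: le_lt_trans; apply: ge0_le_integral => //.
  - by move=> z _; exact: integral_ge0.
  - apply: (sigma_finite_measurable_tonelli (f := abse \o g) (sigma_finiteT P)) => //.
    by move=> p; exact: abse_ge0.
  - by apply/measurable_EFinP; exact: measurable_laplace_rV.
  move=> z _; apply: (@le_trans _ _ (\int[P]_w cst (laplace_rV e z)%:E w)%E).
    apply: ge0_le_integral => //.
      exact: (measurableT_comp mag (pair1_measurable z)).
    move=> w _; rewrite /g/= lee_fin normrM ger0_norm ?laplace_rV_ge0//.
    by rewrite ler_piMr ?laplace_rV_ge0// shifted_cf_le1.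
  by rewrite (@integral_cst _ _ _ P setT measurableT) [X in (_ * X)%E]probability_setT mule1.
have := sigma_finite_fubini sl (sigma_finiteT P) mg gi.
have -> : (\int[leb]_z \int[P]_w g (z, w) = \int[leb]_z (laplace_rV e z * cf_sqr z)%:E)%E.
  apply: eq_integral => z _.
  have ib (h : R -> R) (k : R) : measurable_fun setT (h \o (fun w => dotv (X w) z)) ->
      (forall u, `|h u| <= 1) -> P.-integrable setT (EFin \o (fun w => k * h (dotv (X w) z))).
    move=> mh h1.
    exact: (integrableZl measurableT k (@bounded_integrable _ _ _ P _ 1 mh (fun w => h1 _))).
  have mD : measurable_fun setT (fun w => dotv (X w) z).
    by apply: measurable_dotv => //; exact: measurable_cst.
  have ic k := ib cos k (measurable_cosR mD) (@cos_max R).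
  have s1 (u : R) : `|sin u| <= 1 by rewrite ler_norml sin_geN1 sin_le1.
  have is1 k := ib sin k (measurable_sinR mD) s1.
  have ic1 : P.-integrable setT (EFin \o (fun w => cos (dotv (X w) z))).
    by have := ic 1; under eq_fun do rewrite mul1r.
  have is2 : P.-integrable setT (EFin \o (fun w => sin (dotv (X w) z))).
    by have := is1 1; under eq_fun do rewrite mul1r.
  have E1 : shifted_cf P X 0 0 z = \int[P]_w cos (dotv (X w) z).
    by apply: eq_Rintegral => w _; rewrite subr0 add0r.
  have E2 : shifted_cf P X (- (pi / 2)) 0 z = \int[P]_w sin (dotv (X w) z).
    by apply: eq_Rintegral => w _; rewrite subr0 addrC cosBpihalf.
  have E : \int[P]_w shifted_cf P X 0 (X w) z = cf_sqr z.
    transitivity (\int[P]_w (shifted_cf P X 0 0 z * cos (dotv (X w) z) +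
        shifted_cf P X (- (pi / 2)) 0 z * sin (dotv (X w) z))).
      by apply: eq_Rintegral => w _; rewrite (cE (X w)) mulrC [X in _ + X]mulrC.
    by rewrite RintegralD// !RintegralZl// -E1 -E2 /cf_sqr !expr2.
  have ish : P.-integrable setT (EFin \o (fun w => shifted_cf P X 0 (X w) z)).
    apply: (@eq_integrable _ _ _ P setT measurableT
       (fun w => (shifted_cf P X 0 0 z * cos (dotv (X w) z))%:E +
        (shifted_cf P X (- (pi / 2)) 0 z * sin (dotv (X w) z))%:E)%E).
      by move=> w _; rewrite /= (cE (X w)) -EFinD; congr EFin; ring.
    exact: (integrableD measurableT (ic _) (is1 _)).
  rewrite -E -RintegralZl// /Rintegral fineK//; apply: integrable_fin_num => //.
  exact: (integrableZl measurableT (laplace_rV e z) ish).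
move=> ->.
have -> : (\int[P]_w \int[leb]_z g (z, w) =
    \int[P]_w (\int[P]_w' cauchy_rV e (X w' - X w))%:E)%E.
  apply: eq_integral => w _.
  have := integral_laplace_shifted_cf P mX 0 (X w) e0; rewrite cos0 mul1r => <-.
  rewrite /Rintegral fineK//; apply: integrable_fin_num => //.
  apply: (@le_integrable _ _ _ leb setT measurableT _ (EFin \o laplace_rV e)).
  - apply/measurable_EFinP; apply: measurable_funM; first exact: measurable_laplace_rV.
    exact: measurable_shifted_cf.
  - by move=> z _; rewrite /= lee_fin normrM ler_piMr// shifted_cf_le1.
  - exact: integrable_laplace_rV.
have S0 : 0 <= S by have /andP[] := fS 0; exact: le_trans.
have -> : (S * (2 * pi) ^+ d)%:E = (\int[P]_w cst (S * (2 * pi) ^+ d)%:E w)%E.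
  by rewrite (@integral_cst _ _ _ P setT measurableT) [X in (_ * X)%E]probability_setT mule1.
apply: ge0_le_integral => //.
- by move=> w _; rewrite lee_fin; apply: Rintegral_ge0 => w' _; exact: cauchy_rV_ge0.
- apply/measurable_EFinP.
  pose k (p : Omega * Omega) : \bar R := (cauchy_rV e (X p.2 - X p.1))%:E.
  have mk : measurable_fun setT k.
    apply/measurable_EFinP; apply: (measurableT_comp (measurable_cauchy_rV e0)).
    apply: measurable_fun_rV => i; under eq_fun do rewrite !mxE.
    apply: measurable_funB.
      exact: (measurableT_comp (measurable_coord_rV i) (measurableT_comp mX measurable_snd)).
    exact: (measurableT_comp (measurable_coord_rV i) (measurableT_comp mX measurable_fst)).
  have k0 p : (0 <= k p)%E by rewrite lee_fin cauchy_rV_ge0.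
  have mt := @sigma_finite_measurable_tonelli _ _ _ _ R P (sigma_finiteT P) k mk k0.
  by apply: (measurableT_comp _ mt).
- by move=> w _; rewrite lee_fin; exact: expectation_cauchy_le.
Qed.

(** The Laplace kernel increases to 1 as its parameter decreases to 0, so monotone convergence
    applies. *)
Lemma integral_cf_sqr_le :
  (\int[leb]_z (cf_sqr z)%:E <= (S * (2 * pi) ^+ d)%:E)%E.
Proof.
pose en (n : nat) : R := n.+1%:R^-1.
have en0 n : 0 < en n by rewrite invr_gt0.
have := @cvg_monotone_convergence _ _ R leb setT measurableT
  (fun n z => (laplace_rV (en n) z * cf_sqr z)%:E).
have -> : (fun x : 'rV[R]_d => limn ((fun n z => (laplace_rV (en n) z * cf_sqr z)%:E)^~ x))
    = (fun z => (cf_sqr z)%:E).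
  apply/funext => z; apply/cvg_lim => //; apply: cvg_EFin; first by near=> n.
  rewrite -[X in _ --> X]mul1r; apply: cvgM; last exact: cvg_cst.
  exact: cvg_laplace_rV.
move=> H; apply: cvge_le (H _ _ _).
- by apply: nearW => n; exact: laplace_cf_sqr_le.
- move=> n; apply/measurable_EFinP; apply: measurable_funM.
    exact: measurable_laplace_rV.
  exact: measurable_cf_sqr.
- by move=> n z _; rewrite lee_fin mulr_ge0 ?laplace_rV_ge0 ?cf_sqr_ge0.
- move=> z _ m n mn; rewrite lee_fin ler_wpM2r ?cf_sqr_ge0//.
  by apply: laplace_rV_le; rewrite lef_pV2 ?posrE// ler_nat.
Unshelve. all: by end_near. Qed.

End square_integrable_cf.

Lemma cvg_integral_dominated d (T : measurableType d) (R : realType)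
    (mu : {measure set T -> \bar R}) (D : set T) (f_ : nat -> T -> R) (f g : T -> R) :
  measurable D ->
  (forall n, measurable_fun setT (f_ n)) -> (forall x, f_ n x @[n --> \oo] --> f x) ->
  mu.-integrable D (EFin \o g) -> (forall n x, `|f_ n x| <= g x) ->
  (\int[mu]_(x in D) (f_ n x)%:E)%E @[n --> \oo] --> (\int[mu]_(x in D) (f x)%:E)%E.
Proof.
move=> mD mf cf ig fg.
have mlim : measurable_fun setT f.
  by apply: (@measurable_fun_cvg _ _ R setT f_) => // x _; exact: cf.
have conv x : (f_ n x)%:E @[n --> \oo] --> (f x)%:E.
  by apply: cvg_EFin; [near=> n|exact: cf].
have [_ _ //] := @dominated_convergence _ _ R mu D mD (fun n => EFin \o f_ n) (EFin \o f)
  (EFin \o g) (fun n => measurable_funTS ((measurable_EFinP _ _).2 (mf n)))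
  (measurable_funTS ((measurable_EFinP _ _).2 mlim))
  (aeW _ (fun x _ => conv x)) ig (aeW _ (fun x n _ => fg n x)).
Unshelve. all: by end_near. Qed.

Lemma cvg_prod (R : realType) (I : Type) (r : seq I) (f : I -> nat -> R) (l : I -> R) :
  (forall i, f i n @[n --> \oo] --> l i) ->
  (\prod_(i <- r) f i n) @[n --> \oo] --> \prod_(i <- r) l i.
Proof.
move=> fl; elim: r => [|i r IH].
  by rewrite big_nil; under eq_fun do rewrite big_nil; exact: cvg_cst.
by rewrite big_cons; under eq_fun do rewrite big_cons; exact: cvgM.
Qed.

Lemma cvg_atan_sg (R : realType) (c : R) :
  atan (c / n.+1%:R^-1) @[n --> \oo] --> Num.sg c * (pi / 2).
Proof.
have pos (x : R) : 0 < x -> atan (x / n.+1%:R^-1) @[n --> \oo] --> pi / 2.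
  move=> x0; have := @cvg_atan_linear R x x x0.
  by under eq_fun do rewrite -[X in _ + X]mulr1 -mulrDr natr1 -[X in x * X]invrK.
have [c0|c0|->] := ltgtP c 0.
- rewrite ltr0_sg// mulN1r -[c]opprK.
  under eq_fun do rewrite mulNr atanN.
  by apply: cvgN; apply: pos; rewrite oppr_gt0.
- by rewrite gtr0_sg// mul1r; exact: pos.
- by rewrite sgr0 mul0r; under eq_fun do rewrite mul0r atan0; exact: cvg_cst.
Qed.

Lemma lebesgue_cbox (R : realType) d (a b : 'rV[R]_d) :
  lebesgue_rV R d (cbox a b) = (\prod_(i < d) Num.max 0 (b ord0 i - a ord0 i))%:E.
Proof.
rewrite cboxE (@lebesgue_rV_box R d (fun i => `[a ord0 i, b ord0 i]%classic))//.
rewrite -prodEFin; apply: eq_bigr => i _; rewrite lebesgue_measure_itv/= lte_fin.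
case: ifPn => [ab|]; first by rewrite -EFinB (max_idPr _)// subr_ge0 ltW.
by rewrite -leNgt => ab; rewrite (max_idPl _)// subr_le0.
Qed.

Lemma lebesgue_cbox_lty (R : realType) d (a b : 'rV[R]_d) :
  (lebesgue_rV R d (cbox a b) < +oo)%E.
Proof. by rewrite lebesgue_cbox ltry. Qed.

Section fourier_inversion.
Context {disp : measure_display} {Omega : measurableType disp} {R : realType}.
Variables (P : probability Omega R) (d : nat).
Variable X : {mfun Omega >-> 'rV[R]_d}.
Local Notation leb := (lebesgue_rV R d).

Let mX : measurable_fun setT X. Proof. exact: measurable_funP. Qed.

Variable G : 'rV[R]_d -> R.
Hypothesis iG : leb.-integrable setT (EFin \o G).
Hypothesis GX : forall a x z, `|shifted_cf P X a x z| <= G z.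

Let G0 z : 0 <= G z. Proof. by rewrite (le_trans (normr_ge0 _) (GX 0 0 z)). Qed.

Let en (n : nat) : R := n.+1%:R^-1.
Let en0 n : 0 < en n. Proof. by rewrite invr_gt0. Qed.

Let tpi : R := (2 * pi) ^- d.
Let tpi0 : 0 < tpi. Proof. by rewrite invr_gt0 exprn_gt0// mulr_gt0// pi_gt0. Qed.

(** Fourier inversion in real form: [shifted_cf P X 0 x z] is the real part of exp(-i<x,z>) E
    exp(i<X,z>), and the imaginary part integrates to 0 by [integral_shifted_cf_sin]. *)
Definition inversion_density (x : 'rV[R]_d) : R :=
  (2 * pi) ^- d * \int[leb]_z shifted_cf P X 0 x z.

(** The density of X plus an independent vector of independent Cauchy variables of scale 1/(n+1).
    Unlike the inversion integral it is visibly nonnegative, and this passes to the limit. *)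
Let smooth (n : nat) (x : 'rV[R]_d) : R :=
  tpi * \int[P]_w cauchy_rV (en n) (X w - x).

Let mscf a x : measurable_fun setT (shifted_cf P X a x).
Proof. exact: measurable_shifted_cf. Qed.

Let iscf a x : leb.-integrable setT (EFin \o shifted_cf P X a x).
Proof.
apply: (@le_integrable _ _ _ leb setT measurableT _ (EFin \o G)) => //.
  exact/measurable_EFinP.
by move=> z _; rewrite /= lee_fin (le_trans (GX _ _ _))// ler_norm.
Qed.

Let ilscf n a x : leb.-integrable setT
  (EFin \o (fun z => laplace_rV (en n) z * shifted_cf P X a x z)).
Proof.
apply: (@le_integrable _ _ _ leb setT measurableT _ (EFin \o G)) => //.
  by apply/measurable_EFinP; apply: measurable_funM => //; exact: measurable_laplace_rV.
move=> z _; rewrite /= lee_fin normrM (ger0_norm (laplace_rV_ge0 _ _)) (ger0_norm (G0 z)).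
by rewrite (le_trans _ (GX a x z))// ler_piMl// laplace_rV_le1// ltW.
Qed.

(** By Parseval's identity the left side is the integral of the damped transform, which is dominated
    by G. The phase a = 0 yields the density; a = - pi / 2, where cos a = 0, yields the vanishing of
    the imaginary part. *)
Let cvg_smooth a x :
  cos a * \int[P]_w cauchy_rV (en n) (X w - x) @[n --> \oo] -->
  \int[leb]_z shifted_cf P X a x z.
Proof.
have conv z : (laplace_rV (en n) z * shifted_cf P X a x z)%:E @[n --> \oo] -->
    (shifted_cf P X a x z)%:E.
  apply: cvg_EFin; first by near=> n.
  have := @cvgM _ _ _ _ _ _ _ _ (@cvg_laplace_rV R d z) (cvg_cst (shifted_cf P X a x z)).
  by rewrite mul1r => h; exact: h.
have bnd z n : (`|(laplace_rV (en n) z * shifted_cf P X a x z)%:E| <= (G z)%:E)%E.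
  rewrite /= lee_fin normrM (ger0_norm (laplace_rV_ge0 _ _)).
  by rewrite (le_trans _ (GX a x z))// ler_piMl// laplace_rV_le1// ltW.
have [_ _ H] := @dominated_convergence _ _ R leb setT measurableT
  (fun n z => (laplace_rV (en n) z * shifted_cf P X a x z)%:E)
  (EFin \o shifted_cf P X a x) (EFin \o G)
  (fun n => measurable_int _ (ilscf n a x)) (measurable_int _ (iscf a x))
  (aeW _ (fun z _ => conv z)) iG (aeW _ (fun z n _ => bnd z n)).
have /fine_cvgP[_] : (\int[leb]_z (laplace_rV (en n) z * shifted_cf P X a x z)%:E)%E
   @[n --> \oo] --> (\int[leb]_z shifted_cf P X a x z)%:E.
  by rewrite fineK//; exact: integrable_fin_num (iscf a x).
have -> : (fine \o (fun n => \int[leb]_z (laplace_rV (en n) z * shifted_cf P X a x z)%:E)%E)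
   = (fun n => cos a * \int[P]_w cauchy_rV (en n) (X w - x)).
  by apply/funext => n /=; rewrite -integral_laplace_shifted_cf.
by [].
Unshelve. all: by end_near. Qed.

Lemma integral_shifted_cf_sin x : \int[leb]_z shifted_cf P X (- (pi / 2)) x z = 0.
Proof.
have := @cvg_smooth (- (pi / 2)) x; rewrite cosN cos_pihalf.
under eq_fun do rewrite mul0r.
by move=> h; apply: (cvg_unique _ h) => //; exact: cvg_cst.
Qed.

Let cvg_smooth_density x : smooth n x @[n --> \oo] --> inversion_density x.
Proof.
have := @cvg_smooth 0 x; rewrite cos0; under eq_fun do rewrite mul1r.
by move=> h; apply: cvgM => //; exact: cvg_cst.
Qed.

Let smooth_ge0 n x : 0 <= smooth n x.
Proof.
apply: mulr_ge0; first exact: ltW.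
by apply: Rintegral_ge0 => w _; exact: cauchy_rV_ge0.
Qed.

Let M : R := tpi * \int[leb]_z G z.

Let smooth_le n x : smooth n x <= M.
Proof.
rewrite ler_pM2l//.
have := integral_laplace_shifted_cf P mX 0 x (en0 n); rewrite cos0 mul1r => <-.
apply: le_Rintegral => //.
move=> z _; rewrite (le_trans (ler_norm _))// normrM (ger0_norm (laplace_rV_ge0 _ _)).
by rewrite (le_trans _ (GX 0 x z))// ler_piMl// laplace_rV_le1// ltW.
Qed.

Lemma inversion_density_ge0 x : 0 <= inversion_density x.
Proof. by apply: (cvgr_to_ge (@cvg_smooth_density x)); apply: nearW => n. Qed.

Lemma inversion_density_le x : inversion_density x <= (2 * pi) ^- d * \int[leb]_z G z.
Proof. by apply: (cvgr_to_le (@cvg_smooth_density x)); apply: nearW => n; exact: smooth_le. Qed.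

Let mcauchy2 n : measurable_fun [set: 'rV[R]_d * Omega]
  (fun p => cauchy_rV (en n) (X p.2 - p.1)).
Proof.
apply: (measurableT_comp (measurable_cauchy_rV (en0 n))).
apply: measurable_fun_rV => i; under eq_fun do rewrite !mxE.
apply: measurable_funB.
  exact: (measurableT_comp (measurable_coord_rV i) (measurableT_comp mX measurable_snd)).
exact: (measurableT_comp (measurable_coord_rV i) measurable_fst).
Qed.

Let msmooth n : measurable_fun setT (smooth n).
Proof.
apply: measurable_funM; first exact: measurable_cst.
have mk := (measurable_EFinP _ _).2 (mcauchy2 n).
have k0 (p : 'rV[R]_d * Omega) : (0 <= (EFin \o (fun p => cauchy_rV (en n) (X p.2 - p.1))) p)%E.
  by rewrite lee_fin cauchy_rV_ge0.
have mt := @sigma_finite_measurable_tonelli _ _ _ _ R P (sigma_finiteT P) _ mk k0.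
by apply: (measurableT_comp _ mt).
Qed.

Lemma measurable_inversion_density : measurable_fun setT inversion_density.
Proof.
apply: (@measurable_fun_cvg _ _ R setT smooth) => [n|x _]; [exact: msmooth|exact: cvg_smooth_density].
Qed.

Section box.
Variables a b : 'rV[R]_d.
Hypothesis ab : forall i, a ord0 i < b ord0 i.

(* The Cauchy kernel centred at y, integrated over the box; W is its limit, the
   indicator of the box up to the boundary. *)
Let Wn (n : nat) (y : 'rV[R]_d) : R :=
  \prod_i (pi^-1 * (atan ((b ord0 i - y ord0 i) / en n) - atan ((a ord0 i - y ord0 i) / en n))).

Let W (y : 'rV[R]_d) : R :=
  \prod_i (2^-1 * (Num.sg (b ord0 i - y ord0 i) - Num.sg (a ord0 i - y ord0 i))).

Let cvg_Wn y : Wn n y @[n --> \oo] --> W y.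
Proof.
apply: cvg_prod => i.
set s := Num.sg (b ord0 i - _); set s' := Num.sg (a ord0 i - _).
have -> : 2^-1 * (s - s') = pi^-1 * (s * (pi / 2) - s' * (pi / 2)).
  by have := lt0r_neq0 (pi_gt0 R); move: (pi : R) => p p0; field.
apply: cvgM; first exact: cvg_cst.
by apply: cvgB; exact: cvg_atan_sg.
Qed.

Let Wn_bounds n y : 0 <= Wn n y <= 1.
Proof.
apply: (big_ind (fun x : R => 0 <= x <= 1)) => [|u v /andP[? ?] /andP[? ?]|i _].
- by rewrite ler01 lexx.
- by rewrite mulr_ge0//= mulr_ile1.
have pi0 : 0 < pi :> R := pi_gt0 R.
set u := (b ord0 i - _) / _; set v := (a ord0 i - _) / _.
have uv : v <= u by rewrite ler_pM2r ?invr_gt0// lerB// ltW.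
have := le_atan uv; have := atan_ltpi2 u; have := atan_gtNpi2 v => h1 h2 h3.
rewrite mulr_ge0 ?invr_ge0 ?(ltW pi0) ?subr_ge0//=.
by rewrite mulrC ler_pdivrMr// mul1r; lra.
Qed.

Let mWn n : measurable_fun setT (Wn n).
Proof.
apply: measurable_prod => i _; apply: measurable_funM; first exact: measurable_cst.
have mat : measurable_fun setT (@atan R).
  by apply: continuous_measurable_fun; exact: continuous_atan.
apply: measurable_funB; apply: (measurableT_comp mat); apply: measurable_funM;
  try exact: measurable_cst; apply: measurable_funB; try exact: measurable_cst;
  exact: measurable_coord_rV.
Qed.

(** After Tonelli's theorem the integral over the box is a product of one-dimensional integrals of
    Cauchy kernels, each a difference of arctangents. *)
Let integral_smooth_cbox n :
  (\int[leb]_(x in cbox a b) (smooth n x)%:E = \int[P]_w (Wn n (X w))%:E)%E.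
Proof.
rewrite integral_mul_indic.
pose k (p : 'rV[R]_d * Omega) : \bar R :=
  (tpi * \1_(cbox a b) p.1 * cauchy_rV (en n) (X p.2 - p.1))%:E.
have k0 p : (0 <= k p)%E.
  by rewrite lee_fin mulr_ge0 ?cauchy_rV_ge0// mulr_ge0 ?(ltW tpi0)// indicE.
have mk : measurable_fun setT k.
  apply/measurable_EFinP; apply: measurable_funM; last exact: mcauchy2.
  apply: measurable_funM; first exact: measurable_cst.
  exact: (measurableT_comp (measurable_indic (measurable_cbox a b)) measurable_fst).
transitivity (\int[leb]_x \int[P]_w k (x, w))%E.
  apply: eq_integral => x _.
  have ic := integrable_cauchy_rV P mX x (en0 n).
  rewrite /smooth mulrAC -RintegralZl//.
  rewrite /Rintegral fineK//; apply: integrable_fin_num => //.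
  exact: (integrableZl measurableT (tpi * \1_(cbox a b) x) ic).
rewrite (sigma_finite_tonelli (@lebesgue_rV_sigma_finite R d) (sigma_finiteT P) mk k0).
apply: eq_integral => w _.
pose f (i : 'I_d) (x : R) : R := (2 * pi)^-1 *
  (cauchy (en n) (x - X w ord0 i) * \1_`[a ord0 i, b ord0 i] x).
transitivity (\int[leb]_x (\prod_i f i (x ord0 i))%:E)%E.
  apply: eq_integral => x _; congr EFin.
  rewrite big_split/= [X in _ = _ * X]big_split/= prodr_const card_ord exprVn -/tpi -mulrA; congr (_ * _).
  rewrite mulrC; congr (_ * _).
    apply: eq_bigr => i _; rewrite !mxE /cauchy; congr (_ / (_ + _)).
    by rewrite -sqrrN opprB.
  have [xab|xab] := pselect (cbox a b x).
    rewrite indicE mem_set// big1// => i _.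
    by rewrite indicE mem_set//= in_itv/=; exact: xab.
  have [i xi] : exists i, ~ (a ord0 i <= x ord0 i <= b ord0 i) by exact/existsNP.
  by rewrite indicE memNset// (bigD1 i)//= indicE memNset ?mul0r//=.
rewrite ge0_integral_rV_prod.
- rewrite -prodEFin; apply: eq_bigr => i _.
  transitivity (((2 * pi)^-1)%:E * \int[lebesgue_measure]_x
     (cauchy (en n) (x - X w ord0 i) * \1_`[a ord0 i, b ord0 i] x)%:E)%E.
    rewrite -ge0_integralZl_EFin//.
    + by move=> x _; rewrite lee_fin mulr_ge0 ?cauchy_ge0 ?(ltW (en0 n))// indicE.
    + apply: ((measurable_EFinP _ _).2 _); apply: measurable_funM.
        exact: measurable_cauchy.
      exact: measurable_indic.
    + by rewrite invr_ge0 mulr_ge0// ltW// pi_gt0.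
  rewrite -integral_mul_indic integral_cauchy_itv// -EFinM; congr EFin.
  by have := lt0r_neq0 (pi_gt0 R); move: (pi : R) => p p0; field.
- move=> i; apply: measurable_funM; first exact: measurable_cst.
  by apply: measurable_funM; [exact: measurable_cauchy|exact: measurable_indic].
- move=> i x; apply: mulr_ge0; first by rewrite invr_ge0 mulr_ge0// ltW// pi_gt0.
  by rewrite mulr_ge0 ?cauchy_ge0 ?(ltW (en0 n))// indicE.
Qed.

Let W_bounds y : 0 <= W y <= 1.
Proof.
apply/andP; split.
  by apply: (cvgr_to_ge (@cvg_Wn y)); apply: nearW => n; have /andP[] := Wn_bounds n y.
by apply: (cvgr_to_le (@cvg_Wn y)); apply: nearW => n; have /andP[] := Wn_bounds n y.
Qed.

Let mW : measurable_fun setT W.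
Proof.
apply: (@measurable_fun_cvg _ _ R setT Wn) => [n|y _]; [exact: mWn|exact: cvg_Wn].
Qed.

(** Both sides are limits of the same sequence of integrals: [smooth] is bounded by M on a box of
    finite volume, and Wn by 1 on the probability space. *)
Let integral_density_cbox :
  (\int[leb]_(x in cbox a b) (inversion_density x)%:E = \int[P]_w (W (X w))%:E)%E.
Proof.
have i1 : P.-integrable setT (EFin \o cst (1 : R)).
  by apply: (@bounded_integrable _ _ _ P _ 1) => // w; rewrite /= normr1.
have HP := @cvg_integral_dominated _ _ R P setT (fun n w => Wn n (X w)) (W \o X)
  (cst (1 : R)) measurableT (fun n => measurableT_comp (mWn n) mX)
  (fun w => @cvg_Wn (X w)) i1 _.
have iM : leb.-integrable (cbox a b) (EFin \o cst M).
  apply: measurable_bounded_integrable.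
  - exact: measurable_cbox.
  - by rewrite lebesgue_cbox_lty.
  - exact: measurable_cst.
  - by exists `|M|; split; [exact: num_real|move=> u Mu x _ /=; exact: ltW].
have HL := @cvg_integral_dominated _ _ R leb (cbox a b) smooth inversion_density
  (cst M) (measurable_cbox a b) msmooth (@cvg_smooth_density) iM _.
have HP' : (\int[leb]_(x in cbox a b) (smooth n x)%:E)%E @[n --> \oo] -->
    (\int[P]_w (W (X w))%:E)%E.
  under eq_fun do rewrite integral_smooth_cbox.
  by apply: HP => n w; have /andP[w0 w1] := Wn_bounds n (X w); rewrite /= ger0_norm.
apply: (cvg_unique _ (HL _) HP') => //.
by move=> n x; rewrite ger0_norm.
Qed.

(** W equals 1 inside the open box, 0 outside the closed one, and lies in between on the boundary.
    As the boundary might carry mass of the law, one inequality is obtained for the open box and, in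
    [density_le_cbox], the other for the closed one. *)
Lemma obox_le_density :
  (P (X @^-1` obox a b) <= \int[leb]_(x in cbox a b) (inversion_density x)%:E)%E.
Proof.
have mo : measurable (X @^-1` obox a b).
  by rewrite -[X in measurable X]setTI; apply: mX => //; exact: measurable_obox.
rewrite integral_density_cbox -[X @^-1` _]setIT -integral_indic//.
apply: ge0_le_integral => //.
- by apply/measurable_EFinP; exact: measurable_indic.
- by apply/measurable_EFinP; exact: (measurableT_comp mW mX).
move=> w _; rewrite lee_fin indicE; have [Xw|_] := boolP (w \in _); last first.
  by have /andP[] := W_bounds (X w).
rewrite inE/= in Xw.
rewrite /W big1// => i _; have /andP[h1 h2] := Xw i.
by rewrite gtr0_sg ?subr_gt0// ltr0_sg ?subr_lt0// opprK; field.
Qed.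

Lemma density_le_cbox :
  (\int[leb]_(x in cbox a b) (inversion_density x)%:E <= P (X @^-1` cbox a b))%E.
Proof.
have mc : measurable (X @^-1` cbox a b).
  by rewrite -[X in measurable X]setTI; apply: mX => //; exact: measurable_cbox.
rewrite integral_density_cbox -[X @^-1` _]setIT -integral_indic//.
apply: ge0_le_integral => //.
- by move=> w _; rewrite lee_fin; have /andP[] := W_bounds (X w).
- by apply/measurable_EFinP; exact: (measurableT_comp mW mX).
- by apply/measurable_EFinP; exact: measurable_indic.
move=> w _; rewrite lee_fin indicE; have [Xw|] := boolP (w \in _).
  by have /andP[] := W_bounds (X w).
rewrite notin_setE/= => Xw.
have [i xi] : exists i, ~ (a ord0 i <= X w ord0 i <= b ord0 i) by exact/existsNP.
rewrite /W (bigD1 i)//= (_ : _ * _ = 0)//.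
move/negP: xi; rewrite negb_and -!ltNge => /orP[h|h].
  have hb := lt_trans h (ab i).
  by rewrite !gtr0_sg ?subr_gt0// subrr mulr0 mul0r.
have ha := lt_trans (ab i) h.
by rewrite !ltr0_sg ?subr_lt0// subrr mulr0 mul0r.
Qed.

End box.

End fourier_inversion.

Section box_exhaustion.
Context {R : realType} {d : nat}.
Variables a b : 'rV[R]_d.

(** Moving every face inwards by 1/(n+1) places a closed box between an open box and the original
    open one. The shrunken boxes may be empty. *)
Definition shrink_lo (n : nat) : 'rV[R]_d := \row_i (a ord0 i + n.+1%:R^-1).
Definition shrink_hi (n : nat) : 'rV[R]_d := \row_i (b ord0 i - n.+1%:R^-1).

Lemma obox_sub_cbox (u v : 'rV[R]_d) : obox u v `<=` cbox u v.
Proof. by move=> x H i; have /andP[/ltW -> /ltW ->] := H i. Qed.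

Lemma shrink_cbox_sub n : cbox (shrink_lo n) (shrink_hi n) `<=` obox a b.
Proof.
move=> x H i; have := H i; rewrite !mxE => /andP[h1 h2].
have n0 : 0 < n.+1%:R^-1 :> R by rewrite invr_gt0.
by move: (_^-1) n0 h1 h2 => e n0 h1 h2; apply/andP; split; lra.
Qed.

Let invn_le (m n : nat) : (m <= n)%N -> n.+1%:R^-1 <= m.+1%:R^-1 :> R.
Proof. by move=> mn; rewrite lef_pV2 ?posrE// ler_nat. Qed.

Lemma nondecreasing_shrink_obox :
  nondecreasing_seq (fun n => obox (shrink_lo n) (shrink_hi n)).
Proof.
move=> m n mn; apply/subsetPset => x H i; have := H i; rewrite !mxE => /andP[h1 h2].
by move: (_^-1) (_^-1) (invn_le mn) h1 h2 => e e' h h1 h2; apply/andP; split; lra.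
Qed.

Lemma nondecreasing_shrink_cbox :
  nondecreasing_seq (fun n => cbox (shrink_lo n) (shrink_hi n)).
Proof.
move=> m n mn; apply/subsetPset => x H i; have := H i; rewrite !mxE => /andP[h1 h2].
by move: (_^-1) (_^-1) (invn_le mn) h1 h2 => e e' h h1 h2; apply/andP; split; lra.
Qed.

Lemma bigcup_shrink_obox :
  \bigcup_n obox (shrink_lo n) (shrink_hi n) = obox a b.
Proof.
apply/seteqP; split => [x [n _ /obox_sub_cbox]|x H]; first exact: shrink_cbox_sub.
(* The smallest distance from x to a face, capped by 1. *)
pose e := \big[Num.min/1]_(i < d) Num.min (x ord0 i - a ord0 i) (b ord0 i - x ord0 i).
have e0 : 0 < e.
  apply: (big_ind (fun y : R => 0 < y)) => // [y z y0 z0|i _]; first by rewrite lt_min y0.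
  by have /andP[h1 h2] := H i; rewrite lt_min !subr_gt0 h1.
have [n] := ltr_add_invr e0; rewrite add0r => ne; exists n => // i.
have : e <= Num.min (x ord0 i - a ord0 i) (b ord0 i - x ord0 i) by exact: bigmin_le_cond.
by rewrite le_min !mxE; move: (_^-1) ne => y ne /andP[h1 h2]; apply/andP; split; lra.
Qed.

Lemma bigcup_shrink_cbox :
  \bigcup_n cbox (shrink_lo n) (shrink_hi n) = obox a b.
Proof.
apply/seteqP; split => [x [n _]|x]; first exact: shrink_cbox_sub.
by rewrite -{1}bigcup_shrink_obox => -[n _ /obox_sub_cbox xn]; exists n.
Qed.

End box_exhaustion.

Section inversion_law.
Context {disp : measure_display} {Omega : measurableType disp} {R : realType}.
Variables (P : probability Omega R) (d : nat).
Variable X : {mfun Omega >-> 'rV[R]_d}.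
Local Notation leb := (lebesgue_rV R d).

Variable G : 'rV[R]_d -> R.
Hypothesis iG : leb.-integrable setT (EFin \o G).
Hypothesis GX : forall a x z, `|shifted_cf P X a x z| <= G z.

Let p := inversion_density P X.
Let mp : measurable_fun setT p := measurable_inversion_density iG GX.
Let p0 : forall x, 0 <= p x := inversion_density_ge0 iG GX.

Let obox_le a b : (P (X @^-1` obox a b) <= \int[leb]_(x in cbox a b) (p x)%:E)%E.
Proof.
have [ab|nab] := pselect (forall i, a ord0 i < b ord0 i).
  exact: (obox_le_density iG GX).
have -> : obox a b = set0.
  apply/seteqP; split => // x H; apply: nab => i.
  by have /andP[] := H i; exact: lt_trans.
rewrite preimage_set0 measure0; apply: integral_ge0 => x _.
by rewrite lee_fin.
Qed.

Let le_cbox a b : (\int[leb]_(x in cbox a b) (p x)%:E <= P (X @^-1` cbox a b))%E.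
Proof.
have [ab|nab] := pselect (forall i, a ord0 i < b ord0 i).
  exact: (density_le_cbox iG GX).
have [i ai] : exists i, ~ (a ord0 i < b ord0 i) by exact/existsNP.
have vol0 : leb (cbox a b) = 0%E.
  rewrite lebesgue_cbox (bigD1 i)//= (max_idPl _) ?mul0r// subr_le0 leNgt.
  exact/negP.
rewrite (@null_set_integral _ _ R leb (cbox a b))//; first exact: measurable_cbox.
by apply: measurable_funTS; exact/measurable_EFinP.
Qed.

(** The two inequalities compare open with closed boxes. Applied to the shrunken boxes and passed to
    the limit, they give equality on open boxes, which form a generating system closed under
    intersection. *)
Lemma inversion_law B : measurable B ->
  (distribution P X B = \int[leb]_(x in B) (p x)%:E)%E.
Proof.
move=> mB; pose nu := density_measure leb mp p0.
suff /(_ B mB) : forall C, measurable C -> distribution P X C = nu C by [].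
apply: measure_eq_oboxes.
  by rewrite (le_lt_trans (probability_le1 _ _)) ?ltry.
move=> a b; pose u := shrink_lo a; pose v := shrink_hi b.
have mo n : measurable (obox (u n) (v n)) by exact: measurable_obox.
have mc n : measurable (cbox (u n) (v n)) by exact: measurable_cbox.
have mab : measurable (obox a b) by exact: measurable_obox.
apply/eqP; rewrite eq_le; apply/andP; split.
  have cv : distribution P X (obox (u n) (v n)) @[n --> \oo] --> distribution P X (obox a b).
    rewrite -(bigcup_shrink_obox a b); apply: nondecreasing_cvg_mu => //.
      by rewrite bigcup_shrink_obox.
    exact: nondecreasing_shrink_obox.
  apply: (cvge_le _ cv); apply: nearW => n; apply: (le_trans (obox_le _ _)).
  apply: (@le_measure _ _ _ nu); rewrite ?inE//.
  exact: shrink_cbox_sub.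
have cv : nu (cbox (u n) (v n)) @[n --> \oo] --> nu (obox a b).
  rewrite -(bigcup_shrink_cbox a b); apply: nondecreasing_cvg_mu => //.
    by rewrite bigcup_shrink_cbox.
  exact: nondecreasing_shrink_cbox.
apply: (cvge_le _ cv); apply: nearW => n; apply: (le_trans (le_cbox _ _)).
apply: (@le_measure _ _ _ (distribution P X)); rewrite ?inE//.
exact: shrink_cbox_sub.
Qed.

End inversion_law.

(** * Equivalence of (C2) and (C3) *)

(** g dominates m times the sum of the indicators of the cubes, since at most one of them is nonzero
    at each point. *)
Lemma integral_ge_disjoint_cubes (R : realType) (d n : nat) (c : 'I_n -> 'rV[R]_d)
    (e m : R) (g : 'rV[R]_d -> R) :
  0 <= e -> 0 <= m -> measurable_fun setT g -> (forall z, 0 <= g z) ->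
  (forall k z, cube (c k) e z -> m <= g z) ->
  (forall k l z, cube (c k) e z -> cube (c l) e z -> k = l) ->
  ((n%:R * (2 * e) ^+ d * m)%:E <= \int[lebesgue_rV R d]_z (g z)%:E)%E.
Proof.
move=> e0 m0 mg g0 gm disj.
apply: (@le_trans _ _ (\int[lebesgue_rV R d]_z (\sum_(k < n) (m * \1_(cube (c k) e) z)%:E))%E).
  rewrite ge0_integral_sum//; last 2 first.
  - move=> k; apply/measurable_EFinP; apply: measurable_funM; first exact: measurable_cst.
    by apply: measurable_indic; exact: measurable_cube.
  - by move=> k z _; rewrite lee_fin mulr_ge0// indicE.
  rewrite (eq_bigr (fun=> (m * (2 * e) ^+ d)%:E)); last first.
    move=> k _; under eq_integral do rewrite EFinM.
    rewrite ge0_integralZl_EFin//.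
    - by rewrite integral_indic ?setIT ?lebesgue_rV_cube//; exact: measurable_cube.
    - by apply/measurable_EFinP; apply: measurable_indic; exact: measurable_cube.
  by rewrite sumEFin sumr_const card_ord lee_fin -mulr_natl le_eqVlt; apply/orP; left; apply/eqP; ring.
apply: ge0_le_integral => //.
- by move=> z _; apply: sume_ge0 => k _; rewrite lee_fin mulr_ge0// indicE.
- apply: emeasurable_sum => k; apply/measurable_EFinP.
  apply: measurable_funM; first exact: measurable_cst.
  by apply: measurable_indic; exact: measurable_cube.
- exact/measurable_EFinP.
move=> z _; rewrite sumEFin lee_fin.
have [[k zk]|nz] := pselect (exists k, cube (c k) e z); last first.
  rewrite big1// => k _; rewrite indicE memNset ?mulr0// => zk.
  by apply: nz; exists k.
rewrite (bigD1 k)//= big1 ?addr0.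
  by rewrite indicE mem_set// mulr1 (gm k).
move=> l lk; rewrite indicE memNset ?mulr0// => zl.
by move/eqP: lk; apply; exact: disj zl zk.
Qed.

(** The m-th power of y / m <= exp(y / m). *)
Lemma expr_le_expR (R : realType) (y : R) (m : nat) : (0 < m)%N -> 0 <= y ->
  y ^+ m <= m%:R ^+ m * expR y.
Proof.
move=> m0 y0; have mp : 0 < m%:R :> R by rewrite ltr0n.
have -> : expR y = expR (y / m%:R) ^+ m.
  by rewrite -expRM_natl mulrC divfK// gt_eqF.
rewrite -exprMn lerXn2r ?nnegrE ?mulr_ge0 ?expR_ge0 ?(ltW mp)//.
rewrite mulrC -ler_pdivrMr// (le_trans _ (expR_ge1Dx _))//.
by rewrite lerDr.
Qed.

Section integral_conditions.
Context {R : realType} {d : nat}.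
Variables (A : 'M[R]_d) (N : {measure set 'rV[R]_d -> \bar R}) (b : 'rV[R]_d).
Hypothesis trip : generating_triplet A N b.
Hypothesis h0oo : hfun A N r @[r --> 0^'+] --> +oo.
Hypothesis d_gt0 : (0 < d)%N.
Local Notation leb := (lebesgue_rV R d).
Local Notation psi := (rePsi A N).
Local Notation S := (Psi_star A N b).

Let dp : 0 < d%:R :> R. Proof. by rewrite ltr0n. Qed.

Definition heat_trace (t : R) : \bar R := (\int[leb]_z (expR (- t * psi z))%:E)%E.

Lemma measurable_expR_rePsi t : measurable_fun setT (fun z => expR (- t * psi z)).
Proof.
apply: (measurableT_comp (@measurable_expR R)); apply: measurable_funM.
  exact: measurable_cst.
exact: measurable_rePsi trip.
Qed.

(** The cube of half-side r / d lies in the ball of radius r, where psi <= Psi*(r). *)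
Lemma heat_trace_ge_cube t r : 0 < t -> 0 < r ->
  (((2 * (r / d%:R)) ^+ d * expR (- t * S r))%:E <= heat_trace t)%E.
Proof.
move=> t0 r0.
have := @integral_ge_disjoint_cubes R d 1 (fun=> 0) (r / d%:R) (expR (- t * S r))
  (fun z => expR (- t * psi z)).
rewrite mul1r; apply.
- by rewrite divr_ge0// ltW.
- exact: expR_ge0.
- exact: measurable_expR_rePsi.
- by move=> z; exact: expR_ge0.
- move=> _ z zc; rewrite ler_expR !mulNr lerN2 ler_pM2l//.
  apply: (rePsi_le_Psi_star trip) => //.
  have -> : r = d%:R * (r / d%:R) by rewrite mulrC divfK// gt_eqF.
  by apply: enorm_le_sup => i; have := zc i; rewrite mxE subr0.
- by move=> k l z _ _; rewrite !ord1.
Qed.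

(* The cubes around the multiples k x, k < n, are disjoint, and on all of them
   psi is at most 2 n^2 psi(x) + 2 S(|x|). *)
Lemma heat_trace_ge_tube t n (x : 'rV[R]_d) : 0 < t -> 0 < enorm x ->
  ((n%:R * (enorm x / (2 * d%:R)) ^+ d *
     expR (- t * (2 * n%:R ^+ 2 * psi x + 2 * S (enorm x))))%:E <= heat_trace t)%E.
Proof.
move=> t0 x0; set r := enorm x.
(* With half-side r / (4 d), points of a cube are within r / 4 of its centre, so a common point of
   two cubes would put their centres, which are at least r apart, within r / 2. *)
have := @integral_ge_disjoint_cubes R d n (fun k => k%:R *: x) (r / (4 * d%:R))
  (expR (- t * (2 * n%:R ^+ 2 * psi x + 2 * S r))) (fun z => expR (- t * psi z)).
have -> : 2 * (r / (4 * d%:R)) = r / (2 * d%:R) by field; rewrite gt_eqF.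
have e0 : 0 < r / (4 * d%:R) by rewrite divr_gt0// mulr_gt0.
have de : d%:R * (r / (4 * d%:R)) = r / 4 by field; rewrite gt_eqF.
apply.
- exact: ltW.
- exact: expR_ge0.
- exact: measurable_expR_rePsi.
- by move=> z; exact: expR_ge0.
- move=> k z zc; rewrite ler_expR !mulNr lerN2 ler_pM2l//.
  have -> : z = k%:R *: x + (z - k%:R *: x) by rewrite addrC subrK.
  rewrite (le_trans (rePsiD trip _ _))// lerD//.
    rewrite -mulrA ler_pM2l// (le_trans (rePsi_mulrn trip _ _))//.
    rewrite ler_wpM2r ?(rePsi_ge0 trip)//.
    by rewrite lerXn2r ?nnegrE// ler_nat ltnW.
  rewrite ler_pM2l//; apply: (rePsi_le_Psi_star trip) => //.
  apply: (@le_trans _ _ (r / 4)); last by rewrite ler_pdivrMr// ler_peMr ?ler1n// ltW.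
  by rewrite -de; apply: enorm_le_sup => i; have := zc i; rewrite !mxE.
move=> k l z zk zl; apply/val_inj/eqP; rewrite -(@eqr_nat R) -subr_eq0.
apply/negPn/negP => kl.
have h1 : enorm ((k%:R - l%:R) *: x) <= d%:R * (2 * (r / (4 * d%:R))).
  apply: enorm_le_sup => i; rewrite mxE mulrBl.
  have := zk i; have := zl i; rewrite !mxE distrC => h2 h3.
  have -> : k%:R * x ord0 i - l%:R * x ord0 i =
     - (z ord0 i - k%:R * x ord0 i) - (l%:R * x ord0 i - z ord0 i) by ring.
  by rewrite (le_trans (ler_normB _ _))// normrN; lra.
have : r <= enorm ((k%:R - l%:R) *: x).
  rewrite enormZ ler_peMl ?(ltW x0)//.
  move: kl; have [lk|kl] := leqP l k.
    rewrite -natrB// pnatr_eq0 => lk0; rewrite ger0_norm// ler1n lt0n//.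
  rewrite -opprB oppr_eq0 normrN -natrB ?(ltnW kl)// pnatr_eq0 => lk0.
  by rewrite ger0_norm// ler1n lt0n.
have e2 : d%:R * (2 * (r / (4 * d%:R))) = r / 2 by field; rewrite gt_eqF.
by rewrite e2 in h1; have : 0 < r := x0; lra.
Qed.

(* Otherwise a Psi*(q r) <= 8, and the cube of side 2 q r / d alone would
   contribute more than c r^d to the integral. *)
Lemma doubling_of_heat_trace c : 0 < c -> exists2 q, 1 <= q &
  forall a r, 0 < a -> 0 < r -> a * hfun A N r^-1 <= 2 ->
    (heat_trace a <= (c * r ^+ d)%:E)%E ->
    2 * hfun A N r^-1 <= hfun A N (q * r)^-1.
Proof.
move=> c0; pose E := expR (8 : R).
have E0 : 0 < E by exact: expR_gt0.
(* The cube of half-side q r / d then has volume (2 (1 + c E))^d r^d > c E r^d, where E = e^8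
   compensates the exponential factor. *)
pose q : R := d%:R * (1 + c * E).
have cE : 0 < c * E by rewrite mulr_gt0.
have q1 : 1 <= q by rewrite mulr_ege1 ?ler1n// lerDl ltW.
exists q => // a r a0 r0 ah tr; rewrite leNgt; apply/negP => lt2.
have qr0 : 0 < q * r by rewrite mulr_gt0// (lt_le_trans _ q1).
have := le_trans (heat_trace_ge_cube a0 qr0) tr; rewrite lee_fin.
(* Psi*(q r) <= 2 h(1/(q r)) < 4 h(1/r), and a h(1/r) <= 2. *)
have aS : a * S (q * r) <= 8.
  apply: (@le_trans _ _ (a * (4 * hfun A N r^-1))); last by lra.
  by rewrite ler_pM2l//; have := Psi_star_le trip qr0; lra.
have eE : E^-1 <= expR (- a * S (q * r)).
  by rewrite /E -expRN ler_expR mulNr lerN2.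
have -> : 2 * (q * r / d%:R) = (2 * (1 + c * E)) * r.
  by rewrite /q; field; rewrite gt_eqF.
rewrite exprMn => h1.
have h2 : (2 * (1 + c * E)) ^+ d * r ^+ d * E^-1 <= c * r ^+ d.
  by apply: le_trans h1; rewrite ler_wpM2l// mulr_ge0 ?exprn_ge0 ?(ltW r0)// mulr_ge0// addr_ge0// ltW.
have h3 : (2 * (1 + c * E)) ^+ d <= c * E.
  by move: h2; rewrite mulrAC ler_pM2r ?exprn_gt0// ler_pdivrMr.
have : 2 * (1 + c * E) <= (2 * (1 + c * E)) ^+ d.
  by apply: ler_eXnr => //; lra.
by lra.
Qed.

Let h0 r : 0 < r -> 0 < hfun A N r^-1.
Proof. by move=> r0; apply: (hfun_gt0 trip h0oo); rewrite invr_gt0. Qed.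

(** The time t = 1/h(1/r) belongs to the radius r; at this time the hypothesis bounds the integral
    by c r^d. The cube estimate then gives the growth, the tube estimate the lower bound for psi. *)
Lemma C3_at_of_C2_at u0 : 0 <= u0 -> C2_at A N u0 ->
  exists u1, [/\ 0 <= u1, (u0 = 0 -> u1 = 0) & C3_at A N b u1].
Proof.
move=> u00 [c c0 H].
(* u1 = 1/h^{-1}(u0) carries the range of times over to a range of radii. *)
have [u1 [u10 u1E hu]] : exists u1, [/\ 0 <= u1, (u0 = 0 -> u1 = 0) &
    forall r, u1 < r -> u0 < hfun A N r^-1].
  have [u0E|u0p] := eqVneq u0 0.
    by exists 0; split => // r r0; rewrite u0E h0.
  have {}u0p : 0 < u0 by rewrite lt_neqAle eq_sym u0p.
  have [i0 hi] := hinvP trip h0oo u0p.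
  exists (hinv A N u0)^-1; split; first by rewrite invr_ge0 ltW.
    by move=> E; rewrite E ltxx in u0p.
  move=> r ir; have r0 : 0 < r by rewrite (lt_trans _ ir)// invr_gt0.
  rewrite -{1}hi; apply: (hfun_lt trip h0oo); first by rewrite invr_gt0.
  by rewrite -[ltRHS]invrK ltf_pV2 ?posrE ?invr_gt0.
exists u1; split => //.
have trace r : u1 < r -> (heat_trace (hfun A N r^-1)^-1 <= (c * r ^+ d)%:E)%E.
  move=> ur; have r0 : 0 < r by exact: le_lt_trans ur.
  have := H (hfun A N r^-1)^-1; rewrite invr_gt0 h0// invrK hu// => /(_ isT isT).
  by rewrite (hfunK trip h0oo) ?invr_gt0// exprVn invrK.
have [q q1 hq] := doubling_of_heat_trace c0.
(* The factor (2 d)^d is the volume constant of the tube; e^4 comes from 2 t Psi*(r) <= 4 at t =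
   1/h(1/r). *)
pose C := c * (2 * d%:R) ^+ d * expR 4.
have C0 : 0 < C by rewrite !mulr_gt0 ?expR_gt0 ?exprn_gt0 ?mulr_gt0.
(* The tube estimate will give n exp(-y) <= C with y = 2 n^2 t psi(x). For n > 2 C this excludes y <
   1/2, so psi(x) >= h(1/r) / (4 n^2) >= Psi*(r) / (8 n^2). *)
pose n := (Num.bound (2 * C)).
have nC : 2 * C < n%:R by apply: archi_boundP; rewrite mulr_ge0// ltW.
have n0 : 0 < n%:R :> R by apply: lt_trans nC; rewrite mulr_gt0.
apply: (@C3_of_doubling R d A N b trip h0oo u1 q (8 * n%:R ^+ 2)^-1) => //.
- by rewrite invr_gt0 mulr_gt0// exprn_gt0.
- move=> r ur; have r0 : 0 < r by exact: le_lt_trans ur.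
  apply: (hq (hfun A N r^-1)^-1) => //; first by rewrite invr_gt0 h0.
    by rewrite mulVf ?gt_eqF ?h0// ler1n.
  exact: trace.
move=> x xu; have x0 : 0 < enorm x by exact: le_lt_trans xu.
set r := enorm x in xu x0 *; pose t := (hfun A N r^-1)^-1.
have t0 : 0 < t by rewrite invr_gt0 h0.
have := le_trans (heat_trace_ge_tube n t0 x0) (trace _ xu); rewrite lee_fin -/r.
have tS : t * S r <= 2.
  by rewrite mulrC ler_pdivrMr ?h0// (Psi_star_le trip).
have p0 : 0 <= psi x := rePsi_ge0 trip x.
set y := 2 * n%:R ^+ 2 * (t * psi x).
have -> : - t * (2 * n%:R ^+ 2 * psi x + 2 * S r) = - y - 2 * (t * S r) by rewrite /y; ring.
move=> h1.
have h2 : n%:R * (r / (2 * d%:R)) ^+ d * (expR (- y) * expR (- 4)) <= c * r ^+ d.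
  apply: le_trans h1; rewrite ler_wpM2l ?mulr_ge0 ?exprn_ge0 ?divr_ge0 ?mulr_ge0 ?(ltW x0)//.
  by rewrite -expRD ler_expR; lra.
have h3 : n%:R * expR (- y) <= C.
  move: h2; rewrite exprMn exprVn.
  have -> : n%:R * (r ^+ d * ((2 * d%:R) ^+ d)^-1) * (expR (- y) * expR (- 4)) =
     (n%:R * expR (- y) / ((2 * d%:R) ^+ d * expR 4)) * r ^+ d.
    by rewrite [expR (- 4)]expRN invfM; ring.
  rewrite ler_pM2r ?exprn_gt0// ler_pdivrMr ?mulr_gt0 ?expR_gt0 ?exprn_gt0 ?mulr_gt0//.
  by rewrite mulrA.
have h4 : 1 - y <= expR (- y) by exact: expR_ge1Dx.
have y2 : 1 / 2 <= y.
  rewrite leNgt; apply/negP => yl.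
  have : n%:R * (1 / 2) <= n%:R * expR (- y) by rewrite ler_pM2l//; lra.
  by move: nC h3; lra.
rewrite mulrC ler_pdivrMr ?mulr_gt0 ?exprn_gt0//.
have ht : t * hfun A N r^-1 = 1 by rewrite mulVf// gt_eqF// h0.
have Sh := Psi_star_le trip x0; apply: (le_trans Sh).
have hp := h0 x0; rewrite -/r in hp.
have : hfun A N r^-1 * (1 / 2) <= hfun A N r^-1 * y by rewrite ler_pM2l.
have -> : hfun A N r^-1 * y = 2 * n%:R ^+ 2 * psi x * (t * hfun A N r^-1) by rewrite /y; ring.
by rewrite ht; lra.
Qed.

(** At the scale r = 1/h^{-1}(1/t), with v = |z| / r, the hypothesis makes t psi(z) at least a
    constant times v^a for v > 1. So exp(-t psi) decays faster than the lower bound (2 / (1 +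
    v^2))^d for r^d times the product Cauchy kernel, and the latter has a known integral. *)
Lemma C2_at_of_C3_at u1 : 0 <= u1 -> C3_at A N b u1 ->
  exists u0, [/\ 0 <= u0, (u1 = 0 -> u0 = 0) & C2_at A N u0].
Proof.
move=> u10 [c [a [/andP[c0 c1] /andP[a0 a2] H1 H2]]].
(* u0 = h(1/u1) carries the range of radii back to a range of times. *)
have [u0 [u00 u0E hu]] : exists u0, [/\ 0 <= u0, (u1 = 0 -> u0 = 0) &
    forall s, 0 < s -> u0 < hfun A N s -> u1 < s^-1].
  have [u1E|u1p] := eqVneq u1 0.
    by exists 0; split => // s s0 _; rewrite u1E invr_gt0.
  have {}u1p : 0 < u1 by rewrite lt_neqAle eq_sym u1p.
  exists (hfun A N u1^-1); split; first by rewrite ltW// h0.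
    by move=> E; rewrite E ltxx in u1p.
  move=> s s0 hs; rewrite ltNge; apply/negP => su.
  have : hfun A N s <= hfun A N u1^-1.
    apply: (hfun_le trip h0oo); first by rewrite invr_gt0.
    by rewrite -[leRHS]invrK lef_pV2 ?posrE ?invr_gt0.
  by rewrite leNgt hs.
exists u0; split => //.
pose K : R := 1 + d%:R * 96.
have K0 : 0 < K by rewrite ltr_pwDl// mulr_ge0.
(* t psi(z) >= c t Psi*(|z|) >= c^2 v^a t Psi*(r) >= (c^2 / K) v^a, as h(1/r) = 1/t. *)
pose k := c ^+ 2 / K.
have k0 : 0 < k by rewrite divr_gt0// exprn_gt0.
(* The power m is chosen with a m >= 2 d: then exp(-y) <= (m / y)^m at y = k v^a decays at least
   like v^(-2 d). *)
pose m := (Num.bound (2 * d%:R / a)).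
have ma : 2 * d%:R <= a * m%:R.
  rewrite (mulrC a) -ler_pdivrMr//; apply/ltW/archi_boundP.
  by rewrite divr_ge0 ?mulr_ge0 ?(ltW a0).
have m0 : (0 < m)%N.
  rewrite -(@ltr0n R) -(pmulr_rgt0 _ a0); apply: lt_le_trans ma.
  by rewrite mulr_gt0.
(* The 1 serves the region v <= 1, the other term the region v > 1. *)
pose B := Num.max 1 ((m%:R / k) ^+ m).
have B1 : 1 <= B by rewrite le_max lexx.
have B0 : 0 < B by exact: lt_le_trans B1.
exists (B * (2 * pi) ^+ d); first by rewrite mulr_gt0// exprn_gt0// mulr_gt0// pi_gt0.
move=> t t0 ut.
have it0 : 0 < t^-1 by rewrite invr_gt0.
have [s0 hs] := hinvP trip h0oo it0; set s := hinv A N t^-1 in s0 hs *.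
pose r := s^-1; have r0 : 0 < r by rewrite invr_gt0.
have ur : u1 < r by apply: hu => //; rewrite hs.
have hr : hfun A N r^-1 = t^-1 by rewrite invrK.
have -> : s ^- d = r ^+ d by rewrite exprVn.
have point z : expR (- t * psi z) <= B * r ^+ d * cauchy_rV r z.
  pose v := enorm z / r; have v0 : 0 <= v by rewrite divr_ge0 ?enorm_ge0 ?(ltW r0).
  have vz : v * r = enorm z by rewrite /v divfK ?gt_eqF.
  have low : (2 / (1 + v ^+ 2)) ^+ d <= r ^+ d * cauchy_rV r z.
    have pd (x : R) : x ^+ d = \prod_(i < d) x by rewrite prodr_const card_ord.
    rewrite /cauchy_rV !pd -big_split/=; apply: ler_prod => i _.
    rewrite divr_ge0 ?addr_ge0 ?sqr_ge0//=.
    have zi : z ord0 i ^+ 2 <= (v * r) ^+ 2.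
      rewrite vz -(real_normK (num_real (z ord0 i))) lerXn2r ?nnegrE ?enorm_ge0//.
      exact: coord_le_enorm.
    have -> : 2 / (1 + v ^+ 2) = r * (2 * r / (r ^+ 2 + (v * r) ^+ 2)).
      by field; rewrite !gt_eqF// ?ltr_pwDl ?exprn_gt0 ?sqr_ge0.
    rewrite ler_pM2l// /cauchy ler_pM2l ?mulr_gt0//.
    by rewrite lef_pV2 ?posrE ?ltr_pwDl ?exprn_gt0 ?sqr_ge0// lerD2l.
  rewrite -mulrA; apply: le_trans (ler_wpM2l (ltW B0) low).
  have w0 : 0 < 1 + v ^+ 2 by rewrite ltr_pwDl ?sqr_ge0.
  have [v1|v1] := leP v 1.
    apply: (@le_trans _ _ 1).
      by rewrite -expR0 ler_expR mulNr oppr_le0 mulr_ge0 ?(ltW t0) ?(rePsi_ge0 trip).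
    rewrite -[leLHS]mul1r ler_pM// ?exprn_ege1// ler_pdivlMr// mul1r.
    by have : v ^+ 2 <= 1 by [rewrite expr_le1]; lra.
  have zr : r < enorm z by rewrite -[ltLHS]mul1r -ltr_pdivlMr.
  have zu := lt_trans ur zr.
  have low2 : k * v `^ a <= t * psi z.
    have g1 := H1 z zu; have g2 := H2 v r (ltW v1) ur; rewrite vz in g2.
    have g3 := hfun_le_Psi_star trip r0; rewrite hr -/K in g3.
    have va := powR_ge0 v a.
    have g4 : c * (c * v `^ a * S r) <= psi z.
      by apply: le_trans g1; rewrite ler_pM2l.
    have g5 : t^-1 / K <= S r by rewrite ler_pdivrMr// mulrC.
    have -> : k * v `^ a = t * (c * (c * v `^ a * (t^-1 / K))).
      by rewrite /k; field; rewrite !gt_eqF.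
    by rewrite ler_pM2l// (le_trans _ g4)// ler_pM2l// ler_wpM2l// mulr_ge0 ?(ltW c0).
  have vp : 0 < v by rewrite (lt_trans _ v1).
  set y := k * v `^ a in low2.
  have y0 : 0 < y by rewrite mulr_gt0// powR_gt0.
  apply: (@le_trans _ _ (expR (- y))).
    by rewrite ler_expR mulNr lerN2.
  have ym := expr_le_expR m0 (ltW y0).
  have e1 : expR (- y) <= (m%:R / k) ^+ m / (v `^ a) ^+ m.
    rewrite expRN -[leLHS]mul1r ler_pdivrMr ?expR_gt0//.
    rewrite mulrAC ler_pdivlMr ?exprn_gt0 ?powR_gt0// mul1r.
    rewrite (exprMn m) exprVn mulrAC ler_pdivlMr ?exprn_gt0//.
    by rewrite -exprMn (mulrC (v `^ a)).
  have e2 : v ^+ (2 * d) <= (v `^ a) ^+ m.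
    rewrite -!powR_mulrn ?powR_ge0 ?(ltW vp)// -powRrM ler_powR ?(ltW v1)//.
    by rewrite natrM.
  have e3 : v ^- (2 * d) <= (2 / (1 + v ^+ 2)) ^+ d.
    rewrite exprM -exprVn lerXn2r ?nnegrE ?invr_ge0 ?sqr_ge0 ?divr_ge0 ?(ltW w0)//.
    rewrite -[leLHS]mul1r ler_pdivrMr ?exprn_gt0// mulrAC ler_pdivlMr// mul1r.
    by have : 1 <= v ^+ 2 by [rewrite expr_ge1 ?(ltW v1)]; lra.
  apply: (le_trans e1); apply: ler_pM => //.
  - by rewrite exprn_ge0// divr_ge0// ltW.
  - by rewrite invr_ge0 exprn_ge0// powR_ge0.
  - by rewrite le_max lexx orbT.
  - by rewrite (le_trans _ e3)// lef_pV2 ?posrE ?exprn_gt0 ?powR_gt0.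
apply: (@le_trans _ _ (\int[leb]_z ((B * r ^+ d)%:E * (cauchy_rV r (z - 0))%:E))%E).
  apply: ge0_le_integral => //.
  - by apply/measurable_EFinP; exact: measurable_expR_rePsi.
  - apply: measurable_funeM; apply/measurable_EFinP.
    under eq_fun do rewrite subr0; exact: measurable_cauchy_rV.
  - by move=> z _; rewrite -EFinM lee_fin subr0.
have Br : 0 <= B * r ^+ d by rewrite mulr_ge0 ?exprn_ge0 ?ltW.
rewrite ge0_integralZl_EFin//.
- by rewrite integral_cauchy_rV// -EFinM lee_fin mulrAC.
- by move=> z _; rewrite lee_fin cauchy_rV_ge0.
- apply/measurable_EFinP; under eq_fun do rewrite subr0; exact: measurable_cauchy_rV.
Qed.

End integral_conditions.

(** * Equivalence of (C1) and (C2) *)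

Section complex_exponential.
Context {R : realType}.
Local Open Scope complex_scope.

Lemma cexpE (w : R[i]) : cexp w =
  (expR (complex.Re w) * cos (complex.Im w)) +i* (expR (complex.Re w) * sin (complex.Im w)).
Proof. by rewrite /cexp; apply/eqP; rewrite eq_complex /= !mul0r subr0 addr0 !eqxx. Qed.

Lemma cexpD (v w : R[i]) : cexp (v + w) = cexp v * cexp w.
Proof.
case: v w => [a b] [a' b']; rewrite !cexpE/=; apply/eqP; rewrite eq_complex/=.
by rewrite expRD cosD sinD; apply/andP; split; apply/eqP; ring.
Qed.

End complex_exponential.

Section laws_from_exponent.
Context {disp : measure_display} {Omega : measurableType disp} {R : realType}.
Variables (P : probability Omega R) (d : nat).
Variables (A : 'M[R]_d) (N : {measure set 'rV[R]_d -> \bar R}) (b : 'rV[R]_d).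
Variable Y : R -> {mfun Omega >-> 'rV[R]_d}.
Hypothesis trip : generating_triplet A N b.
Hypothesis expo : has_exponent P Y (Psi A N b).
Local Notation leb := (lebesgue_rV R d).
Local Notation psi := (rePsi A N).

(** The phase of exp(-t Psi(z)), whose modulus is exp(-t psi(z)). *)
Let theta (t : R) (z : 'rV[R]_d) : R := - t * complex.Im (Psi A N b z).

Let exponentE (t : R) z : (- t%:C)%C * Psi A N b z = (- t * psi z +i* theta t z)%C.
Proof.
rewrite -(Re_Psi A N b) /theta; case: (Psi A N b z) => u v /=.
by apply/eqP; rewrite eq_complex/= oppr0 !mul0r subr0 addr0 !eqxx.
Qed.

Let mY t : measurable_fun setT (Y t). Proof. exact: measurable_funP. Qed.

Let cf_polar (t : R) (z : 'rV[R]_d) : 0 <= t ->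
  shifted_cf P (Y t) 0 0 z = expR (- t * psi z) * cos (theta t z) /\
  shifted_cf P (Y t) (- (pi / 2)) 0 z = expR (- t * psi z) * sin (theta t z).
Proof.
move=> t0; have := expo z t0; rewrite exponentE cexpE/= /cintegral => -[<- <-].
split; apply: eq_Rintegral => w _; rewrite !mul0r !mul1r !(add0r, oppr0, addr0) expR0 mul1r dotvC.
  by [].
by rewrite addrC cosB cos_pihalf sin_pihalf mulr0 add0r mulr1.
Qed.

Lemma shifted_cf_polar (t : R) a x z : 0 <= t ->
  shifted_cf P (Y t) a x z = expR (- t * psi z) * cos (a - dotv x z + theta t z).
Proof.
move=> t0; have [c s] := cf_polar z t0.
rewrite (shifted_cf_rotate _ (mY t)) c s.
rewrite (_ : a + pi / 2 - dotv x z = a - dotv x z + pi / 2); last by ring.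
by rewrite cosDpihalf [in RHS]cosD; ring.
Qed.

Lemma shifted_cf_le_heat (t : R) a x z : 0 <= t ->
  `|shifted_cf P (Y t) a x z| <= expR (- t * psi z).
Proof.
move=> t0; rewrite shifted_cf_polar// normrM ger0_norm ?expR_ge0//.
by rewrite ler_piMr ?expR_ge0// ler_norml cos_geN1 cos_le1.
Qed.

Lemma cf_sqrE (t : R) z : 0 <= t -> cf_sqr P (Y t) z = expR (- (2 * t) * psi z).
Proof.
move=> t0; have [c s] := cf_polar z t0.
rewrite /cf_sqr c s !exprMn -mulrDr cos2Dsin2 mulr1 -expRM_natl.
by congr expR; ring.
Qed.

Let shift_cexp (t : R) x z : 0 <= t ->
  cexp (- ('i%C * (dotv x z)%:C))%C * cexp ((- t%:C)%C * Psi A N b z) =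
  (shifted_cf P (Y t) 0 x z +i* shifted_cf P (Y t) (- (pi / 2)) x z)%C.
Proof.
move=> t0; rewrite -cexpD exponentE cexpE/= !(mul0r, mul1r, addr0, oppr0, add0r).
rewrite !shifted_cf_polar// sub0r -addrA (addrC (- (pi / 2))).
by rewrite cosB cos_pihalf sin_pihalf mulr0 add0r mulr1.
Qed.

(** By [shift_cexp] the complex inversion integrand has [shifted_cf] at phases 0 and - pi / 2 as
    real and imaginary part; the first integrates to the density up to (2 pi)^d, the second to 0. *)
Lemma inversion_transition_density (p : R -> 'rV[R]_d -> R) :
  (forall t, 0 < t -> leb.-integrable setT (EFin \o (fun z => expR (- t * psi z)))) ->
  (forall t, p t = inversion_density P (Y t)) ->
  transition_density P Y (Psi A N b) p.
Proof.
move=> ih pE t t0; have GX a x z := shifted_cf_le_heat a x z (ltW t0).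
rewrite !pE; split; first split.
- exact: inversion_density_ge0 (ih t t0) GX.
- exact: measurable_inversion_density (ih t t0) GX.
- by move=> B mB; exact: inversion_law (ih t t0) GX _ mB.
move=> _ x; rewrite /inversion_density.
rewrite (funext (fun z => shift_cexp x z (ltW t0))) /cintegral/=.
rewrite (integral_shifted_cf_sin (ih t t0) GX x).
by apply/eqP; rewrite eq_complex/= !mul0r mulr0 subr0 addr0 !eqxx.
Qed.

Hypothesis h0oo : hfun A N r @[r --> 0^'+] --> +oo.
Hypothesis d_gt0 : (0 < d)%N.

(** The squared modulus of the characteristic function brings in time 2 t, so the bound for the
    integral at time t has h^{-1}(2/t) in place of h^{-1}(1/t). Doubling, extracted from this same
    bound, gives h^{-1}(2/t) >= h^{-1}(1/t) / q, which costs the factor q^d. *)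
Lemma C2_at_of_C1 (T : \bar R) (u : R) :
  (forall t, 0 < t -> u < t^-1 -> (t%:E < T)%E) -> C1 P Y A N b T -> C2_at A N u.
Proof.
move=> uT [p [pd [c c0 pc]]].
pose C := c * (2 * pi) ^+ d.
have C0 : 0 < C by rewrite mulr_gt0// exprn_gt0// mulr_gt0// pi_gt0.
have tr t : 0 < t -> u < t^-1 ->
    (heat_trace A N (2 * t) <= (C * (hinv A N t^-1)^-1 ^+ d)%:E)%E.
  move=> t0 ut; have [[p0 mp pl] _] := pd t t0.
  pose S := c * hinv A N t^-1 ^- d.
  have pS x : 0 <= p t x <= S.
    rewrite p0/= -lee_fin; apply: le_trans (pc t t0 (uT t t0 ut)).
    by apply: ereal_sup_ubound; exists x.
  have := integral_cf_sqr_le mp pS pl.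
  rewrite /heat_trace (_ : C * _ = S * (2 * pi) ^+ d); last first.
    by rewrite /C /S exprVn mulrAC.
  congr (_ <= _)%E; apply: eq_integral => z _.
  by rewrite cf_sqrE// ltW.
have [q q1 Hq] := doubling_of_heat_trace trip d_gt0 C0.
have q0 : 0 < q by exact: lt_le_trans q1.
exists (C * q ^+ d); first by rewrite mulr_gt0// exprn_gt0.
move=> t t0 ut; have it0 : 0 < t^-1 by rewrite invr_gt0.
have [s0 hs] := hinvP trip h0oo it0; set s := hinv A N t^-1 in s0 hs *.
have t20 : 0 < t / 2 by rewrite divr_gt0.
have it20 : 0 < (t / 2)^-1 by rewrite invr_gt0.
have [s20 hs2] := hinvP trip h0oo it20.
have ut2 : u < (t / 2)^-1.
  by rewrite (lt_le_trans ut)// lef_pV2 ?posrE//; lra.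
have := tr _ t20 ut2; rewrite mulrC divfK//.
move: s20 hs2; set s2 := hinv A N (t / 2)^-1 => s20 hs2.
move=> /le_trans; apply.
rewrite lee_fin -mulrA ler_pM2l// -exprVn -exprMn lerXn2r// ?nnegrE.
- by rewrite invr_ge0 ltW.
- by rewrite divr_ge0 ?(ltW q0) ?(ltW s0).
have sq0 : 0 < s / q by rewrite divr_gt0.
rewrite -[leRHS]invrK invf_div lef_pV2 ?posrE// leNgt; apply/negP => s2q.
have := hfun_lt trip h0oo s20 s2q; rewrite hs2.
(* At r = 1/s and a = 2 t the product a h(1/r) equals 2, the largest value that
   [doubling_of_heat_trace] admits. *)
have := Hq (2 * t) s^-1 (mulr_gt0 (ltr0Sn _ 1) t0).
rewrite invr_gt0 s0 invrK hs -mulrA divff ?gt_eqF// mulr1 lexx => /(_ isT isT (tr t t0 ut)).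
have -> : (q / s)^-1 = s / q by rewrite invf_div.
by rewrite ltNge invf_div => ->.
Qed.

Lemma C1_of_C2_at (T : \bar R) (u : R) : 0 <= u ->
  (forall t, 0 < t -> (t%:E < T)%E -> u < t^-1) -> C2_at A N u -> C1 P Y A N b T.
Proof.
move=> u0 uT [c c0 H].
have ih t : 0 < t -> leb.-integrable setT (EFin \o (fun z => expR (- t * psi z))).
  (* A density is required at all t > 0 while the bound covers small times only; exp(-t psi) <=
     exp(-t1 psi) with t1 <= t in the admissible range closes the gap. *)
  move=> t0; pose t1 := Num.min t (u + 1)^-1.
  have u10 : 0 < u + 1 by rewrite ltr_wpDl.
  have t10 : 0 < t1 by rewrite lt_min t0 invr_gt0.
  have ut1 : u < t1^-1.
    rewrite (@lt_le_trans _ _ (u + 1)) ?ltrDl// -[leLHS]invrK.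
    by rewrite lef_pV2 ?posrE ?invr_gt0// ge_min lexx orbT.
  apply/integrableP; split; first exact: ((measurable_EFinP _ _).2 (measurable_expR_rePsi trip _)).
  apply: le_lt_trans (ltry (c * hinv A N t1^-1 ^- d)).
  apply: le_trans (H t1 t10 ut1); apply: ge0_le_integral => //.
  - apply: measurableT_comp => //; exact: ((measurable_EFinP _ _).2 (measurable_expR_rePsi trip _)).
  - exact: ((measurable_EFinP _ _).2 (measurable_expR_rePsi trip _)).
  move=> z _; rewrite /= lee_fin ger0_norm ?expR_ge0// ler_expR !mulNr lerN2.
  by rewrite ler_wpM2r ?(rePsi_ge0 trip)// ge_min lexx.
exists (fun t => inversion_density P (Y t)); split.
  exact: inversion_transition_density.
exists ((2 * pi) ^- d * c).
  by rewrite mulr_gt0// invr_gt0 exprn_gt0// mulr_gt0// pi_gt0.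
move=> t t0 tT; apply: ge_ereal_sup => _ [x _ <-]; rewrite lee_fin.
have GX a y z := shifted_cf_le_heat a y z (ltW t0).
rewrite (le_trans (inversion_density_le (ih t t0) GX x))//.
rewrite -mulrA ler_wpM2l//.
  by rewrite invr_ge0 exprn_ge0// mulr_ge0// pi_ge0.
rewrite -lee_fin; apply: le_trans (H t t0 (uT t t0 tT)).
by rewrite /Rintegral fineK// (integrable_fin_num measurableT (ih t t0)).
Qed.

End laws_from_exponent.

(** * Passage between T and 1/T, and assembly of the equivalences *)

Section real_parameter.
Context {R : realType}.

Lemma inve_fin_num (T : \bar R) : (0 < T)%E -> exists2 u : R, 0 <= u & T^-1%E = u%:E.
Proof.
case: T => [r| |]//=; last by rewrite invey => _; exists 0.
rewrite lte_fin => r0; exists r^-1; first by rewrite invr_ge0 ltW.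
by rewrite inver gt_eqF.
Qed.

Lemma lte_inve (T : \bar R) (u t : R) : (0 < T)%E -> T^-1%E = u%:E -> 0 < t ->
  (t%:E < T)%E = (u < t^-1).
Proof.
move=> T0 Tu t0; rewrite -lte_fin -Tu (_ : t^-1%:E = t%:E^-1)%E; last by rewrite inver gt_eqF.
by rewrite lte_pV2// inE /= ?lee_fin ltW.
Qed.

Lemma exists_inve (u : R) : 0 <= u ->
  exists T : \bar R, [/\ (0 < T)%E, T^-1%E = u%:E & u = 0 -> T = +oo%E].
Proof.
move=> u0; exists (u%:E^-1)%E; rewrite inveK; split=> [||->]//; last by rewrite inve0.
by rewrite inver; case: eqVneq => [_|un0]; rewrite ?lt0y// lte_fin invr_gt0 lt0r un0.
Qed.

End real_parameter.

Section conditions_at.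
Context {R : realType} {d : nat}.
Variables (A : 'M[R]_d) (N : {measure set 'rV[R]_d -> \bar R}) (b : 'rV[R]_d).
Variables (T : \bar R) (u : R).
Hypothesis T0 : (0 < T)%E.
Hypothesis Tu : T^-1%E = u%:E.

Lemma C2_atP : C2 A N b T <-> C2_at A N u.
Proof.
have E t : (\int[lebesgue_rV R d]_z (expR (- t * complex.Re (Psi A N b z)))%:E =
    \int[lebesgue_rV R d]_z (expR (- t * rePsi A N z))%:E)%E.
  by apply: eq_integral => z _; rewrite Re_Psi.
split => -[c c0 H]; exists c => // t t0 tT.
  by rewrite -E; apply: H => //; rewrite (lte_inve T0 Tu).
by rewrite E; apply: H => //; rewrite -(lte_inve T0 Tu).
Qed.

Lemma C3_atP : C3 A N b T <-> C3_at A N b u.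
Proof.
split => -[c [a [c01 a02 H1 H2]]]; exists c, a; split => //.
- by move=> x ux; rewrite -(Re_Psi A N b); apply: H1; rewrite Tu lte_fin.
- by move=> l r l1 ur; apply: H2 => //; rewrite Tu lte_fin.
- by move=> x; rewrite Tu lte_fin (Re_Psi A N b); exact: H1.
- by move=> l r l1; rewrite Tu lte_fin; exact: H2.
Qed.

Lemma C4_atP : C4 A N b T <-> C4_at A N b u.
Proof.
by split => -[c c1 H]; exists c => // x; have := H x; rewrite Tu lte_fin.
Qed.

End conditions_at.

Theorem theorem3p1 (R : realType) (disp : measure_display)
    (Omega : measurableType disp) (P : probability Omega R)
    (d : nat) (d_gt0 : (0 < d)%N)
    (A : 'M[R]_d) (N : {measure set 'rV[R]_d -> \bar R}) (b : 'rV[R]_d)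
    (Y : R -> {mfun Omega >-> 'rV[R]_d}) :
  levy_process P Y ->
  generating_triplet A N b ->
  has_exponent P Y (Psi A N b) ->
  hfun A N r @[r --> 0^'+] --> +oo ->
  [<-> (exists2 T : \bar R, (0 < T)%E & C1 P Y A N b T);
       (exists2 T : \bar R, (0 < T)%E & C2 A N b T);
       (exists2 T : \bar R, (0 < T)%E & C3 A N b T);
       (exists2 T : \bar R, (0 < T)%E & C4 A N b T)] /\
  ([\/ C1 P Y A N b +oo%E, C2 A N b +oo%E, C3 A N b +oo%E | C4 A N b +oo%E] ->
   [/\ C1 P Y A N b +oo%E, C2 A N b +oo%E, C3 A N b +oo%E & C4 A N b +oo%E]).
Proof.
move=> _ trip expo h0oo.
have C12 (T : \bar R) : (0 < T)%E -> C1 P Y A N b T -> C2 A N b T.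
  move=> T0 H; have [u u0 Tu] := inve_fin_num T0; apply/(C2_atP _ _ _ T0 Tu).
  by apply: (C2_at_of_C1 trip expo h0oo d_gt0 _ H) => t t0; rewrite (lte_inve T0 Tu).
have C21 (T : \bar R) : (0 < T)%E -> C2 A N b T -> C1 P Y A N b T.
  move=> T0; have [u u0 Tu] := inve_fin_num T0 => /(C2_atP _ _ _ T0 Tu).
  by apply: (C1_of_C2_at trip expo u0) => t t0; rewrite (lte_inve T0 Tu).
(* T' differs from T in general, so the value oo is tracked separately for the final claim. *)
have C23 (T : \bar R) : (0 < T)%E -> C2 A N b T ->
    exists T', [/\ (0 < T')%E, T = +oo%E -> T' = +oo%E & C3 A N b T'].
  move=> T0; have [u u0 Tu] := inve_fin_num T0 => /(C2_atP _ _ _ T0 Tu).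
  move=> /(C3_at_of_C2_at trip h0oo d_gt0 u0)[v [v0 vu H]].
  have [T' [T'0 T'v T'oo]] := exists_inve v0.
  exists T'; split => //; last exact/(C3_atP _ _ _ T'v).
  by move=> Too; apply/T'oo/vu; move: Tu; rewrite Too invey => -[].
have C32 (T : \bar R) : (0 < T)%E -> C3 A N b T ->
    exists T', [/\ (0 < T')%E, T = +oo%E -> T' = +oo%E & C2 A N b T'].
  move=> T0; have [u u0 Tu] := inve_fin_num T0 => /(C3_atP _ _ _ Tu).
  move=> /(C2_at_of_C3_at trip h0oo d_gt0 u0)[v [v0 vu H]].
  have [T' [T'0 T'v T'oo]] := exists_inve v0.
  exists T'; split => //; last exact/(C2_atP _ _ _ T'0 T'v).
  by move=> Too; apply/T'oo/vu; move: Tu; rewrite Too invey => -[].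
have C34 (T : \bar R) : (0 < T)%E -> C3 A N b T -> C4 A N b T.
  move=> T0; have [u u0 Tu] := inve_fin_num T0 => /(C3_atP _ _ _ Tu) H.
  exact/(C4_atP _ _ _ Tu)/(C4_at_of_C3_at trip h0oo u0).
have C43 (T : \bar R) : (0 < T)%E -> C4 A N b T -> C3 A N b T.
  move=> T0; have [u u0 Tu] := inve_fin_num T0 => /(C4_atP _ _ _ Tu) H.
  exact/(C3_atP _ _ _ Tu)/(C3_at_of_C4_at trip h0oo d_gt0 u0).
split.
  tfae.
  - by move=> [T T0 /(C12 _ T0)]; exists T.
  - by move=> [T T0 /(C23 _ T0)[T' [T'0 _ H]]]; exists T'.
  - by move=> [T T0 /(C34 _ T0)]; exists T.
  - move=> [T T0 /(C43 _ T0)/(C32 _ T0)[T' [T'0 _ H]]]; exists T' => //.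
    exact: C21.
have oo : (0 < +oo :> \bar R)%E by exact: lt0y.
have D12 := C12 _ oo; have D21 := C21 _ oo; have D34 := C34 _ oo; have D43 := C43 _ oo.
have D23 : C2 A N b +oo -> C3 A N b +oo by move=> /(C23 _ oo)[T [_ -> //]].
have D32 : C3 A N b +oo -> C2 A N b +oo by move=> /(C32 _ oo)[T [_ -> //]].
by case=> H; split; auto.
Qed.
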